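(* There is a constant $C_{B,\mathbf M}$, depending only on $B$, on $\mathbf M=(\overline M_1,\dots,\overline M_K)$ and on the rate of convergence of $M_i/\sum_{l=1}^n D_l$ to $\overline M_i$, such that the following holds. Consider a sequence (indexed by $n$) of degree-corrected stochastic block models on $V=\{1,\dots,n\}$ with parameters $B$, $\boldsymbol\alpha$ (fixed), labels $\{\sigma_u\}_{u=1}^n$ and weights $0<D_1\le D_2\le\dots\le D_n$ (depending on $n$), such that: (i) $\frac{D_uD_v}{n\overline D}B_{\sigma_u\sigma_v}\le 1$ for all $u,v$; (ii) for every $i\in\{1,\dots,K\}$, $\overline D_i/\overline D\to d_i$ as $n\to\infty$ for some non-zero constant $d_i$; (iii) for all $i\ne l$ there exists $j$ such that $\frac{B_{ij}}{\overline M_i}\neq\frac{B_{lj}}{\overline M_l}$; (iv) $D_1^2/\overline D=\Omega(\log n)$; (v) either $\lim_{n\to\infty}D_1/\log n=\infty$, or both $D_1\ge C_{B,\mathbf M}\log n$ and, for some constant $c<1/2$, $\lim_{n\to\infty}D_n^2/n^c=0$. Let $\widehat z_u$ ($u\in V$) be the spectral embedding vectors of the observed graph, and let $P$, $W=\widehat H-P$ and $\Delta(P)$ be as defined in the context. Then, with high probability, there exist $K$ vectors $\{t_k\}_{k\in S}$ (block-representatives, possibly depending on $n$) such that $$\|\sqrt n\,\widehat z_u-t_{\sigma_u}\|=\mathcal O\left(\left(\frac{\rho(W)}{\Delta(P)}\right)^{2/3}\right)=o(1)$$ for all but $\mathcal O\left(n\left(\frac{\rho(W)}{\Delta(P)}\right)^{2/3}\right)$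 nodes $u\in V$.
   Context: Degree-corrected stochastic block model. $K$ is a fixed number of communities, $S=\{1,\dots,K\}$; $B$ is a fixed symmetric $K\times K$ matrix with nonnegative real entries, independent of $n$; $\boldsymbol\alpha=(\alpha_1,\dots,\alpha_K)$ is a fixed vector of positive numbers summing to $1$. Each vertex $u\in V=\{1,\dots,n\}$ has a label $\sigma_u\in S$, with exactly $\alpha_kn$ vertices of label $k$, and a weight $D_u>0$. Labels and weights may depend on $n$. Write $\overline D=\frac1n\sum_{l=1}^nD_l$ and $\overline D_i=\frac1{\alpha_in}\sum_{u:\sigma_u=i}D_u$. The random graph has, independently for each unordered pair $u\ne v$, an edge with probability $\frac{D_uD_v}{n\overline D}B_{\sigma_u\sigma_v}$; there are no loops. $A$ is its adjacency matrix and $\widehat D_u=\sum_vA_{uv}$ is the observed degree of $u$. Put $M_i=\sum_{l=1}^nD_lB_{i\sigma_l}$ and $\overline M_i=\lim_{n\to\infty}M_i/\sum_{l}D_l=\sum_{k=1}^KB_{ik}\alpha_kd_k$, where $d_i=\lim\overline D_i/\overline D$; it is understood that $\overline M_i>0$. $\rho(X)$ denotes the spectral radius of $X$. ''With high probability'' means with probability tending to $1$ as $n\to\infty$, with constants in $\mathcal O$ independent of $n$. Matrices: $\widehat H_{uv}=\frac{1}{\widehat D_u\widehat D_v}$ if $A_{uv}=1$ and $\widehat H_{uv}=0$ otherwise; $P_{uv}=\frac1{n\overline D}\frac{B_{\sigma_u\sigma_v}}{\overline M_{\sigma_u}\overline M_{\sigma_v}}$; $W=\widehat H-P$; $\Delta(P)=\min\{|\lambda-\mu|:\lambda\ne\mu,\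 \lambda,\mu\text{ eigenvalues of }P\}$. Spectral embedding. If $D_1/\log n\to\infty$, let $f$ be any function tending to $0$ with $f(n)\gg\frac1{\widehat D_1}+\frac1{\sqrt{\log n}}+\sqrt{\frac{\log n}{\widehat D_1}}$; in the other regime of (v), let $f$ be any function tending to $0$ with $f(n)\gg\frac1{\widehat D_1}+\frac1{\sqrt{\log n}}+\frac1{\log^{1/3}n}$ (where $a(n)\gg b(n)$ means $a(n)/b(n)\to\infty$, in probability since $\widehat D_1$ is random). Let $\widehat D_{\mathrm{average}}$ be the average degree of the observed graph and $\widehat L$ the number of eigenvalues of $\widehat H$ larger in absolute value than $f(n)/\widehat D_{\mathrm{average}}$. Let $\widehat x_1,\dots,\widehat x_{\widehat L}$ be orthonormal eigenvectors of $\widehat H$ corresponding to its $\widehat L$ eigenvalues largest in absolute value, and $\widehat z_u=(\widehat x_1(u),\dots,\widehat x_{\widehat L}(u))$. *)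

(* Defs.v *)
From HB Require Import structures.
From mathcomp Require Export all_boot all_order all_algebra.
From mathcomp Require Export all_classical all_reals all_analysis.
Export Order.TTheory GRing.Theory Num.Theory.
Export numFieldNormedType.Exports.

Set Implicit Arguments.
Unset Strict Implicit.
Unset Printing Implicit Defensive.

Local Open Scope classical_set_scope.
Local Open Scope ring_scope.

(* Only used for real symmetric matrices, all of whose complex eigenvalues are
   real; hence real eigenvalues suffice. *)
Definition spectral_radius (R : realType) (n : nat) (X : 'M[R]_n) : R :=
  sup [set `|a| | a in [set a : R | eigenvalue X a]].

(* The set of gaps is finite; it is nonempty unless X has only one eigenvalue,
   in which case the value is inf set0 = 0. *)
Definition eigengap (R : realType) (n : nat) (X : 'M[R]_n) : R :=
  inf [set g : R | exists a b : R,
         [/\ a != b, eigenvalue X a, eigenvalue X b & g = `|a - b|]].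

(* Counted with (algebraic) multiplicity. *)
Definition nb_large_eigenvalues (R : realType) (n : nat) (X : 'M[R]_n)
    (thr : R) : nat :=
  \big[addn/0%N]_(a \in [set a : R | eigenvalue X a /\ thr < `|a|])
     mup a (char_poly X).

Definition euclid_norm (R : realType) (n : nat) (v : 'rV[R]_n) : R :=
  Num.sqrt (\sum_j v 0 j ^+ 2).

(* Graphs on n vertices are the symmetric boolean matrices with zero diagonal. *)
Definition simple_graph (n : nat) (A : 'M[bool]_n) : bool :=
  [forall u, ~~ A u u] && [forall u, forall v, A u v == A v u].

(* Probability of E for the random graph in which the pairs u < v are
   independently joined with probability p u v. *)
Definition graph_pr (R : realType) (n : nat) (p : 'M[R]_n)
    (E : 'M[bool]_n -> Prop) : R :=
  \sum_(A : 'M[bool]_n | simple_graph A && `[< E A >])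
    \prod_(u < n) \prod_(v < n | (u < v)%N)
      (if A u v then p u v else 1 - p u v).

Definition whp (R : realType) (n : nat -> nat) (p : forall m, 'M[R]_(n m))
    (E : forall m, 'M[bool]_(n m) -> Prop) : Prop :=
  graph_pr (p m) (E m) @[m --> \oo] --> (1 : R).

Section Model.
Context {R : realType} {K n : nat}.
Implicit Types (B : 'M[R]_K) (M : 'I_K -> R).
Implicit Types (sigma : 'I_n -> 'I_K) (D : 'I_n -> R).
Implicit Types (A : 'M[bool]_n).

Definition avg_weight D : R := (\sum_u D u) / n%:R.

Definition block_avg_weight (alpha : 'I_K -> R) sigma D (i : 'I_K) : R :=
  (\sum_(u | sigma u == i) D u) / (alpha i * n%:R).

Definition edge_prob B sigma D : 'M[R]_n :=
  \matrix_(u, v) (D u * D v / (n%:R * avg_weight D) * B (sigma u) (sigma v)).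

Definition Mvol B sigma D (i : 'I_K) : R := \sum_u D u * B i (sigma u).

Definition degree A (u : 'I_n) : nat := (\sum_v A u v)%N.

Definition avg_degree A : R := (\sum_u (degree A u)%:R) / n%:R.

Definition Hhat A : 'M[R]_n :=
  \matrix_(u, v) (if A u v then ((degree A u)%:R * (degree A v)%:R)^-1 else 0).

Definition Pmx B M sigma D : 'M[R]_n :=
  \matrix_(u, v) ((n%:R * avg_weight D)^-1 *
    (B (sigma u) (sigma v) / (M (sigma u) * M (sigma v)))).

Definition Wmx B M sigma D A : 'M[R]_n := Hhat A - Pmx B M sigma D.

(* The columns of X are orthonormal eigenvectors of Hhat A; row u of X is the
   embedding vector of vertex u.  As L is the number of all eigenvalues above
   the threshold, L orthonormal eigenvectors with eigenvalues above it are
   exactly eigenvectors for the L largest eigenvalues in absolute value.  For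
   the empty graph the threshold is x / 0 = 0, and then L = 0. *)
Definition spectral_embedding A (fn : R) (L : nat) (X : 'M[R]_(n, L)) : Prop :=
  let thr := fn / avg_degree A in
  [/\ L = nb_large_eigenvalues (Hhat A) thr,
      X^T *m X = 1%:M &
      forall j : 'I_L, exists2 a : R,
        thr < `|a| & Hhat A *m col j X = a *: col j X].

(* (rho(W) / Delta(P)) ^ (2/3) *)
Definition embedding_error B M sigma D A : R :=
  (spectral_radius (Wmx B M sigma D A) / eigengap (Pmx B M sigma D))
    `^ (2%:R / 3%:R).

End Model.

(* Main.v *)
(* Write m_i = M_i / sum_l D_l for the finite-n averages and let P' be P with the
   limits replaced by m.  The normalised adjacency matrix is E (Y + P') E off the
   diagonal, where Y is a centred matrix with independent entries and E = diag of
   expected over observed degrees.  Three facts give |W| = o(1 / average weight):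

   - |Y| = O(1 / (Dbar sqrt (log n))) with no logarithmic loss, by the trace method
     with about log n moments: a closed walk contributes only if each of its edges
     is traversed at least twice; grouping walks by shape, the sum is compared with
     the same trace for a dense matrix of size about 2 log n with independent
     entries in {2, -1}, whose norm is controlled by rounding its top eigenvector
     to integer vectors and an exponential moment bound;
   - E is bounded since all degrees are at least a fixed fraction of their means,
     and its mean square deviation from 1 is O(1 / log n);
   - P' and P differ only by a block-constant rescaling tending to 1, so the slow
     convergence of M_i does not interfere with the rank.

   An eigenvalue of Hhat above the threshold is then of the order of the
   eigenvalues of P, because |x P' P'| >= c |x P'| / Dbar; if x is its eigenvector,
   x P / a is constant on blocks and within |W| / |a| of x, and Bessel's inequality
   bounds the number of such eigenvectors by 9 K. *)

Require Import Defs.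
From mathcomp Require Import ring lra zify.

Set Implicit Arguments.
Unset Strict Implicit.
Unset Printing Implicit Defensive.

Local Open Scope classical_set_scope.
Local Open Scope ring_scope.

(** * Euclidean norm and symmetric matrices *)

(** The threshold defining [L] is [f] over the average degree, and [f] dominates [1 / sqrt (log n)]
    possibly by an arbitrarily slow factor. A noise bound losing a power of [log n] could not
    exclude noise eigenvalues above the threshold; hence the sharp trace estimate. The slow factor
    is measured by [h = (f sqrt (log n)) ^ (1/4)], which tends to infinity and is the slack spent in
    the moment bounds for the degrees. Two comparison matrices appear because [M_i] may converge
    more slowly than [f] tends to 0: [Hhat - P'] has to stay below the threshold, whereas [Hhat - P]
    has to be small against the gap of [P], which is of order [1 / Dbar]. Spectral facts about [P]
    reduce to [K x K] matrices independent of [n], so their constants are uniform. The exponent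
    [2/3] is a balance: a mean square distance of order [delta ^ 2] allows a fraction
    [delta ^ 2 / err ^ 2] of the vertices at distance above [err], and this fraction equals [err]
    for [err = delta ^ (2/3)]. *)

Section RowVectors.
Context {R : realType}.

Definition dot n (u v : 'rV[R]_n) : R := \sum_j u 0 j * v 0 j.

Lemma dotE n (u v : 'rV[R]_n) : dot u v = (u *m v^T) 0 0.
Proof. by rewrite mxE; apply: eq_bigr => j _; rewrite mxE. Qed.

Lemma dotC n (u v : 'rV[R]_n) : dot u v = dot v u.
Proof. by apply: eq_bigr => j _; rewrite mulrC. Qed.

Lemma dotDl n (u v w : 'rV[R]_n) : dot (u + v) w = dot u w + dot v w.
Proof. by rewrite !dotE mulmxDl mxE. Qed.

Lemma dotZl n (c : R) (u w : 'rV[R]_n) : dot (c *: u) w = c * dot u w.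
Proof. by rewrite !dotE -scalemxAl mxE. Qed.

Lemma dotDr n (u v w : 'rV[R]_n) : dot w (u + v) = dot w u + dot w v.
Proof. by rewrite dotC dotDl !(dotC w). Qed.

Lemma dotZr n (c : R) (u w : 'rV[R]_n) : dot w (c *: u) = c * dot w u.
Proof. by rewrite dotC dotZl dotC. Qed.

Lemma dotNl n (u w : 'rV[R]_n) : dot (- u) w = - dot u w.
Proof. by rewrite -scaleN1r dotZl mulN1r. Qed.

Lemma dotNr n (u w : 'rV[R]_n) : dot w (- u) = - dot w u.
Proof. by rewrite dotC dotNl dotC. Qed.

Lemma dot_ge0 n (u : 'rV[R]_n) : 0 <= dot u u.
Proof. by apply: sumr_ge0 => j _; rewrite -expr2 sqr_ge0. Qed.

Lemma dot_eq0 n (u : 'rV[R]_n) : dot u u = 0 -> u = 0.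
Proof.
move=> /eqP; rewrite psumr_eq0 => [/allP u0|j _]; last by rewrite -expr2 sqr_ge0.
apply/rowP => j; rewrite mxE.
by have := u0 j (mem_index_enum _); rewrite /= mulf_eq0 orbb => /eqP.
Qed.

Lemma dot_mulmx n m (u : 'rV[R]_n) (W : 'M[R]_(n, m)) v :
  dot (u *m W) v = dot u (v *m W^T).
Proof. by rewrite !dotE trmx_mul trmxK mulmxA. Qed.

Lemma euclid_norm_sqr n (u : 'rV[R]_n) : euclid_norm u ^+ 2 = dot u u.
Proof.
have E : \sum_j u 0 j ^+ 2 = dot u u by apply: eq_bigr => j _; rewrite expr2.
by rewrite /euclid_norm E sqr_sqrtr ?dot_ge0.
Qed.

Lemma euclid_norm_ge0 n (u : 'rV[R]_n) : 0 <= euclid_norm u.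
Proof. exact: sqrtr_ge0. Qed.

Lemma euclid_norm_le n (u : 'rV[R]_n) c :
  0 <= c -> (euclid_norm u <= c) = (dot u u <= c ^+ 2).
Proof. by move=> c0; rewrite -euclid_norm_sqr ler_sqr ?nnegrE ?euclid_norm_ge0. Qed.

Lemma cauchy_schwarz n (u v : 'rV[R]_n) : dot u v ^+ 2 <= dot u u * dot v v.
Proof.
have [v0|v0] := eqVneq (dot v v) 0.
  by rewrite (dot_eq0 v0) dotC -(scale0r 0) dotZl mul0r expr0n /= dotZl !mul0r mulr0.
have vp : 0 < dot v v by rewrite lt_def v0 dot_ge0.
have := dot_ge0 (dot v v *: u - dot u v *: v).
rewrite !(dotDl, dotDr, dotNl, dotNr, dotZl, dotZr) (dotC v u).
set a := dot u u; set b := dot v v; set c := dot u v => h.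
have {h} : 0 <= b * (a * b - c ^+ 2) by move: h; congr (_ <= _); ring.
by rewrite pmulr_rge0 // subr_ge0.
Qed.

Lemma normr_dot n (u v : 'rV[R]_n) :
  `|dot u v| <= euclid_norm u * euclid_norm v.
Proof.
rewrite -ler_sqr ?nnegrE ?mulr_ge0 ?euclid_norm_ge0 //.
by rewrite exprMn !euclid_norm_sqr real_normK ?num_real ?cauchy_schwarz.
Qed.

Lemma euclid_normD n (u v : 'rV[R]_n) :
  euclid_norm (u + v) <= euclid_norm u + euclid_norm v.
Proof.
rewrite euclid_norm_le ?addr_ge0 ?euclid_norm_ge0 //.
rewrite dotDl !dotDr sqrrD !euclid_norm_sqr (dotC v u).
have := ler_norm (dot u v); have := normr_dot u v; lra.
Qed.

Lemma euclid_normZ n c (u : 'rV[R]_n) :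
  euclid_norm (c *: u) = `|c| * euclid_norm u.
Proof.
apply/eqP; rewrite -(@eqrXn2 _ 2) ?mulr_ge0 ?euclid_norm_ge0 //.
by rewrite exprMn !euclid_norm_sqr dotZl dotZr real_normK ?num_real // mulrA.
Qed.

Lemma euclid_normN n (u : 'rV[R]_n) : euclid_norm (- u) = euclid_norm u.
Proof. by rewrite -scaleN1r euclid_normZ normrN1 mul1r. Qed.

Lemma euclid_normB n (u v : 'rV[R]_n) :
  euclid_norm (u - v) <= euclid_norm u + euclid_norm v.
Proof. by rewrite -(euclid_normN v) euclid_normD. Qed.

Lemma euclid_norm_eq0 n (u : 'rV[R]_n) : euclid_norm u = 0 -> u = 0.
Proof. by move=> h; apply: dot_eq0; rewrite -euclid_norm_sqr h expr0n. Qed.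

Lemma euclid_norm1 n (u : 'rV[R]_n) : dot u u = 1 -> euclid_norm u = 1.
Proof.
move=> u1; apply/eqP; rewrite -(@eqrXn2 _ 2) ?euclid_norm_ge0 //.
by rewrite euclid_norm_sqr u1 expr1n.
Qed.

(** Cauchy-Schwarz in each column. It serves the matrices that are controlled entrywise rather than
    spectrally. *)
Lemma frobenius_bound m n (W : 'M[R]_(m, n)) c (v : 'rV[R]_m) :
  0 <= c -> \sum_i \sum_j W i j ^+ 2 <= c ^+ 2 ->
  euclid_norm (v *m W) <= c * euclid_norm v.
Proof.
move=> c0 hW; rewrite euclid_norm_le ?mulr_ge0 ?euclid_norm_ge0 //.
rewrite exprMn euclid_norm_sqr.
apply: le_trans (_ : (\sum_i \sum_j W i j ^+ 2) * dot v v <= _); last first.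
  by rewrite ler_wpM2r ?dot_ge0.
rewrite exchange_big /= mulr_suml; apply: ler_sum => j _.
have -> : \sum_i W i j ^+ 2 = dot (col j W)^T (col j W)^T.
  by apply: eq_bigr => i _; rewrite !mxE expr2.
have -> : (v *m W) 0 j = dot v (col j W)^T.
  by rewrite mxE; apply: eq_bigr => i _; rewrite !mxE.
by rewrite -expr2 [leRHS]mulrC cauchy_schwarz.
Qed.

End RowVectors.

(** * Extremal eigenvectors; the spectral radius as operator norm and its comparison with traces *)

Section SymmetricMatrices.
Context {R : realType}.

Lemma cvg_sum (T : Type) (F : set_system T) {FF : Filter F} (I : Type)
    (r : seq I) (f : I -> T -> R) (l : I -> R) :
  (forall i, f i x @[x --> F] --> l i) ->
  \sum_(i <- r) f i x @[x --> F] --> \sum_(i <- r) l i.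
Proof.
move=> h; elim: r => [|i r IH].
  rewrite big_nil (_ : (fun _ => _) = cst 0); first exact: cvg_cst.
  by apply/funext => x; rewrite big_nil.
rewrite big_cons (_ : (fun _ => _) = f i \+ fun x => \sum_(i <- r) f i x).
  exact: cvgD.
by apply/funext => x; rewrite big_cons.
Qed.

Lemma continuous_dot_mulmx n p (U : 'M[R]_(n, p)) (V : 'M[R]_(n, p)) :
  continuous (fun v : 'rV[R]_n => dot (v *m U) (v *m V)).
Proof.
have cU (W : 'M[R]_(n, p)) j : continuous (fun v : 'rV[R]_n => (v *m W) 0 j).
  move=> v; rewrite (_ : (fun _ => _) = fun v : 'rV[R]_n => \sum_i v 0 i * W i j).
    apply: (cvg_sum (F := nbhs v)) => i; apply: cvgMl.
    exact: coord_continuous.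
  by apply/funext => u; rewrite mxE.
move=> v; apply: (cvg_sum (F := nbhs v)) => j; apply: cvgM; exact: cU.
Qed.

Lemma sphere_max n (f : 'rV[R]_n.+1 -> R) : continuous f ->
  exists2 x, dot x x = 1 & forall y, dot y y = 1 -> f y <= f x.
Proof.
move=> cf; pose S := [set x : 'rV[R]_n.+1 | dot x x = 1].
have cd : continuous (fun x : 'rV[R]_n.+1 => dot x x).
  move=> x; have := @continuous_dot_mulmx n.+1 n.+1 1%:M 1%:M x.
  rewrite (_ : (fun v : 'rV_ _ => _) = fun x => dot x x) //.
  by apply/funext => u; rewrite !mulmx1.
have [|||x xS xmax] := @EVT_max_rV R n.+1 f S.
- exists (delta_mx 0 0); rewrite /S /= /dot (bigD1 ord0) //= big1 => [|j /negPf j0].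
    by rewrite !mxE eqxx mulr1 addr0.
  by rewrite !mxE j0 mul0r.
- apply: (@subclosed_compact _ S
    [set v : 'rV[R]_n.+1 | forall i, `[-1, 1]%classic (v 0 i)]).
  + apply: (preimage_closed (f := fun x : 'rV[R]_n.+1 => dot x x) (D := [set 1])).
      by move=> x _; exact: cd.
    exact/accessible_closed_set1/hausdorff_accessible/norm_hausdorff.
  + exact: (@rV_compact R _ (fun=> `[-1, 1]%classic)
      (fun=> @segment_compact _ _ _)).
  + move=> x x1 i /=; rewrite in_itv /= -ler_norml.
    rewrite -(@ler_pXn2r _ 2) ?nnegrE // expr1n -normrX ger0_norm ?sqr_ge0 //.
    rewrite -x1 /dot (bigD1 i) //= -expr2 lerDl.
    by apply: sumr_ge0 => j _; rewrite -expr2 sqr_ge0.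
- exact: continuous_subspaceT.
exists x => [|y y1]; first by move: xS; rewrite inE.
by apply: xmax; rewrite inE.
Qed.

(** A unit [x] maximising [|x W|] satisfies [x W W = s2 x] by a variational argument. Then
    [z = x W + s x] satisfies [z W = s z]: either [z] is an eigenvector for [s], or it vanishes and
    [x] is one for [- s]. *)
Lemma sym_eigen_max n (W : 'M[R]_n.+1) : W^T = W ->
  exists a x, [/\ dot x x = 1, x *m W = a *: x &
    forall v, euclid_norm (v *m W) <= `|a| * euclid_norm v].
Proof.
move=> Wsym.
have [x x1 xmax] := sphere_max (@continuous_dot_mulmx _ _ W W).
pose s2 := dot (x *m W) (x *m W); have s20 : 0 <= s2 by exact: dot_ge0.
have bnd y : dot (y *m W) (y *m W) <= s2 * dot y y.
  have [y0|y0] := eqVneq (dot y y) 0.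
    by rewrite (dot_eq0 y0) mul0mx -(scale0r 0) !dotZl !mul0r mulr0.
  have yp : 0 < dot y y by rewrite lt_def y0 dot_ge0.
  have := xmax ((euclid_norm y)^-1 *: y).
  rewrite -!scalemxAl !dotZl !dotZr -/s2 !mulrA.
  rewrite -invfM -expr2 euclid_norm_sqr mulVf // => /(_ erefl).
  by rewrite mulrC ler_pdivrMr.
have [y yE] : exists y, y = s2 *: x - x *m W *m W by exists (s2 *: x - x *m W *m W).
have y0 : y = 0.
  apply: dot_eq0; pose c := s2 * dot y y - dot (y *m W) (y *m W).
  have c0 : 0 <= c by rewrite subr_ge0.
  set a := dot y y.
  have a0 : 0 <= a := dot_ge0 _.
  have E t : s2 * dot (x + t *: y) (x + t *: y)
      - dot ((x + t *: y) *m W) ((x + t *: y) *m W) = 2 * t * a + t ^+ 2 * c.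
    have aE : a = s2 * dot x y - dot (x *m W) (y *m W).
      by rewrite /a {1}yE dotDl dotNl dotZl [dot (_ *m W *m W) y]dot_mulmx Wsym.
    rewrite aE /c mulmxDl -scalemxAl !(dotDl, dotDr, dotZl, dotZr) x1.
    rewrite -/s2 (dotC y x) (dotC (y *m W) (x *m W)); ring.
  have c1 : 0 < c + 1 by rewrite ltr_wpDl.
  (* The expression [2 t a + t ^ 2 c] is smallest at [t = - a / c]; the denominator [c + 1] avoids
     the case [c = 0] and still gives a negative value unless [a = 0]. *)
  have := bnd (x + (- (a / (c + 1))) *: y); rewrite -subr_ge0 E.
  have -> : 2 * - (a / (c + 1)) * a + (- (a / (c + 1))) ^+ 2 * c =
     - (a ^+ 2 * (c + 2) / (c + 1) ^+ 2) by field; rewrite gt_eqF.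
  rewrite oppr_ge0 => h; apply/eqP; rewrite -sqrf_eq0 eq_le sqr_ge0 andbT.
  move: h; rewrite ler_pdivrMr ?mul0r ?exprn_gt0 //.
  by rewrite pmulr_lle0 // ltr_wpDl.
pose s := Num.sqrt s2; have s0 : 0 <= s := sqrtr_ge0 _.
have ss : s ^+ 2 = s2 by rewrite sqr_sqrtr.
have xWW : x *m W *m W = s2 *: x by move/eqP: y0; rewrite yE subr_eq0 => /eqP.
have bs v : euclid_norm (v *m W) <= s * euclid_norm v.
  by rewrite euclid_norm_le ?mulr_ge0 ?euclid_norm_ge0 // exprMn ss euclid_norm_sqr.
pose z := x *m W + s *: x.
have zW : z *m W = s *: z.
  by rewrite mulmxDl xWW -scalemxAl scalerDr scalerA -expr2 ss addrC.
have [z0|z0] := eqVneq (dot z z) 0.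
  exists (- s), x; split => // [|v]; last by rewrite normrN ger0_norm.
  by move/dot_eq0/eqP: z0; rewrite addr_eq0 scaleNr => /eqP.
have zp : 0 < euclid_norm z.
  rewrite lt_def euclid_norm_ge0 andbT; apply: contraNneq z0 => h.
  by rewrite -euclid_norm_sqr h expr0n.
exists s, ((euclid_norm z)^-1 *: z); split=> [||v]; last by rewrite ger0_norm.
  by rewrite dotZl dotZr mulrA -invfM -expr2 euclid_norm_sqr mulVf.
by rewrite -scalemxAl zW !scalerA mulrC.
Qed.

Lemma eigenvalue_le n (W : 'M[R]_n) c b :
  (forall v, euclid_norm (v *m W) <= c * euclid_norm v) ->
  eigenvalue W b -> `|b| <= c.
Proof.
move=> hc /eigenvalueP [v vW v0]; have := hc v; rewrite vW euclid_normZ ler_pM2r //.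
by rewrite lt_def euclid_norm_ge0 andbT; apply: contra_neq v0 => /euclid_norm_eq0.
Qed.

Lemma sym_spectral_radius n (W : 'M[R]_n.+1) : W^T = W ->
  exists a x, [/\ dot x x = 1, x *m W = a *: x, spectral_radius W = `|a| &
    forall v, euclid_norm (v *m W) <= `|a| * euclid_norm v].
Proof.
move=> /sym_eigen_max [a [x [x1 xW hW]]]; exists a, x; split=> //.
have ea : eigenvalue W a.
  apply/eigenvalueP; exists x => //; apply: contra_eq_neq x1 => ->.
  by rewrite -(scale0r 0) dotZl mul0r eq_sym oner_eq0.
apply/eqP; rewrite eq_le; apply/andP; split.
  apply: ge_sup => [|_ [b /= eb <-]]; first by exists `|a|, a.
  exact: eigenvalue_le eb.
apply: ub_le_sup; last by exists a.
by exists `|a| => _ [b /= eb <-]; exact: eigenvalue_le eb.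
Qed.

Lemma spectral_radius_bound n (W : 'M[R]_n.+1) v : W^T = W ->
  euclid_norm (v *m W) <= spectral_radius W * euclid_norm v.
Proof. by move=> /sym_spectral_radius [a [x [_ _ -> h]]]. Qed.

Lemma spectral_radius_le n (W : 'M[R]_n.+1) c : W^T = W ->
  (forall v, euclid_norm (v *m W) <= c * euclid_norm v) -> spectral_radius W <= c.
Proof.
move=> /sym_spectral_radius [a [x [x1 xW -> _]]] hc.
apply: (eigenvalue_le hc); apply/eigenvalueP; exists x => //.
apply: contra_eq_neq x1 => ->; by rewrite -(scale0r 0) dotZl mul0r eq_sym oner_eq0.
Qed.

Lemma spectral_radius_ge0 n (W : 'M[R]_n.+1) : W^T = W -> 0 <= spectral_radius W.
Proof. by move=> /sym_spectral_radius [a [x [_ _ -> _]]]. Qed.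

Lemma trX_sym n (W : 'M[R]_n.+1) k : W^T = W -> (W ^+ k)^T = W ^+ k.
Proof. by move=> h; elim: k => [|k IH]; rewrite ?expr0 ?trmx1 // exprS trmx_mul IH h -[RHS]exprS exprSr. Qed.

Lemma rowmulX n (W : 'M[R]_n.+1) (x : 'rV_n.+1) a k :
  x *m W = a *: x -> x *m W ^+ k = a ^+ k *: x.
Proof.
move=> h; elim: k => [|k IH]; first by rewrite !expr0 scale1r mulmx1.
by rewrite exprS -[_ * _]/(_ *m _) mulmxA h -scalemxAl IH scalerA -exprS.
Qed.

Lemma mxtraceX2 n (W : 'M[R]_n.+1) k : W^T = W ->
  \tr (W ^+ k.*2) = \sum_i \sum_j (W ^+ k) i j ^+ 2.
Proof.
move=> h; rewrite -addnn exprD; apply: eq_bigr => i _.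
rewrite -{2}(trX_sym k h) mxE; apply: eq_bigr => j _.
by rewrite mxE expr2.
Qed.

(** A top eigenvector shows that [rho ^ k] is at most the Frobenius norm of [W ^ k], whose square is
    the trace. This direction serves the random matrix; the reverse one, which costs the dimension,
    serves the reference matrix. *)
Lemma spectral_radius_trace n (W : 'M[R]_n.+1) k : W^T = W ->
  spectral_radius W ^+ k.*2 <= \tr (W ^+ k.*2).
Proof.
move=> h; have [a [x [x1 xW -> _]]] := sym_spectral_radius h.
rewrite mxtraceX2 //; set F := \sum_i _.
have F0 : 0 <= F by apply: sumr_ge0 => i _; apply: sumr_ge0 => j _; rewrite sqr_ge0.
have := @frobenius_bound R _ _ (W ^+ k) (Num.sqrt F) x (sqrtr_ge0 _).
rewrite sqr_sqrtr // => /(_ (lexx _)).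
rewrite (rowmulX _ xW) euclid_normZ (euclid_norm1 x1) !mulr1.
rewrite -ler_sqr ?nnegrE ?sqrtr_ge0 // sqr_sqrtr //.
by rewrite normrX -exprM muln2.
Qed.

Lemma trace_spectral_radius n (W : 'M[R]_n.+1) k : W^T = W ->
  \tr (W ^+ k.*2) <= n.+1%:R * spectral_radius W ^+ k.*2.
Proof.
move=> h; rewrite mxtraceX2 //.
have b v : euclid_norm (v *m W ^+ k) <= spectral_radius W ^+ k * euclid_norm v.
  elim: k v => [|k IH] v; first by rewrite !expr0 mul1r mulmx1.
  rewrite exprSr -[_ * _]/(_ *m _) mulmxA (le_trans (spectral_radius_bound _ h)) //.
  by rewrite exprS -mulrA ler_wpM2l ?spectral_radius_ge0.
apply: le_trans (_ : \sum_(i < n.+1) spectral_radius W ^+ k.*2 <= _); last first.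
  by rewrite sumr_const card_ord mulr_natl.
apply: ler_sum => i _; have := b (delta_mx 0 i).
rewrite -rowE [X in _ * X]euclid_norm1; last first.
  rewrite /dot (bigD1 i) //= big1 => [|j /negPf ji]; first by rewrite !mxE !eqxx mulr1 addr0.
  by rewrite !mxE ji andbF mul0r.
rewrite mulr1 euclid_norm_le ?exprn_ge0 ?spectral_radius_ge0 // -exprM muln2.
by apply: le_trans; rewrite /dot; apply: ler_sum => j _; rewrite !mxE expr2.
Qed.

End SymmetricMatrices.

(** * Random graphs *)

Lemma simple_graphP n (A : 'M[bool]_n) :
  reflect ((forall u, A u u = false) /\ forall u v, A u v = A v u) (simple_graph A).
Proof.
apply: (iffP andP) => [[/forallP Ad /forallP As]|[Ad As]].
  by split=> [u|u v]; [exact/negbTE/Ad|have /forallP /(_ v) /eqP := As u].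
split; apply/forallP => u; first by rewrite Ad.
by apply/forallP => v; rewrite As.
Qed.

Section RandomGraph.
Context {R : realType} {n : nat}.
Variable p : 'M[R]_n.

Definition graph_weight (A : 'M[bool]_n) : R :=
  \prod_(u < n) \prod_(v < n | (u < v)%N)
     (if A u v then p u v else 1 - p u v).

Definition graph_ex (F : 'M[bool]_n -> R) : R :=
  \sum_(A : 'M[bool]_n | simple_graph A) graph_weight A * F A.

Lemma graph_prE E : graph_pr p E = graph_ex (fun A => (`[< E A >])%:R).
Proof.
rewrite /graph_pr big_mkcondr; apply: eq_bigr => A _; rewrite /graph_weight.
by case: `[< _ >]; rewrite ?mulr1 ?mulr0.
Qed.

Lemma eq_graph_ex F G :
  (forall A, simple_graph A -> F A = G A) -> graph_ex F = graph_ex G.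
Proof. by move=> h; apply: eq_bigr => A /h ->. Qed.

Lemma graph_ex_sum (I : Type) (r : seq I) (P : pred I) (F : I -> 'M[bool]_n -> R) :
  graph_ex (fun A => \sum_(i <- r | P i) F i A) = \sum_(i <- r | P i) graph_ex (F i).
Proof.
rewrite /graph_ex exchange_big /=; apply: eq_bigr => A _.
by rewrite mulr_sumr.
Qed.

Lemma graph_exZ c F : graph_ex (fun A => c * F A) = c * graph_ex F.
Proof. by rewrite /graph_ex mulr_sumr; apply: eq_bigr => A _; rewrite mulrCA. Qed.

Lemma graph_exD F G : graph_ex (fun A => F A + G A) = graph_ex F + graph_ex G.
Proof. by rewrite /graph_ex -big_split; apply: eq_bigr => A _; rewrite mulrDr. Qed.

(** Independence of the edges: simple graphs correspond to boolean functions on the pairs [u < v],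
    and the sum over these functions distributes into a product of sums. *)
Lemma graph_ex_prod (h : 'I_n * 'I_n -> bool -> R) :
  graph_ex (fun A => \prod_(e : 'I_n * 'I_n | (e.1 < e.2)%N) h e (A e.1 e.2)) =
  \prod_(e : 'I_n * 'I_n | (e.1 < e.2)%N)
    (p e.1 e.2 * h e true + (1 - p e.1 e.2) * h e false).
Proof.
pose F e b : R := (if b then p e.1 e.2 else 1 - p e.1 e.2) * h e b.
transitivity (\prod_(e : 'I_n * 'I_n | (e.1 < e.2)%N) \sum_b F e b); last first.
  by apply: eq_bigr => e _; rewrite big_bool.
rewrite (big_distr_big_dep false).
pose g (A : 'M[bool]_n) : {ffun 'I_n * 'I_n -> bool} :=
  [ffun e : 'I_n * 'I_n => (e.1 < e.2)%N && A e.1 e.2].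
pose g' (f : {ffun 'I_n * 'I_n -> bool}) : 'M[bool]_n := \matrix_(u, v)
  if (u < v)%N then f (u, v) else if (v < u)%N then f (v, u) else false.
rewrite (reindex_onto g g') /=; last first.
  move=> f /pfamilyP [fs _]; apply/ffunP => -[u v]; rewrite ffunE mxE /=.
  case: ltnP => //= uv; apply/esym/negbTE/negP => fuv.
  by have := fintype.subsetP fs (u, v); rewrite !inE /in_mem /= fuv => /(_ isT); rewrite ltnNge uv.
rewrite /graph_ex; apply: eq_big => [A|A _].
  apply/simple_graphP/andP => [[Ad As]|[_ /eqP <-]].
    split.
      apply/pfamilyP; split=> [|//]; apply/fintype.subsetP => -[u v].
      by rewrite /in_mem /= /in_mem /= ffunE /=; case: (u < v)%N.
    apply/eqP/matrixP => u v; rewrite mxE !ffunE /=.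
    by have [uv|uv|/ord_inj ->] := ltngtP u v; rewrite ?Ad //= As.
  split=> [u|u v]; first by rewrite mxE ltnn.
  by rewrite !mxE; have [uv|uv|_] := ltngtP u v.
rewrite /graph_weight pair_big_dep -big_split /=.
by apply: eq_bigr => -[u v] /= uv; rewrite ffunE /= uv.
Qed.

(** A pair repeated in [s] contributes a higher moment; for a pair outside [s] the exponent is 0 and
    the factor is [p + (1 - p) = 1]. *)
Lemma graph_ex_seq (h : 'I_n * 'I_n -> bool -> R) (s : seq ('I_n * 'I_n)) :
  all (fun e : 'I_n * 'I_n => (e.1 < e.2)%N) s ->
  graph_ex (fun A => \prod_(e <- s) h e (A e.1 e.2)) =
  \prod_(e : 'I_n * 'I_n | (e.1 < e.2)%N)
    (p e.1 e.2 * h e true ^+ count_mem e s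
      + (1 - p e.1 e.2) * h e false ^+ count_mem e s).
Proof.
move=> /allP hs; rewrite -(graph_ex_prod (fun e b => h e b ^+ count_mem e s)).
apply: eq_graph_ex => A _.
rewrite -big_undup_iterop_count /= big_uniq ?undup_uniq //= big_mkcond /=.
rewrite [RHS]big_mkcond; apply: eq_bigr => e _; rewrite mem_undup.
case: ifPn => es; first by rewrite hs.
by rewrite (count_memPn es) expr0 if_same.
Qed.

Lemma graph_ex1 : graph_ex (fun=> 1) = 1.
Proof.
transitivity (graph_ex (fun=> \prod_(e <- [::] : seq ('I_n * 'I_n)) 1)).
  by apply: eq_graph_ex => A _; rewrite big_nil.
rewrite (graph_ex_seq (fun _ _ => 1)) // big1 // => e _.
by rewrite !expr0 !mulr1 addrC subrK.
Qed.

Hypothesis p01 : forall u v, 0 <= p u v <= 1.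

Lemma graph_weight_ge0 A : 0 <= graph_weight A.
Proof.
apply: prodr_ge0 => u _; apply: prodr_ge0 => v _.
by have /andP [h0 h1] := p01 u v; case: ifP; rewrite ?subr_ge0.
Qed.

Lemma graph_ex_le F G :
  (forall A, simple_graph A -> F A <= G A) -> graph_ex F <= graph_ex G.
Proof.
by move=> h; apply: ler_sum => A /h ?; rewrite ler_wpM2l ?graph_weight_ge0.
Qed.

Lemma graph_ex_ge0 F : (forall A, simple_graph A -> 0 <= F A) -> 0 <= graph_ex F.
Proof. by move=> h; apply: sumr_ge0 => A /h; apply: mulr_ge0 (graph_weight_ge0 A). Qed.

Lemma graph_pr_le E E' :
  (forall A, simple_graph A -> E A -> E' A) -> graph_pr p E <= graph_pr p E'.
Proof.
move=> h; rewrite !graph_prE; apply: graph_ex_le => A sA.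
by have [/(h _ sA) ?|] := asboolP (E A); rewrite ?ler0n // asboolT.
Qed.

Lemma graph_pr_ge0 E : 0 <= graph_pr p E.
Proof. by rewrite graph_prE graph_ex_ge0. Qed.

Lemma graph_prC E : graph_pr p E = 1 - graph_pr p (fun A => ~ E A).
Proof.
apply/eqP; rewrite -subr_eq0 opprB addrA subr_eq0; apply/eqP.
rewrite -[RHS]graph_ex1 !graph_prE -graph_exD.
by apply: eq_graph_ex => A _; rewrite asbool_neg; case: `[< _ >]; rewrite ?addr0 ?add0r.
Qed.

Lemma graph_pr_le1 E : graph_pr p E <= 1.
Proof. by rewrite graph_prC lerBlDr lerDl graph_pr_ge0. Qed.

Lemma graph_prU E E' :
  graph_pr p (fun A => E A \/ E' A) <= graph_pr p E + graph_pr p E'.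
Proof.
rewrite !graph_prE -graph_exD; apply: graph_ex_le => A _.
rewrite -natrD ler_nat asbool_or; by case: `[< _ >]; case: `[< _ >].
Qed.

Lemma graph_prU_big (I : finType) (E : I -> 'M[bool]_n -> Prop) :
  graph_pr p (fun A => exists i, E i A) <= \sum_i graph_pr p (E i).
Proof.
under eq_bigr do rewrite graph_prE.
rewrite graph_prE -graph_ex_sum; apply: graph_ex_le => A _.
have [[i Ei]|_] := asboolP (exists i, E i A); last by rewrite sumr_ge0.
rewrite (bigD1 i) //= asboolT // lerDl sumr_ge0 //.
Qed.

Lemma graph_markov F c : 0 < c -> (forall A, simple_graph A -> 0 <= F A) ->
  graph_pr p (fun A => c <= F A) <= graph_ex F / c.
Proof.
move=> c0 F0; rewrite mulrC -graph_exZ graph_prE; apply: graph_ex_le => A sA.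
have [h|_] := asboolP (c <= F A); last first.
  by apply: mulr_ge0; [rewrite invr_ge0 ltW | exact: F0].
by rewrite [leRHS]mulrC ler_pdivlMr // -[_%:R]/(1 : R) mul1r.
Qed.

End RandomGraph.

(** * Walks *)

Section Walks.

(** An unordered pair is coded by sorting it, so that both directions of traversal count as the same
    edge; a loop stays [(u, u)]. *)
Definition edge n (u v : 'I_n) : 'I_n * 'I_n :=
  if (u <= v)%N then (u, v) else (v, u).

Lemma edgeC n (u v : 'I_n) : edge u v = edge v u.
Proof. by rewrite /edge; have [uv|uv|/ord_inj ->] := ltngtP u v. Qed.

Lemma edgeP n (u v : 'I_n) : edge u v = (u, v) \/ edge u v = (v, u).
Proof. by rewrite /edge; case: ifP; [left|right]. Qed.

Lemma edge_fst_le n (u v : 'I_n) : ((edge u v).1 <= (edge u v).2)%N.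
Proof. by rewrite /edge; case: (leqP u v) => //= /ltnW. Qed.

Definition walk_edges n (s : seq 'I_n) : seq ('I_n * 'I_n) :=
  if s is x :: s' then pairmap (@edge n) x s' else [::].

Definition closed_walk (T : eqType) (s : seq T) : bool :=
  if s is x :: s' then last x s' == x else true.

(** Applied to edge lists: an edge traversed exactly once makes the expectation of the whole walk
    vanish by centring. *)
Definition recurrent (T : eqType) (s : seq T) : bool :=
  all (fun e => (1 < count_mem e s)%N) s.

Lemma matrixX_walks (R : comNzRingType) n (Y : 'M[R]_n.+1) l a b :
  Y^T = Y ->
  (Y ^+ l) a b = \sum_(w : l.-tuple 'I_n.+1 | last a w == b)
    \prod_(e <- pairmap (@edge n.+1) a w) Y e.1 e.2.
Proof.
move=> Ysym; have Ye u v : Y (edge u v).1 (edge u v).2 = Y u v.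
  by have [->|->] //= := edgeP u v; rewrite -{1}Ysym mxE.
elim: l a => [|l IH] a.
  rewrite expr0 mxE big_mkcond /= (big_pred1 [tuple]) /=; last by move=> t; apply/esym/eqP; rewrite [t]tuple0.
  by rewrite big_nil; case: (a == b).
rewrite exprS mxE.
pose F (x : 'I_n.+1) (w : l.-tuple 'I_n.+1) : R :=
  if last x w == b then \prod_(e <- pairmap (@edge _) x w) Y e.1 e.2 else 0.
transitivity (\sum_x \sum_w Y a x * F x w).
  by apply: eq_bigr => x _; rewrite IH big_mkcond /= mulr_sumr.
rewrite pair_bigA /= [RHS]big_mkcond /=.
rewrite (reindex (fun q : 'I_n.+1 * l.-tuple 'I_n.+1 => [tuple of q.1 :: q.2])) /=; last first.
  exists (fun w => (thead w, [tuple of behead w])) => [[x w] _|w _] /=.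
    by congr (_, _); apply/val_inj.
  by apply: val_inj; rewrite [in RHS](tuple_eta w).
apply: eq_bigr => -[x w] _ /=; rewrite /F big_cons Ye.
by case: ifP; rewrite ?mulr0.
Qed.

Lemma mxtraceX_walks (R : comNzRingType) n (Y : 'M[R]_n.+1) l :
  Y^T = Y ->
  \tr (Y ^+ l) = \sum_(w : l.+1.-tuple 'I_n.+1 | closed_walk w)
    \prod_(e <- walk_edges w) Y e.1 e.2.
Proof.
move=> Ysym; rewrite [RHS]big_mkcond /=.
rewrite (reindex (fun q : 'I_n.+1 * l.-tuple 'I_n.+1 => [tuple of q.1 :: q.2])) /=; last first.
  exists (fun w => (thead w, [tuple of behead w])) => [[x w] _|w _] /=.
    by congr (_, _); apply/val_inj.
  by apply: val_inj; rewrite [in RHS](tuple_eta w).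
rewrite -(pair_bigA _ (fun (x : 'I_n.+1) (w : l.-tuple 'I_n.+1) => if last x w == x then
   \prod_(e <- pairmap (@edge _) x w) Y e.1 e.2 else 0)) /=.
by apply: eq_bigr => x _; rewrite matrixX_walks // big_mkcond.
Qed.

(** Building the walk from its end, a vertex not met before comes with an edge not met before,
    namely the one to its successor. *)
Lemma size_undup_walk n (s : seq 'I_n) :
  (size (undup s) <= (size (undup (walk_edges s))).+1)%N.
Proof.
case: s => // x s; rewrite /walk_edges; elim: s x => [|y s IH] x //.
have mem : forall x' s' (e : 'I_n * 'I_n), e \in pairmap (@edge n) x' s' ->
    (e.1 \in x' :: s') && (e.2 \in x' :: s').
  move=> x' s'; elim: s' x' => [//|z s' IHs] x' e /=.
  rewrite inE => /orP [/eqP ->|/IHs /andP [h1 h2]].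
    by have [->|->] := edgeP x' z; rewrite !inE !eqxx ?orbT.
  by rewrite !(in_cons x') h1 h2 !orbT.
have := IH y; rewrite [pairmap _ x _]/= [undup (x :: _)]/= [undup (edge _ _ :: _)]/=.
case: (boolP (x \in y :: s)) => xs; first by move/leq_trans; apply; case: ifP.
have -> : (edge x y \in pairmap (@edge n) y s) = false.
  apply/negbTE; apply: contra xs => /mem.
  by have [->|->] /= := edgeP x y => /andP [].
by move=> h; rewrite /= ltnS.
Qed.

Lemma recurrent_size (T : eqType) (s : seq T) :
  recurrent s -> ((size (undup s)).*2 <= size s)%N.
Proof.
move=> /allP h; rewrite -addnn.
have -> : size s = (\sum_(e <- undup s) count_mem e s)%N.
  rewrite -[LHS](perm_size (perm_count_undup s)) size_flatten /shape -map_comp.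
  by rewrite sumnE big_map; apply: eq_bigr => e _ /=; rewrite size_nseq.
rewrite addnn -muln2 mulnC -sum1_size big_distrr /= big_seq [leqRHS]big_seq.
by apply: leq_sum => e; rewrite mem_undup muln1 => /h.
Qed.

End Walks.

(** * Shapes of walks *)

Section InjectiveRelabelling.

Lemma size_undup_map_in (T1 T2 : eqType) (f : T1 -> T2) (s : seq T1) :
  {in s &, injective f} -> size (undup (map f s)) = size (undup s).
Proof.
move=> fi; rewrite -[RHS](size_map f); apply/perm_size/uniq_perm.
- exact: undup_uniq.
- by rewrite map_inj_in_uniq ?undup_uniq // => x y; rewrite !mem_undup; exact: fi.
- move=> y; rewrite mem_undup; apply/mapP/mapP => -[x xs ->]; exists x => //;
    by move: xs; rewrite mem_undup.
Qed.

Lemma count_mem_map_in (T1 T2 : eqType) (f : T1 -> T2) (s : seq T1) x :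
  {in s &, injective f} -> x \in s ->
  count_mem (f x) (map f s) = count_mem x s.
Proof.
move=> fi xs; rewrite count_map; apply: eq_in_count => y ys /=.
by apply/eqP/eqP => [|-> //]; exact: fi.
Qed.

Lemma index_map_in (T1 T2 : eqType) (f : T1 -> T2) (s : seq T1) x :
  {in s &, injective f} -> x \in s -> index (f x) (map f s) = index x s.
Proof.
elim: s => [//|y s IH] fi xs /=; rewrite (inj_in_eq fi) ?mem_head //.
case: eqVneq => // xy; rewrite IH //.
  by move=> a b ha hb; apply: fi; rewrite inE ?ha ?hb orbT.
by move: xs; rewrite inE eq_sym (negPf xy).
Qed.

Lemma recurrent_map (T1 T2 : eqType) (f : T1 -> T2) (s : seq T1) :
  {in s &, injective f} -> recurrent (map f s) = recurrent s.
Proof.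
by move=> fi; rewrite /recurrent all_map; apply: eq_in_all => x xs /=; rewrite count_mem_map_in.
Qed.

Lemma closed_walk_map (T1 T2 : eqType) (f : T1 -> T2) (s : seq T1) :
  {in s &, injective f} -> closed_walk (map f s) = closed_walk s.
Proof.
case: s => //= x s fi; rewrite last_map; apply/eqP/eqP => [|-> //].
by apply: fi; rewrite ?mem_last ?mem_head.
Qed.

Lemma mem_walk_edges n (x : 'I_n) s (e : 'I_n * 'I_n) :
  e \in pairmap (@edge n) x s ->
  [/\ e.1 \in x :: s, e.2 \in x :: s & edge e.1 e.2 = e].
Proof.
elim: s x => [//|y s IH] x /=; rewrite inE => /orP [/eqP ->|/IH [h1 h2 h3]].
  by split; have [h|h] := edgeP x y; rewrite h /= ?inE ?eqxx ?orbT ?h // edgeC h.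
by split=> //; rewrite in_cons ?h1 ?h2 orbT.
Qed.

Definition edge_map n m (f : 'I_n -> 'I_m) (e : 'I_n * 'I_n) := edge (f e.1) (f e.2).

Lemma walk_edges_map n m (f : 'I_n -> 'I_m) s :
  walk_edges (map f s) = map (edge_map f) (walk_edges s).
Proof.
case: s => // x s /=; elim: s x => //= y s IH x; rewrite IH; congr (_ :: _).
by rewrite /edge_map; have [->|->] //= := edgeP x y; rewrite edgeC.
Qed.

(** Edges with equal images have equal endpoints up to a swap, and an edge of a walk is sorted,
    hence determined by its endpoints. *)
Lemma edge_map_inj n m (f : 'I_n -> 'I_m) s :
  {in s &, injective f} -> {in walk_edges s &, injective (edge_map f)}.
Proof.
case: s => // x s fi e e' /mem_walk_edges [h1 h2 he] /mem_walk_edges [h1' h2' he'].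
rewrite /edge_map => E.
have [[a b]|[a b]] : (e.1 = e'.1 /\ e.2 = e'.2) \/ (e.1 = e'.2 /\ e.2 = e'.1).
- move: E; have [->|->] := edgeP (f e.1) (f e.2);
    have [->|->] := edgeP (f e'.1) (f e'.2); case=> E1 E2;
    by [left; split; exact: fi|right; split; exact: fi].
- by rewrite -he -he' a b.
- by rewrite -he -he' a b edgeC.
Qed.

Lemma recurrent_walk_map n m (f : 'I_n -> 'I_m) s : {in s &, injective f} ->
  recurrent (walk_edges (map f s)) = recurrent (walk_edges s).
Proof. by move=> fi; rewrite walk_edges_map recurrent_map //; exact: edge_map_inj. Qed.

Lemma size_undup_edges_map n m (f : 'I_n -> 'I_m) s : {in s &, injective f} ->
  size (undup (walk_edges (map f s))) = size (undup (walk_edges s)).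
Proof. by move=> fi; rewrite walk_edges_map size_undup_map_in //; exact: edge_map_inj. Qed.

End InjectiveRelabelling.

(** * Counting words by shape *)

Section CanonicalForm.
Variable l : nat.

Definition canon_idx (T : eqType) (w : l.+1.-tuple T) (x : T) : 'I_l.+1 :=
  inord (index x w).

(* Two words have the same canonical form exactly when one is an injective
   relabelling of the other. *)
Definition canon (T : eqType) (w : l.+1.-tuple T) : l.+1.-tuple 'I_l.+1 :=
  map_tuple (canon_idx w) w.

Lemma canon_idxE (T : eqType) (w : l.+1.-tuple T) x : x \in w ->
  canon_idx w x = index x w :> nat.
Proof. by move=> xw; rewrite inordK // -{2}(size_tuple w) index_mem. Qed.

Lemma canon_idx_inj (T : eqType) (w : l.+1.-tuple T) :
  {in w &, injective (canon_idx w)}.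
Proof.
move=> x y xw yw /(congr1 (@nat_of_ord _)); rewrite !canon_idxE // => h.
by rewrite -(nth_index x xw) h nth_index.
Qed.

Lemma canon_map (T1 T2 : eqType) (f : T1 -> T2) (w : l.+1.-tuple T1) :
  {in w &, injective f} -> canon (map_tuple f w) = canon w.
Proof.
move=> fi; apply: val_inj => /=; rewrite -map_comp; apply/eq_in_map => x xw /=.
apply: ord_inj; rewrite !canon_idxE ?map_f //= index_map_in //.
Qed.

Lemma canonK (T : eqType) (w : l.+1.-tuple T) : canon (canon w) = canon w.
Proof. exact/canon_map/canon_idx_inj. Qed.

(** A word of shape [c] is an injective labelling of the [v] distinct letters of [c], that is, a
    duplicate-free [v]-tuple over [T]; [Phi] is this bijection. *)
Lemma card_canon (T : finType) (w : l.+1.-tuple T) (c : l.+1.-tuple 'I_l.+1) :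
  canon w = c -> #|[set w' : l.+1.-tuple T | canon w' == c]%SET| =
  (#|T| ^_ (size (undup c)))%N.
Proof.
move=> wc; have x0 : T := thead w.
have cc : canon c = c by rewrite -wc canonK.
set v := size (undup c).
pose lab (u : v.-tuple T) (i : 'I_l.+1) : T := nth x0 u (index i (undup c)).
pose Phi (u : v.-tuple T) : l.+1.-tuple T := map_tuple (lab u) c.
have labu u : map (lab u) (undup c) = u.
  apply: (@eq_from_nth _ x0) => [|i]; first by rewrite size_map size_tuple.
  rewrite size_map => iv; rewrite (nth_map ord0) // /lab index_uniq ?undup_uniq //.
have labi (u : v.-tuple T) : uniq u -> {in c &, injective (lab u)}.
  move=> uu i j ic jc; rewrite /lab => /eqP; rewrite nth_uniq ?size_tuple ?index_mem ?mem_undup //.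
  by move=> /eqP h; rewrite -(@nth_index _ ord0 i (undup c)) ?mem_undup // h nth_index ?mem_undup.
have -> : [set w' : l.+1.-tuple T | canon w' == c]%SET = (Phi @: [set u : v.-tuple T | all predT u & uniq u])%SET.
  apply/setP => w'; rewrite inE; apply/eqP/imsetP => [w'c|[u]]; last first.
    by rewrite inE => /andP [_ uu] ->; rewrite canon_map ?cc //; exact: labi.
  pose h (i : 'I_l.+1) := nth x0 w' i.
  have hw' : map h c = w'.
    rewrite -w'c /= -map_comp -[RHS]map_id; apply/eq_in_map => x xw' /=.
    by rewrite /h canon_idxE // nth_index.
  have hi : {in c &, injective h}.
    move=> i j; rewrite -w'c => /mapP [x xw ->] /mapP [y yw ->].
    by rewrite /h !canon_idxE // !nth_index // => ->.
  have su : size (map h (undup c)) == v by rewrite size_map.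
  exists (Tuple su).
    rewrite inE all_predT /= map_inj_in_uniq ?undup_uniq // => i j.
    by rewrite !mem_undup; exact: hi.
  apply: val_inj => /=; rewrite -hw'; apply/eq_in_map => i ic.
  rewrite /lab /= (nth_map ord0) ?index_mem ?mem_undup // nth_index ?mem_undup //.
rewrite card_in_imset ?card_uniq_tuples // => u u' _ _ /(congr1 val) /= E.
apply: val_inj; rewrite /= -labu -[RHS]labu; apply/eq_in_map => i.
by rewrite mem_undup => ic; move/eq_in_map: E; apply.
Qed.

(** Both sums are grouped by shape, each shape weighted by a falling factorial. Shapes that occur
    over [T] must occur over [T']; those that do not are harmless because [H'] is nonnegative. *)
Lemma ler_sum_canon (R : realType) (T T' : finType) (a : R)
    (H H' : l.+1.-tuple 'I_l.+1 -> R) :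
  0 <= a -> (forall c, 0 <= H' c) ->
  (forall w : l.+1.-tuple T,
     (#|T| ^_ (size (undup (canon w))))%:R * H (canon w) <=
     a * ((#|T'| ^_ (size (undup (canon w))))%:R * H' (canon w))) ->
  (forall w : l.+1.-tuple T, exists w' : l.+1.-tuple T', canon w' = canon w) ->
  \sum_(w : l.+1.-tuple T) H (canon w) <= a * \sum_(w : l.+1.-tuple T') H' (canon w).
Proof.
move=> a0 H'0 hH hT.
rewrite (partition_big (@canon T) xpredT) //= (partition_big (@canon T') xpredT) //=.
rewrite mulr_sumr; apply: ler_sum => c _.
have E (S : finType) (G : l.+1.-tuple 'I_l.+1 -> R) :
    \sum_(w : l.+1.-tuple S | canon w == c) G (canon w) =
    #|[set w : l.+1.-tuple S | canon w == c]%SET|%:R * G c.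
  rewrite (eq_bigr (fun=> G c)) => [|w /eqP -> //].
  rewrite sumr_const mulr_natl; congr (_ *+ _).
  by apply: eq_card => w; rewrite !inE.
rewrite !E.
have [h0|] := set_0Vmem [set w : l.+1.-tuple T | canon w == c]%SET.
  by rewrite h0 cards0 mul0r mulr_ge0 // mulr_ge0 // ler0n.
case=> w; rewrite inE => /eqP wc; have [w' w'c] := hT w.
rewrite (card_canon wc) (@card_canon T' w' c) ?w'c //.
by have := hH w; rewrite wc.
Qed.

End CanonicalForm.

(** * The reference matrix *)

Section ReferenceMatrix.
Context {R : realType}.

(* A centred variable all of whose moments of order at least 2 are at least 1,
   so that it dominates the moments of a small centred variable. *)
Definition three_point (i : 'I_3) : R := if i == ord0 then 2 else -1.

Lemma three_point_moment m :
  0 <= (\sum_i three_point i ^+ m) / 3%:R /\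
  ((1 < m)%N -> 1 <= (\sum_i three_point i ^+ m) / 3%:R).
Proof.
have -> : \sum_i three_point i ^+ m = 2 ^+ m + (-1) ^+ m + (-1) ^+ m :> R.
  by rewrite !big_ord_recl big_ord0 /three_point /= addr0 addrA.
have b : -1 <= (-1) ^+ m :> R by rewrite -signr_odd; case: (odd m); rewrite ?expr0 ?expr1; lra.
case: m b => [|[|[|m]]] b.
- by rewrite !expr0; split => //; lra.
- by rewrite !expr1; split => //; lra.
- by rewrite !expr2; split => [|_]; lra.
have : 8 <= 2 ^+ m.+3 :> R.
  rewrite !exprS !mulrA; have : 1 <= 2 ^+ m :> R by rewrite exprn_ege1 //; lra.
  lra.
by split => [|_]; lra.
Qed.

Variable r : nat.
Local Notation pair := ('I_r * 'I_r)%type.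

(** Expectation for independent uniform variables, one for each ordered pair. The normalisation is a
    product over the pairs so that it factors together with the integrand. *)
Definition ref_ex (F : {ffun pair -> 'I_3} -> R) : R :=
  (\sum_w F w) / \prod_(e : pair) 3%:R.

Lemma ref_ex_prod (F : pair -> 'I_3 -> R) :
  ref_ex (fun w => \prod_e F e (w e)) = \prod_e ((\sum_i F e i) / 3%:R).
Proof. by rewrite /ref_ex -bigA_distr_bigA -prodf_div. Qed.

Lemma ref_ex_le F G : (forall w, F w <= G w) -> ref_ex F <= ref_ex G.
Proof.
move=> h; rewrite ler_wpM2r ?invr_ge0 ?prodr_ge0 //.
by apply: ler_sum.
Qed.

Lemma ref_exZ c F : ref_ex (fun w => c * F w) = c * ref_ex F.
Proof. by rewrite /ref_ex -mulr_sumr mulrA. Qed.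

Lemma ref_exD F G : ref_ex (fun w => F w + G w) = ref_ex F + ref_ex G.
Proof. by rewrite /ref_ex big_split mulrDl. Qed.

Lemma ref_ex_sum (I : Type) (s : seq I) (P : pred I) (F : I -> _ -> R) :
  ref_ex (fun w => \sum_(i <- s | P i) F i w) = \sum_(i <- s | P i) ref_ex (F i).
Proof. by rewrite /ref_ex exchange_big /= mulr_suml. Qed.

Lemma ref_ex_walk (s : seq pair) :
  0 <= ref_ex (fun w => \prod_(e <- s) three_point (w e)) /\
  (recurrent s -> 1 <= ref_ex (fun w => \prod_(e <- s) three_point (w e))).
Proof.
have -> : ref_ex (fun w => \prod_(e <- s) three_point (w e)) =
    \prod_e ((\sum_i three_point i ^+ count_mem e s) / 3%:R).
  rewrite -(ref_ex_prod (fun e i => three_point i ^+ count_mem e s)).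
  congr ref_ex; apply/funext => w.
  rewrite -big_undup_iterop_count /= big_uniq ?undup_uniq //= big_mkcond /=.
  apply: eq_bigr => e _; rewrite mem_undup.
  by case: ifPn => // es; rewrite (count_memPn es) expr0.
split=> [|/allP hs]; first by apply: prodr_ge0 => e _; case: (three_point_moment (count_mem e s)).
rewrite [leLHS](_ : _ = \prod_(e : pair) 1); last by rewrite big1_eq.
apply: ler_prod => e _; rewrite ler01 /=.
have [/hs|es] := boolP (e \in s); first by case: (three_point_moment (count_mem e s)).
by rewrite (count_memPn es); under eq_bigr do rewrite expr0; rewrite sumr_const card_ord mulfV.
Qed.

(** The linear term disappears on averaging over a centred variable. For [x > 1/2] one has
    [x < 2 x ^ 2]; otherwise [exp x <= 1 / (1 - x) <= 1 + x + 2 x ^ 2]. *)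
Lemma expR_le_quadratic (x : R) : expR x <= x + expR (2 * x ^+ 2).
Proof.
have [h|h] := lerP x 2^-1; last first.
  have : expR x <= expR (2 * x ^+ 2) by rewrite ler_expR expr2; nra.
  lra.
have h1 := expR_ge1Dx (- x); have h2 := expR_ge1Dx (2 * x ^+ 2).
have h3 : expR x * expR (- x) = 1 by rewrite -expRD subrr expR0.
have h4 := expR_gt0 x.
have : expR x <= 1 + x + 2 * x ^+ 2; last by lra.
have h5 : 1 <= (1 - x) * (1 + x + 2 * x ^+ 2).
  have : 0 <= x ^+ 2 * (1 - 2 * x) by rewrite mulr_ge0 ?sqr_ge0 //; lra.
  lra.
have h6 : expR x * (1 - x) <= 1 by rewrite -[leRHS]h3 ler_wpM2l // ltW.
have h7 : 0 < 1 - x by lra.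
rewrite -(ler_pM2r h7); apply: (le_trans h6); apply: (le_trans h5).
by rewrite [leLHS]mulrC.
Qed.

Lemma three_point_mgf (x : R) :
  (\sum_i expR (x * three_point i)) / 3%:R <= expR (8 * x ^+ 2).
Proof.
rewrite !big_ord_recl big_ord0 /three_point /= addr0.
have h1 := expR_le_quadratic (x * 2); have h2 := expR_le_quadratic (x * -1).
have e1 : 2 * (x * 2) ^+ 2 = 8 * x ^+ 2 by ring.
have e2 : expR (2 * (x * -1) ^+ 2) <= expR (8 * x ^+ 2).
  by rewrite ler_expR; have := sqr_ge0 x; nra.
by move: h1; rewrite e1; lra.
Qed.

Lemma exprn_even_le_expR (x : R) k : (0 < k)%N ->
  x ^+ k.*2 <= (k.*2)%:R ^+ k.*2 * (expR x + expR (- x)).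
Proof.
move=> k0; have k2 : 0 < (k.*2)%:R :> R by rewrite ltr0n double_gt0.
have h : expR `|x| <= expR x + expR (- x).
  by have := expR_gt0 x; have := expR_gt0 (- x); case: (ger0P x) => _; lra.
apply: le_trans (ler_wpM2l (exprn_ge0 _ (ltW k2)) h).
have -> : x ^+ k.*2 = `|x| ^+ k.*2.
  by rewrite -muln2 mulnC !exprM real_normK ?num_real.
have -> : expR `|x| = expR (`|x| / (k.*2)%:R) ^+ k.*2.
  by rewrite -expRM_natr divfK // gt_eqF.
rewrite -exprMn ler_pXn2r ?double_gt0 ?nnegrE ?mulr_ge0 ?expR_ge0 ?(ltW k2) //.
rewrite mulrC -ler_pdivrMr //.
by apply: le_trans (expR_ge1Dx _); rewrite lerDr.
Qed.

Lemma ref_ex_moment (c : pair -> R) k (V : R) : (0 < k)%N -> 0 < V ->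
  \sum_e c e ^+ 2 <= V ->
  ref_ex (fun w => (\sum_e c e * three_point (w e)) ^+ k.*2) <=
  2 * (32 * expR 1 * k%:R * V) ^+ k.
Proof.
move=> k0 V0 cV; have kp : 0 < k%:R :> R by rewrite ltr0n.
(* The generating function at [t] is at most [exp (8 t ^ 2 V)]; [t] makes this exponent equal to
   [k], and then [(2 k) ^ (2 k) / t ^ (2 k) = (32 k V) ^ k]. *)
pose t := Num.sqrt (k%:R / (8 * V)).
have t2 : t ^+ 2 = k%:R / (8 * V) by rewrite sqr_sqrtr // divr_ge0 ?mulr_ge0 ?ltW.
have tp : 0 < t by rewrite sqrtr_gt0 divr_gt0 // mulr_gt0.
have mgf (b : R) : b ^+ 2 = 1 ->
    ref_ex (fun w => expR (b * t * \sum_e c e * three_point (w e))) <= expR k%:R.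
  move=> b2; apply: le_trans (_ : \prod_e expR (8 * (b * t * c e) ^+ 2) <= _).
    rewrite (_ : (fun w => _) = fun w : {ffun pair -> 'I_3} =>
        \prod_e expR (b * t * c e * three_point (w e))); last first.
      apply/funext => w; rewrite mulr_sumr expR_sum.
      by apply: eq_bigr => e _; rewrite mulrA.
    rewrite (ref_ex_prod (fun e i => expR (b * t * c e * three_point i))).
    apply: ler_prod => e _; rewrite three_point_mgf andbT.
    by rewrite divr_ge0 // sumr_ge0 // => i _; rewrite expR_ge0.
  rewrite -expR_sum ler_expR.
  under eq_bigr do rewrite !exprMn b2 mul1r t2.
  rewrite -mulr_sumr -mulr_sumr.
  apply: le_trans (_ : 8 * (k%:R / (8 * V) * V) <= _).
    by rewrite ler_wpM2l // ler_wpM2l // divr_ge0 // mulr_ge0 // ltW.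
  by rewrite (_ : 8 * _ = k%:R) //; field; rewrite gt_eqF.
have E w : (\sum_e c e * three_point (w e)) ^+ k.*2 <=
   ((k.*2)%:R ^+ k.*2 / t ^+ k.*2) *
   (expR (1 * t * \sum_e c e * three_point (w e)) +
    expR ((-1) * t * \sum_e c e * three_point (w e))).
  rewrite mulrAC ler_pdivlMr ?exprn_gt0 // -exprMn mulN1r mul1r mulNr mulrC.
  exact: exprn_even_le_expR.
apply: le_trans (ref_ex_le E) _; rewrite ref_exZ ref_exD.
apply: le_trans (_ : (k.*2)%:R ^+ k.*2 / t ^+ k.*2 * (expR k%:R + expR k%:R) <= _).
  rewrite ler_wpM2l ?divr_ge0 ?exprn_ge0 ?(ltW tp) //.
  by apply: lerD; apply: mgf; rewrite ?sqrrN expr1n.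
rewrite -mulr2n -[_ *+ 2]mulr_natl mulrCA ler_wpM2l // le_eqVlt; apply/orP; left; apply/eqP.
have -> : expR k%:R = expR 1 ^+ k :> R by rewrite -expRM_natl mulr1.
rewrite -mul2n !exprM t2 natrM -exprVn -!exprMn; congr (_ ^+ _).
by field; rewrite !gt_eqF.
Qed.

End ReferenceMatrix.

(** * Norm of the reference matrix by rounding to integer vectors *)

Section Rounding.
Context {R : realType}.
Variable r : nat.
Local Notation d := r.+1.

(* Integer vectors, each entry given by its sign and its size. *)
Local Notation ivec := {ffun 'I_d -> bool * 'I_r.+3}.

Definition int_row (z : ivec) : 'rV[R]_d :=
  \row_j ((-1) ^+ (z j).1 * (z j).2%:R).

(** The bound [4 d] is the cost of rounding a vector of squared norm at most [d], by
    [(|y_j| + 1) ^ 2 <= 2 y_j ^ 2 + 2]. *)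
Definition short_vec (z : ivec) : bool := (\sum_j (z j).2 ^ 2 <= 4 * d)%N.

Lemma int_row_sqr z : dot (int_row z) (int_row z) = (\sum_j (z j).2 ^ 2)%N%:R.
Proof.
rewrite /dot natr_sum; apply: eq_bigr => j _.
by rewrite mxE mulrACA -expr2 sqrr_sign mul1r -natrM mulnn.
Qed.

Lemma round_up (y : R) : exists s (m : nat),
  y <= (-1) ^+ (s : bool) * m%:R /\ m%:R <= `|y| + 1.
Proof.
have [y0|y0] := lerP 0 y.
  exists false, (Num.truncn y).+1; rewrite expr0 mul1r.
  have /andP [h1 h2] := truncn_itv y0.
  by rewrite ltW // -natr1 lerD2r ger0_norm.
exists true, (Num.truncn (- y)); rewrite expr1 mulN1r.
have y1 : 0 <= - y by rewrite oppr_ge0 ltW.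
have /andP [h1 h2] := truncn_itv y1.
by rewrite lerNr h1 ltr0_norm //; split => //; lra.
Qed.

Lemma round_scaled (a y : R) : exists s (m : nat),
  a * y <= a * ((-1) ^+ (s : bool) * m%:R) /\ m%:R <= `|y| + 1.
Proof.
have [a0|a0] := lerP 0 a.
  by have [s [m [h1 h2]]] := round_up y; exists s, m; rewrite ler_wpM2l.
have [s [m [h1 h2]]] := round_up (- y); exists (~~ s), m; rewrite -(normrN y); split=> //.
by rewrite signrN mulNr ler_nM2l // lerNl.
Qed.

(** Each coordinate is rounded in the direction favoured by the sign of [a 0 j], so the linear form
    never decreases. Unlike a net argument, this leaves no approximation error to absorb. *)
Lemma round_dot (a y : 'rV[R]_d) : dot y y <= d%:R ->
  exists2 z : ivec, short_vec z & dot a y <= dot a (int_row z).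
Proof.
move=> yd.
have yj j : y 0 j ^+ 2 <= d%:R.
  apply: le_trans yd; rewrite /dot (bigD1 j) //= -expr2 lerDl.
  by apply: sumr_ge0 => i _; rewrite -expr2 sqr_ge0.
have /choice [z hz] : forall j, exists q : bool * 'I_r.+3,
    a 0 j * y 0 j <= a 0 j * ((-1) ^+ q.1 * q.2%:R) /\ q.2%:R <= `|y 0 j| + 1.
  move=> j; have [s [m [h1 h2]]] := round_scaled (a 0 j) (y 0 j).
  have mr : (m < r.+3)%N.
    rewrite -(ltr_nat R) (le_lt_trans h2) // -[r.+3%:R]natr1 ltrD2r.
    rewrite -(@ltr_pXn2r _ 2) ?nnegrE // real_normK ?num_real //.
    rewrite (le_lt_trans (yj j)) // -natrX ltr_nat; nia.
  by exists (s, Ordinal mr).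
exists [ffun j => z j].
  rewrite /short_vec -(ler_nat R) -int_row_sqr.
  apply: le_trans (_ : \sum_j (2 * (y 0 j * y 0 j) + 2) <= _).
    apply: ler_sum => j _; rewrite !mxE !ffunE mulrACA -expr2 sqrr_sign mul1r -expr2.
    have [_ h] := hz j; apply: le_trans (_ : (`|y 0 j| + 1) ^+ 2 <= _).
      by rewrite ler_pXn2r ?nnegrE // addr_ge0.
    have := real_normK (num_real (y 0 j)); have := sqr_ge0 (`|y 0 j| - 1).
    rewrite -expr2; nra.
  rewrite big_split /= -mulr_sumr sumr_const card_ord natrM -[2 *+ d]mulr_natr.
  by move: yd; rewrite /dot; lra.
by apply: ler_sum => j _; rewrite !mxE !ffunE; case: (hz j).
Qed.

(** Give [z] the weight [2 ^ - (sum |z_j|)]. A short vector has [sum |z_j| <= sum z_j ^ 2 <= 4 d],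
    so its weight times [2 ^ (4 d)] is at least 1; each coordinate has total weight at most 4, and
    [16 * 4 = 64]. *)
Lemma card_short : #|[pred z : ivec | short_vec z]|%:R <= 64 ^+ d :> R.
Proof.
pose wt (q : bool * 'I_r.+3) : R := (2 ^+ q.2)^-1.
apply: le_trans (_ : \sum_(z : ivec) 2 ^+ (4 * d)%N * \prod_j wt (z j) <= _).
  rewrite -sum1_card natr_sum big_mkcond /=; apply: ler_sum => z _.
  rewrite inE; case: ifP => [hz|_]; last first.
    rewrite mulr_ge0 ?exprn_ge0 // prodr_ge0 // => j _.
    by rewrite invr_ge0 exprn_ge0.
  rewrite /wt prodfV -expr_sum -expfB_cond ?pnatr_eq0 //; last first.
    rewrite /= (leq_trans _ hz) //; apply: leq_sum => j _.
    by rewrite -mulnn; case: (nat_of_ord _) => // m; rewrite leq_pmulr.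
  by rewrite exprn_ege1 // ler1n.
rewrite -mulr_sumr -(bigA_distr_bigA (fun _ => wt)) /= prodr_const card_ord.
rewrite exprM -exprMn lerXn2r ?nnegrE ?mulr_ge0 ?sumr_ge0 //.
  by move=> q _; rewrite invr_ge0 exprn_ge0.
have -> : \sum_q wt q = \sum_(s : bool) \sum_(m < r.+3) (2 ^+ m)^-1.
  by rewrite pair_bigA.
rewrite big_bool /=.
have : \sum_(m < r.+3) (2 ^+ m)^-1 <= 2 :> R.
  have -> : \sum_(m < r.+3) (2 ^+ m)^-1 = 2 - 2 * (2 ^+ r.+3)^-1 :> R.
    elim: r.+3 => [|m IH]; first by rewrite big_ord0 expr0 invr1; lra.
    by rewrite big_ord_recr /= IH exprS invfM; lra.
  by have : 0 <= (2 ^+ r.+3)^-1 :> R; [rewrite invr_ge0 exprn_ge0 | lra].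
lra.
Qed.

Lemma sum_pair (V : nmodType) n (F : 'I_n * 'I_n -> V) :
  \sum_e F e = \sum_u \sum_v F (u, v).
Proof. by rewrite pair_bigA; apply: eq_bigr => -[]. Qed.

Definition ref_mx (w : {ffun 'I_d * 'I_d -> 'I_3}) : 'M[R]_d :=
  \matrix_(u, v) three_point (w (edge u v)).

Lemma ref_mx_sym w : (ref_mx w)^T = ref_mx w.
Proof. by apply/matrixP => u v; rewrite !mxE edgeC. Qed.

Lemma spectral_radius_round (Y : 'M[R]_d) : Y^T = Y ->
  exists z z' : ivec, [/\ short_vec z, short_vec z' &
    spectral_radius Y * d%:R <= dot (int_row z *m Y) (int_row z')].
Proof.
move=> Ys; have [a [x [x1 xY -> _]]] := sym_spectral_radius Ys.
pose s : R := Num.sqrt d%:R; have ss : s * s = d%:R by rewrite -expr2 sqr_sqrtr.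
(* The bilinear form at [y] and [y'] equals [|a| d]. The two arguments are rounded in turn, each
   against the linear form given by the other. *)
pose y := s *: x; pose y' := Num.sg a *: y.
have yd : dot y y <= d%:R by rewrite dotZl dotZr x1 mulr1 ss.
have y'd : dot y' y' <= d%:R.
  rewrite dotZl dotZr mulrA -expr2 sqr_sg; apply: le_trans yd.
  by case: (a != 0); rewrite ?mul1r // mul0r dot_ge0.
have [z' z's hz'] := round_dot (y *m Y) y'd.
have [z zs hz] := round_dot (int_row z' *m Y) yd.
exists z, z'; split=> //.
rewrite dot_mulmx Ys dotC; apply: le_trans hz.
rewrite dot_mulmx Ys dotC; apply: le_trans hz'.
rewrite /y' /y -scalemxAl xY !(dotZl, dotZr) x1.
by rewrite normrEsg -ss le_eqVlt; apply/orP; left; apply/eqP; ring.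
Qed.

(** Collecting the two positions of each unordered pair turns the bilinear form into a linear form
    in independent variables, as [ref_ex_moment] requires. *)
Lemma dot_ref_mx (z z' : 'rV[R]_d) w :
  dot (z *m ref_mx w) z' =
  \sum_(e : 'I_d * 'I_d) ((if (e.1 <= e.2)%N then z 0 e.1 * z' 0 e.2 else 0) +
     (if (e.1 < e.2)%N then z 0 e.2 * z' 0 e.1 else 0)) * three_point (w e).
Proof.
under [RHS]eq_bigr do rewrite mulrDl.
rewrite big_split /=.
transitivity (\sum_v \sum_u z 0 u * three_point (w (edge u v)) * z' 0 v).
  by apply: eq_bigr => v _; rewrite mxE mulr_suml; apply: eq_bigr => u _; rewrite mxE.
rewrite sum_pair [X in _ = _ + X]sum_pair /=.
rewrite exchange_big /= [X in _ = _ + X]exchange_big /= -big_split /=.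
apply: eq_bigr => u _; rewrite -big_split /=; apply: eq_bigr => v _.
rewrite /edge; case: leqP => uv; first by rewrite mul0r addr0; ring.
by rewrite mul0r add0r; ring.
Qed.

(** The maximum over pairs of short vectors is replaced by the sum of their moments, at the price of
    [64 ^ d * 64 ^ d]. For [d] of order [k] the result is [(const k) ^ k], which means a norm of
    order [sqrt k]. *)
Lemma ref_ex_spectral_radius k : (0 < k)%N ->
  ref_ex (fun w => spectral_radius (ref_mx w) ^+ k.*2) <=
  (64 * 64) ^+ d * (2 * (32 * 32 * expR 1 * k%:R) ^+ k).
Proof.
move=> k0; have d0 : 0 < d%:R :> R by [].
have dk : 0 < d%:R ^+ k.*2 :> R by rewrite exprn_gt0.
rewrite -(ler_pM2r dk).
pose S z z' w : R := dot (int_row z *m ref_mx w) (int_row z').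
have sqr_ge (x : R) : 0 <= x ^+ k.*2 by rewrite -mul2n exprM exprn_ge0 ?sqr_ge0.
apply: le_trans (_ : ref_ex (fun w => \sum_(z | short_vec z)
    \sum_(z' | short_vec z') S z z' w ^+ k.*2) <= _).
  rewrite mulrC -ref_exZ; apply: ref_ex_le => w.
  have [z [z' [hz hz' h]]] := spectral_radius_round (ref_mx_sym w).
  rewrite mulrC -exprMn (bigD1 z) //= (bigD1 z') //=.
  apply: le_trans (_ : S z z' w ^+ k.*2 <= _).
    rewrite lerXn2r ?nnegrE ?mulr_ge0 ?spectral_radius_ge0 ?ref_mx_sym //.
    by apply: le_trans h; rewrite mulr_ge0 // spectral_radius_ge0 ?ref_mx_sym.
  rewrite -addrA lerDl addr_ge0 // ?sumr_ge0 // => z1 _; rewrite sumr_ge0 //.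
rewrite ref_ex_sum; pose bnd : R := 2 * (32 * 32 * expR 1 * k%:R * d%:R ^+ 2) ^+ k.
have bnd0 : 0 <= bnd by rewrite mulr_ge0 // exprn_ge0 // !mulr_ge0 ?expR_ge0.
apply: le_trans (_ : \sum_(z | short_vec z) \sum_(z' | short_vec z') bnd <= _).
  apply: ler_sum => z hz; rewrite ref_ex_sum; apply: ler_sum => z' hz'.
  rewrite (_ : (fun w => _) = fun w : {ffun 'I_d * 'I_d -> 'I_3} => (\sum_(e : 'I_d * 'I_d)
      ((if (e.1 <= e.2)%N then (int_row z) 0 e.1 * (int_row z') 0 e.2 else 0) +
     (if (e.1 < e.2)%N then (int_row z) 0 e.2 * (int_row z') 0 e.1 else 0))
      * three_point (w e)) ^+ k.*2); last first.
    by apply/funext => w; rewrite /S dot_ref_mx.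
  (* [32 d ^ 2 = 2 (4 d) (4 d)]: two short vectors, and a factor 2 for squaring a coefficient that
     is a sum of two products. *)
  apply: le_trans (ref_ex_moment (V := 32 * d%:R ^+ 2) k0 _ _) _.
  - by rewrite mulr_gt0 // exprn_gt0.
  - apply: le_trans (_ : 2 * (dot (int_row z) (int_row z) * dot (int_row z') (int_row z')) <= _).
      rewrite /dot big_distrlr mulr_sumr /=.
      under [leRHS]eq_bigr do rewrite mulr_sumr.
      pose q (e : 'I_d * 'I_d) : R := 2 * ((int_row z) 0 e.1 * (int_row z) 0 e.1 *
         ((int_row z') 0 e.2 * (int_row z') 0 e.2)).
      have -> : \sum_u \sum_v 2 * ((int_row z) 0 u * (int_row z) 0 u *
         ((int_row z') 0 v * (int_row z') 0 v)) =
         \sum_(e : 'I_d * 'I_d) (if (e.1 <= e.2)%N then q e else 0) +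
         \sum_(e : 'I_d * 'I_d) (if (e.1 < e.2)%N then q (e.2, e.1) else 0).
        rewrite sum_pair [X in _ = _ + X]sum_pair /=.
        rewrite [X in _ = _ + X]exchange_big -big_split /=; apply: eq_bigr => u _.
        rewrite -big_split /=; apply: eq_bigr => v _.
        by case: leqP; rewrite ?addr0 ?add0r.
      rewrite -big_split /=; apply: ler_sum => -[u v] _ /=; rewrite /q /=.
      have sq (x y : R) : x * x * (y * y) = (x * y) ^+ 2 by ring.
      have sq2 (x y : R) : (x + y) ^+ 2 <= 2 * x ^+ 2 + 2 * y ^+ 2.
        have := sqr_ge0 (x - y); nra.
      apply: le_trans (sq2 _ _) _; rewrite !sq.
      by case: ifP; case: ifP; rewrite ?expr0n /= ?mulr0.
    have short_le (y : ivec) : short_vec y -> dot (int_row y) (int_row y) <= 4 * d%:R.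
      by move=> hy; rewrite int_row_sqr -natrM ler_nat.
    rewrite (_ : 32 * d%:R ^+ 2 = 2 * (4 * d%:R * (4 * d%:R))); last by ring.
    by rewrite ler_wpM2l // ler_pM ?dot_ge0 ?short_le.
  rewrite le_eqVlt; apply/orP; left; apply/eqP; rewrite /bnd; congr (2 * _ ^+ k); ring.
have bndE : bnd = 2 * (32 * 32 * expR 1 * k%:R) ^+ k * d%:R ^+ k.*2.
  by rewrite /bnd exprMn -exprM mul2n mulrA.
rewrite !sumr_const -[leLHS]mulr_natl -[bnd *+ _]mulr_natl -[leRHS]mulrA -bndE.
have := card_short; set c := #|_|%:R => hc.
have cc : c * c <= (64 * 64) ^+ d by rewrite exprMn ler_pM // ler0n.
by rewrite mulrA ler_wpM2r.
Qed.

End Rounding.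

(** * Norm of a sparse centred matrix *)

Section SparseNorm.
Context {R : realType}.

Definition graph_mx n (h : 'I_n * 'I_n -> bool -> R) (A : 'M[bool]_n) : 'M[R]_n :=
  \matrix_(u, v) if u == v then 0 else h (edge u v) (A u v).

Lemma graph_mx_sym n h (A : 'M[bool]_n) : simple_graph A ->
  (graph_mx h A)^T = graph_mx h A.
Proof.
by case/simple_graphP => _ As; apply/matrixP => u v; rewrite !mxE eq_sym edgeC As.
Qed.

Lemma size_walk_edges l (T : nat) (w : l.+1.-tuple 'I_T) : size (walk_edges w) = l.
Proof. by case/tupleP: w => x w /=; rewrite size_pairmap size_tuple. Qed.

Lemma walk_edges_le n (s : seq 'I_n) e : e \in walk_edges s -> (e.1 <= e.2)%N.
Proof.
by case: s => // x s /mem_walk_edges [_ _ <-]; exact: edge_fst_le.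
Qed.

(** Each factor of the falling factorial is at least [2 k + 1 - k > k]. A reference matrix of size
    [2 k + 1] therefore has room for every shape with up to [k + 1] vertices. *)
Lemma expn_le_ffact k v : (v <= k.+1)%N -> (k ^ v <= (k.*2.+1) ^_ v)%N.
Proof.
elim: v => // v IH vk; rewrite ffactnSr expnSr leq_mul ?IH ?(ltnW vk) //; lia.
Qed.

Lemma ffact_le_expn n v : (n ^_ v <= n ^ v)%N.
Proof. by elim: v => // v IH; rewrite ffactnSr expnSr leq_mul // leq_subr. Qed.

Variables (n k : nat) (p : 'M[R]_n.+1) (h : 'I_n.+1 * 'I_n.+1 -> bool -> R).
Hypothesis p01 : forall u v, 0 <= p u v <= 1.
Hypothesis k0 : (0 < k)%N.
Hypothesis kn : (k <= n.+1)%N.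
Hypothesis h_mean : forall e : 'I_n.+1 * 'I_n.+1, (e.1 < e.2)%N ->
  p e.1 e.2 * h e true + (1 - p e.1 e.2) * h e false = 0.
Hypothesis h_var : forall e : 'I_n.+1 * 'I_n.+1, (e.1 < e.2)%N ->
  p e.1 e.2 * h e true ^+ 2 + (1 - p e.1 e.2) * h e false ^+ 2 <= n.+1%:R^-1.
Hypothesis h_bnd : forall (e : 'I_n.+1 * 'I_n.+1) b, (e.1 < e.2)%N ->
  h e b ^+ 2 <= k%:R^-1.

Let N : R := n.+1%:R.
Let kR : R := k%:R.
Let beta : R := Num.sqrt kR^-1.

Let kR0 : 0 < kR. Proof. by rewrite ltr0n. Qed.
Let N0 : 0 < N. Proof. by rewrite ltr0n. Qed.
Let beta2 : beta ^+ 2 = kR^-1.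
Proof. by rewrite sqr_sqrtr // invr_ge0 ltW. Qed.
Let beta0 : 0 <= beta. Proof. exact: sqrtr_ge0. Qed.

(** Two factors are bounded through the variance [1 / N], the others by [beta], and
    [beta ^ (m - 2) / N = (k / N) beta ^ m]. *)
Lemma edge_moment (e : 'I_n.+1 * 'I_n.+1) m : (e.1 < e.2)%N -> (1 < m)%N ->
  `|p e.1 e.2 * h e true ^+ m + (1 - p e.1 e.2) * h e false ^+ m|
    <= kR / N * beta ^+ m.
Proof.
move=> he; case: m => [|[|m]] // _; have /andP [q0 q1] := p01 e.1 e.2.
have hb b : `|h e b ^+ m| <= beta ^+ m.
  rewrite normrX lerXn2r ?nnegrE // -(@ler_pXn2r _ 2) ?nnegrE //.
  by rewrite beta2 real_normK ?num_real ?h_bnd.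
rewrite -addn2 !exprD beta2 [leRHS](_ : _ = beta ^+ m * N^-1); last first.
  by field; rewrite !gt_eqF.
apply: le_trans (_ : beta ^+ m * (p e.1 e.2 * h e true ^+ 2 +
   (1 - p e.1 e.2) * h e false ^+ 2) <= _); last first.
  by rewrite ler_wpM2l ?exprn_ge0 // h_var.
apply: le_trans (ler_normD _ _) _; rewrite mulrDr; apply: lerD.
  rewrite normrM (ger0_norm q0) [leRHS]mulrCA ler_wpM2l // normrM [`|_ ^+ 2|]ger0_norm ?sqr_ge0 //.
  by rewrite ler_wpM2r ?sqr_ge0.
have q1' : 0 <= 1 - p e.1 e.2 by rewrite subr_ge0.
rewrite normrM (ger0_norm q1') [leRHS]mulrCA ler_wpM2l // normrM [`|_ ^+ 2|]ger0_norm ?sqr_ge0 //.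
by rewrite ler_wpM2r ?sqr_ge0.
Qed.

(** A loop gives 0 by the zero diagonal, an edge traversed once by centring. Otherwise the factors
    [beta] multiply to [beta ^ (2 k) = k ^ (- k)] and each distinct edge leaves one [k / N]. *)
Lemma graph_ex_walk (w : k.*2.+1.-tuple 'I_n.+1) :
  graph_ex p (fun A => \prod_(e <- walk_edges w) graph_mx h A e.1 e.2) <=
  if recurrent (walk_edges w)
  then (kR / N) ^+ size (undup (walk_edges w)) * kR^-1 ^+ k else 0.
Proof.
set es := walk_edges w.
have rhs0 : 0 <= (if recurrent es
    then (kR / N) ^+ size (undup es) * kR^-1 ^+ k else 0).
  case: ifP => // _; apply: mulr_ge0; apply: exprn_ge0.
    by rewrite divr_ge0 ?(ltW kR0) ?(ltW N0).
  by rewrite invr_ge0 ltW.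
have [hes|/allPn [e ees he]] := boolP (all (fun e : 'I_n.+1 * 'I_n.+1 => (e.1 < e.2)%N) es);
    last first.
  rewrite (@eq_graph_ex _ _ _ _ (fun=> 0)).
    by rewrite /graph_ex big1 // => A _; rewrite mulr0.
  move=> A _; apply/eqP; rewrite prodf_seq_eq0; apply/hasP; exists e => //=.
  have := walk_edges_le ees; rewrite leq_eqVlt (negPf he) orbF => /eqP /ord_inj E.
  by rewrite mxE E eqxx.
rewrite (@eq_graph_ex _ _ _ _ (fun A => \prod_(e <- es) h e (A e.1 e.2))); last first.
  move=> A _; rewrite big_seq [RHS]big_seq; apply: eq_bigr => e ees.
  have /allP /(_ e ees) he := hes; rewrite mxE -val_eqE /= ltn_eqF //.
  rewrite /edge; case: leqP => [_|h']; first by case: e {ees he}.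
  by move: he; rewrite ltnNge ltnW.
rewrite graph_ex_seq //.
have [rec|/allPn [e ees]] := boolP (recurrent es); last first.
  rewrite -leqNgt => ce; have he := allP hes _ ees.
  have c1 : count_mem e es = 1%N by apply/eqP; rewrite eqn_leq ce -has_count has_pred1.
  by rewrite (bigD1 e) //= c1 !expr1 h_mean // mul0r.
apply: le_trans (ler_norm _) _; rewrite normr_prod.
apply: le_trans (_ : \prod_(e <- undup es) (kR / N * beta ^+ count_mem e es) <= _); last first.
  rewrite big_split /= big_const_seq iter_mulr_1.
  rewrite (_ : \prod_(e <- undup es) beta ^+ count_mem e es = beta ^+ size es); last first.
    have := big_undup_iterop_count *%R es xpredT (fun=> beta).
    by rewrite /= => ->; rewrite big_const_seq iter_mulr_1 count_predT.
  by rewrite count_predT size_walk_edges -mul2n exprM beta2.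
rewrite big_uniq ?undup_uniq //= [leRHS]big_mkcond [leLHS]big_mkcond /=.
apply: ler_prod => e _; rewrite mem_undup.
case: ifP => [he|hn].
  rewrite normr_ge0 /=; case: ifPn => ees.
    by apply: edge_moment => //; exact: (allP rec).
  by rewrite (count_memPn ees) !expr0 !mulr1 addrC subrK normr1.
by case: ifPn => ees; rewrite ?ler01 ?lexx //; move: (allP hes _ ees); rewrite hn.
Qed.

(* A walk with v vertices and t edges has v <= t + 1, and its shape occurs
   n^_v times among n vertices and (2k+1)^_v >= k^v times in the reference matrix. *)
Lemma graph_ex_trace :
  graph_ex p (fun A => \tr (graph_mx h A ^+ k.*2)) <=
  N / kR * kR^-1 ^+ k *
  (k.*2.+1%:R * ref_ex (fun w => spectral_radius (@ref_mx R k.*2 w) ^+ k.*2)).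
Proof.
pose good (c : k.*2.+1.-tuple 'I_k.*2.+1) :=
  closed_walk c && recurrent (walk_edges c).
pose H c : R := if good c then (kR / N) ^+ size (undup (walk_edges c)) * kR^-1 ^+ k else 0.
pose H' c : R := (good c)%:R.
have a0 : 0 <= N / kR * kR^-1 ^+ k.
  by rewrite !mulr_ge0 ?exprn_ge0 ?invr_ge0 ?(ltW kR0) ?(ltW N0).
have goodE m (w : k.*2.+1.-tuple 'I_m) :
    good (canon w) = closed_walk w && recurrent (walk_edges w).
  have wi := @canon_idx_inj _ _ w.
  by rewrite /good closed_walk_map // recurrent_walk_map.
apply: le_trans (_ : \sum_(w : k.*2.+1.-tuple 'I_n.+1) H (canon w) <= _).
  rewrite (@eq_graph_ex _ _ _ _ (fun A => \sum_(w : k.*2.+1.-tuple 'I_n.+1 | closed_walk w)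
    \prod_(e <- walk_edges w) graph_mx h A e.1 e.2)); last first.
    by move=> A sA; rewrite mxtraceX_walks // graph_mx_sym.
  rewrite graph_ex_sum big_mkcond; apply: ler_sum => w _.
  rewrite /H goodE size_undup_edges_map; last exact: canon_idx_inj.
  by case: ifP => //= cw; exact: graph_ex_walk.
apply: le_trans (ler_sum_canon (T' := 'I_k.*2.+1) (H' := H') a0 _ _ _) _.
- by move=> c; rewrite ler0n.
- move=> w; rewrite /H /H'; case: ifP => [gc|_]; last by rewrite !mulr0.
  set c := canon w in gc *; rewrite mulr1 !card_ord.
  set v := size (undup c); set t := size _.
  have vt : (v <= t.+1)%N by exact: size_undup_walk.
  have tk : (t <= k)%N.
    case/andP: gc => _ /recurrent_size; rewrite size_walk_edges leq_double; exact.
  rewrite mulrA [leRHS]mulrAC ler_wpM2r ?exprn_ge0 ?invr_ge0 ?(ltW kR0) //.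
  (* [N ^ v (k / N) ^ t] is [(N / k) k ^ v] times [(k / N) ^ (t + 1 - v)], and the last factor is at
     most 1 because [v <= t + 1] and [k <= N]. *)
  apply: le_trans (_ : N ^+ v * (kR / N) ^+ t <= _).
    rewrite ler_wpM2r ?exprn_ge0 ?divr_ge0 ?(ltW kR0) ?(ltW N0) //.
    by rewrite /N -natrX ler_nat ffact_le_expn.
  apply: le_trans (_ : N / kR * kR ^+ v <= _); last first.
    rewrite ler_wpM2l ?divr_ge0 ?(ltW kR0) ?(ltW N0) // /kR -natrX ler_nat expn_le_ffact //.
    exact: leq_trans vt _.
  rewrite exprMn exprVn mulrA ler_pdivrMr ?exprn_gt0 // mulrAC -mulrA.
  rewrite -(ler_pM2r kR0) -[leLHS]mulrA -exprSr.
  rewrite [leRHS](_ : _ = N ^+ t.+1 * kR ^+ v); last first.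
    by rewrite exprS; field; rewrite gt_eqF.
  rewrite -(subnKC vt) !exprD -!mulrA ler_wpM2l ?exprn_ge0 ?(ltW N0) //.
  rewrite mulrC ler_wpM2r ?exprn_ge0 ?(ltW kR0) //.
  by rewrite lerXn2r ?nnegrE ?(ltW kR0) ?(ltW N0) // ler_nat.
- by move=> w; exists (canon w); rewrite canonK.
rewrite ler_wpM2l // -ref_exZ.
apply: le_trans (_ : ref_ex (fun w => \tr (@ref_mx R k.*2 w ^+ k.*2)) <= _); last first.
  by apply: ref_ex_le => w; rewrite trace_spectral_radius ?ref_mx_sym.
rewrite (_ : (fun w => \tr _) = fun w : {ffun 'I_k.*2.+1 * 'I_k.*2.+1 -> 'I_3} => \sum_(q : k.*2.+1.-tuple 'I_k.*2.+1 | closed_walk q)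
    \prod_(e <- walk_edges q) three_point (w e)); last first.
  apply/funext => w; rewrite mxtraceX_walks ?ref_mx_sym //.
  apply: eq_bigr => q _; rewrite big_seq [RHS]big_seq; apply: eq_bigr => e eq.
  by rewrite mxE /edge (walk_edges_le eq); case: e {eq}.
rewrite ref_ex_sum [leRHS]big_mkcond; apply: ler_sum => q _.
rewrite /H' goodE; case: (closed_walk q) => //=.
(* Closed walks that are not recurrent still have nonnegative expectation in the reference model, so
   completing the sum to a full trace only increases it. *)
have [h1 h2] := @ref_ex_walk R k.*2.+1 (walk_edges q).
by case: (boolP (recurrent _)) => [/h2|_].
Qed.

End SparseNorm.

(** The powers [k ^ k] of the reference moment and [k ^ (- k)] of the walks cancel. With [k] of
    order [log n] the factor [n] is itself exponential in [k], so the norm is bounded by a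
    constant. *)
Lemma graph_ex_spectral_radius (R : realType) : exists2 C : R, 0 < C &
  forall (n k : nat) (p : 'M[R]_n.+1) (h : 'I_n.+1 * 'I_n.+1 -> bool -> R),
  (forall u v, 0 <= p u v <= 1) -> (0 < k)%N -> (k <= n.+1)%N ->
  (forall e : 'I_n.+1 * 'I_n.+1, (e.1 < e.2)%N ->
    p e.1 e.2 * h e true + (1 - p e.1 e.2) * h e false = 0) ->
  (forall e : 'I_n.+1 * 'I_n.+1, (e.1 < e.2)%N ->
    p e.1 e.2 * h e true ^+ 2 + (1 - p e.1 e.2) * h e false ^+ 2 <= n.+1%:R^-1) ->
  (forall (e : 'I_n.+1 * 'I_n.+1) b, (e.1 < e.2)%N -> h e b ^+ 2 <= k%:R^-1) ->
  graph_ex p (fun A => spectral_radius (graph_mx h A) ^+ k.*2) <= n.+1%:R * C ^+ k.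
Proof.
pose a : R := 64 * 64; pose b : R := 32 * 32 * expR 1.
have a1 : 1 <= a by rewrite /a; lra.
have b1 : 1 <= b.
  by rewrite /b; have := expR_ge1Dx (1 : R); lra.
(* [2 (2 k + 1) / k <= 6] and [a ^ (2 k + 1) = a (a a) ^ k]; the prefactor [6 a] is absorbed into
   the [k]-th power. *)
exists (6 * a * (a * a * b)); first by rewrite !mulr_gt0 //; lra.
move=> n k p h p01 k0 kn hm hv hb.
have kR0 : 0 < k%:R :> R by rewrite ltr0n.
apply: le_trans (_ : graph_ex p (fun A => \tr (graph_mx h A ^+ k.*2)) <= _).
  apply: graph_ex_le => // A sA; apply: spectral_radius_trace.
  exact: graph_mx_sym.
apply: le_trans (graph_ex_trace p01 k0 kn hm hv hb) _.
apply: le_trans (_ : n.+1%:R / k%:R * k%:R^-1 ^+ k *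
  (k.*2.+1%:R * (a ^+ k.*2.+1 * (2 * (b * k%:R) ^+ k))) <= _).
  rewrite ler_wpM2l ?mulr_ge0 ?exprn_ge0 ?invr_ge0 //.
  by rewrite ler_wpM2l // ref_ex_spectral_radius.
rewrite [leLHS](_ : _ = n.+1%:R * (2 * k.*2.+1%:R / k%:R * a * (a * a * b) ^+ k)); last first.
  have -> : a ^+ k.*2.+1 = a * (a * a) ^+ k by rewrite exprS -mul2n exprM -expr2.
  rewrite (exprMn_comm k (mulrC b k%:R)) (exprMn_comm k (mulrC (a * a) b)) exprVn.
  have : k%:R ^+ k != 0 :> R by rewrite expf_neq0 ?gt_eqF.
  move: (a ^+ 2) (_ ^+ k) ((a * a) ^+ k) (b ^+ k) => _ kk A B kk0.
  by field; rewrite kk0 gt_eqF.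
rewrite ler_wpM2l // (exprMn_comm k (mulrC (6 * a) _)) ler_wpM2r ?exprn_ge0 ?mulr_ge0 //; try lra.
apply: le_trans (_ : 6 * a <= _); last first.
  rewrite -{1}[6 * a]expr1 ler_eXn2l //; lra.
rewrite ler_wpM2r //; first lra.
rewrite ler_pdivrMr // -[k.*2.+1%:R]natr1 -mul2n natrM.
have : 1 <= k%:R :> R by rewrite ler1n.
lra.
Qed.

(** * Perturbation of eigenvalues *)

Section Perturbation.
Context {R : realType}.

(** Applying [P] again gives [x P P = a x P - x W P]. If [|a| <= ci / 2], the lower bound on the
    range of [P] absorbs [a x P] and forces [|x P| <= 2 cP w / ci]; but [|a| - w <= |x P|]. *)
Lemma eigenvalue_dichotomy n (P W : 'M[R]_n) (w cP ci a : R) (x : 'rV[R]_n) :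
  (forall v, euclid_norm (v *m W) <= w * euclid_norm v) ->
  (forall v, euclid_norm (v *m P) <= cP * euclid_norm v) ->
  (forall v, ci * euclid_norm (v *m P) <= euclid_norm (v *m P *m P)) ->
  0 < ci -> 0 <= cP -> euclid_norm x = 1 -> x *m (P + W) = a *: x ->
  w * (1 + 2 * cP / ci) < `|a| -> ci / 2 < `|a|.
Proof.
move=> hW hP hi ci0 cP0 x1 xa ha; rewrite ltNge; apply/negP => ha2.
have xP : x *m P = a *: x - x *m W by rewrite -xa mulmxDr addrK.
have h1 : `|a| - w <= euclid_norm (x *m P).
  have -> : `|a| = euclid_norm (x *m P + x *m W).
    by rewrite xP subrK euclid_normZ x1 mulr1.
  have := euclid_normD (x *m P) (x *m W); have := hW x; rewrite x1; lra.
have h2 : euclid_norm (x *m P *m P) <= `|a| * euclid_norm (x *m P) + cP * w.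
  rewrite {1}xP mulmxBl -scalemxAl; apply: le_trans (euclid_normB _ _) _.
  rewrite euclid_normZ lerD2l; apply: le_trans (hP _) _.
  by rewrite ler_wpM2l //; have := hW x; rewrite x1 mulr1.
have := hi x; set y := euclid_norm (x *m P) in h1 h2 * => h3.
have y0 : 0 <= y by exact: euclid_norm_ge0.
have w0 : 0 <= w by have := hW x; rewrite x1 mulr1; apply: le_trans; exact: euclid_norm_ge0.
have h4 : ci / 2 * y <= cP * w by clear xa xP; nra.
have h5 : ci / 2 * (`|a| - w) <= cP * w by clear xa xP; nra.
have h6 : ci / 2 * (w * (1 + 2 * cP / ci)) = ci / 2 * w + cP * w.
  by field; rewrite gt_eqF.
have h7 : ci / 2 * (w * (1 + 2 * cP / ci)) < ci / 2 * `|a|.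
  by rewrite ltr_pM2l // divr_gt0.
by clear xa xP; lra.
Qed.

Lemma diag_mx_norm_le n (e : 'rV[R]_n) c v : 0 <= c ->
  (forall i, `|e 0 i| <= c) ->
  euclid_norm (v *m diag_mx e) <= c * euclid_norm v.
Proof.
move=> c0 he; rewrite euclid_norm_le ?mulr_ge0 ?euclid_norm_ge0 //.
rewrite exprMn euclid_norm_sqr /dot mulr_sumr; apply: ler_sum => i _.
rewrite mul_mx_diag !mxE -!expr2 exprMn mulrC ler_wpM2r ?sqr_ge0 //.
by rewrite -real_normK ?num_real // lerXn2r ?nnegrE.
Qed.

(** With [q = v E P] the two vectors are [q E] and [q E E P E]. Replacing [E E] by 1 costs at most
    half of [c |q|], and the outer [E] on each side costs a factor 2, whence [c / 8]. *)
Lemma range_bound_diag n (P : 'M[R]_n) (e : 'rV[R]_n) (eta g c : R) :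
  (forall i, `|e 0 i - 1| <= eta) -> 0 <= eta <= 2^-1 ->
  (forall v, euclid_norm (v *m P) <= g * euclid_norm v) ->
  (forall v, c * euclid_norm (v *m P) <= euclid_norm (v *m P *m P)) ->
  0 <= g -> 0 <= c -> 3 * eta * g <= c / 2 ->
  forall v, let P' := diag_mx e *m P *m diag_mx e in
    c / 8 * euclid_norm (v *m P') <= euclid_norm (v *m P' *m P').
Proof.
move=> he /andP [eta0 eta1] hg hc g0 c0 hgc v /=.
set E := diag_mx e; pose q := v *m E *m P.
have e2 i : 2^-1 <= e 0 i <= 2 by have := he i; rewrite ler_distl; lra.
have E2 u : euclid_norm (u *m E) <= 2 * euclid_norm u.
  by apply: diag_mx_norm_le => // i; rewrite ler_norml; have := e2 i; lra.
have Ei u : euclid_norm u <= 2 * euclid_norm (u *m E).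
  have uE : u = u *m E *m diag_mx (\row_i (e 0 i)^-1).
    rewrite -mulmxA -[LHS]mulmx1; congr (_ *m _); apply/matrixP => i j.
    rewrite mul_mx_diag !mxE; case: eqVneq => [<-|_]; last by rewrite mulr0n mul0r.
    by rewrite !mulr1n mulfV //; have := e2 i; apply: contraTneq => ->; lra.
  rewrite [X in euclid_norm X <= _]uE; apply: diag_mx_norm_le => // i.
  have en : 2^-1 <= `|e 0 i| by have /andP [l1 l2] := e2 i; rewrite ger0_norm; lra.
  by rewrite mxE normfV -[2]invrK lef_pV2 ?posrE //; apply: lt_le_trans en.
have E1 u : euclid_norm (u *m (E *m E - 1%:M)) <= 3 * eta * euclid_norm u.
  have -> : E *m E - 1%:M = diag_mx (\row_i (e 0 i ^+ 2 - 1)).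
    apply/matrixP => i j; rewrite mul_mx_diag !mxE.
    by case: eqVneq => [<-|_]; rewrite ?mulr1n ?mulr0n ?mul0r ?subrr ?expr2.
  apply: diag_mx_norm_le; first lra.
  move=> i; rewrite mxE; have := he i; have := e2 i; rewrite ler_distl ler_norml; nra.
have -> : v *m (E *m P *m E) *m (E *m P *m E) = q *m (E *m E) *m P *m E.
  by rewrite /q !mulmxA.
have -> : v *m (E *m P *m E) = q *m E by rewrite /q !mulmxA.
have s1 : euclid_norm (q *m E) <= 2 * euclid_norm q := E2 q.
have s2 := Ei (q *m (E *m E) *m P).
have s3 : euclid_norm (q *m P) - 3 * eta * g * euclid_norm q
    <= euclid_norm (q *m (E *m E) *m P).
  have -> : q *m P = q *m (E *m E) *m P - q *m (E *m E - 1%:M) *m P.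
    by rewrite -mulmxBl -mulmxBr opprB addrC subrK mulmx1.
  have := euclid_normB (q *m (E *m E) *m P) (q *m (E *m E - 1%:M) *m P).
  have := hg (q *m (E *m E - 1%:M)); have := ler_wpM2l g0 (E1 q); lra.
have s4 : c * euclid_norm q <= euclid_norm (q *m P) := hc (v *m E).
have q0 := euclid_norm_ge0 q.
have s5 : 3 * eta * g * euclid_norm q <= c / 2 * euclid_norm q by rewrite ler_wpM2r.
have s6 : c * euclid_norm (q *m E) <= c * (2 * euclid_norm q) by rewrite ler_wpM2l.
lra.
Qed.

(* For symmetric [G] the kernels of [G] and [G *m G] agree, so [G] factors
   through [G *m G]. *)
Lemma sym_range_bound n (G : 'M[R]_n) : G^T = G ->
  exists2 c : R, 0 < c &
    forall v, c * euclid_norm (v *m G) <= euclid_norm (v *m G *m G).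
Proof.
move=> Gs.
have /submxP [T0 GT] : (G <= G *m G)%MS.
  have kk : (kermx (G *m G) <= kermx G)%MS.
    apply/rV_subP => v /sub_kermxP; rewrite mulmxA => vGG; apply/sub_kermxP.
    by apply: dot_eq0; rewrite dot_mulmx Gs dotE vGG trmx0 mulmx0 mxE.
  have rk : (\rank G <= \rank (G *m G))%N.
    have := mxrankS kk; rewrite !mxrank_ker.
    have := rank_leq_row G; have := rank_leq_row (G *m G); lia.
  by rewrite -(geq_leqif (mxrank_leqif_sup (submxMl G G))).
have {GT} GT v : v *m G = v *m G *m G *m T0^T.
  have := congr1 trmx GT; rewrite !trmx_mul Gs => {1}->.
  by rewrite !mulmxA.
pose f : R := \sum_i \sum_j T0^T i j ^+ 2.
have f0 : 0 <= f by apply: sumr_ge0 => i _; apply: sumr_ge0 => j _; exact: sqr_ge0.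
exists (Num.sqrt f + 1)^-1; first by rewrite invr_gt0 ltr_wpDl ?sqrtr_ge0.
move=> v; rewrite mulrC ler_pdivrMr ?ltr_wpDl ?sqrtr_ge0 // mulrC.
rewrite {1}GT; apply: le_trans (frobenius_bound _ (sqrtr_ge0 f) _) _.
  by rewrite sqr_sqrtr.
by rewrite ler_wpM2r ?euclid_norm_ge0 // lerDl.
Qed.

Lemma roots_seq (F : fieldType) (q : {poly F}) : q != 0 ->
  exists s : seq F, forall x, root q x -> x \in s.
Proof.
move: {2}(size q) (leqnn (size q)) => m; elim: m q => [|m IH] q.
  by rewrite leqn0 size_poly_eq0 => /eqP ->; rewrite eqxx.
move=> sq q0; have [[x qx]|nr] := pselect (exists x, root q x); last first.
  by exists [::] => x qx; case: nr; exists x.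
have /factor_theorem [q' qE] := qx.
have q'0 : q' != 0 by apply: contraNneq q0 => h; rewrite qE h mul0r.
have [|//|s hs] := IH q'.
  by move: sq; rewrite qE size_Mmonic ?monicXsubC // size_XsubC addn2.
exists (x :: s) => y; rewrite qE rootM root_XsubC inE orbC => /orP [->//|/hs ->].
by rewrite orbT.
Qed.

Lemma min_gap (s : seq R) : exists2 c : R, 0 < c &
  {in s &, forall a b, a != b -> c <= `|a - b|}.
Proof.
pose l := [seq `|a - b| | a <- s, b <- [seq b <- s | a != b]].
have [c c0 hc] : exists2 c : R, 0 < c & forall x, x \in l -> 0 < x -> c <= x.
  elim: l => [|y l [c c0 hc]]; first by exists 1.
  have [y0|y0] := lerP y 0.
    by exists c => // x; rewrite inE => /orP [/eqP ->|/hc //]; rewrite ltNge y0.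
  exists (Num.min c y) => [|x]; first by rewrite lt_min c0.
  rewrite inE ge_min => /orP [/eqP ->|/hc h /h ->//]; by rewrite lexx orbT.
exists c => // a b sa sb ab; apply: hc; last by rewrite normr_gt0 subr_eq0.
by apply/allpairsPdep; exists a, b; rewrite mem_filter ab sb.
Qed.

End Perturbation.

(** * The block matrix P *)

Section BlockMatrix.
Context {R : realType} {K : nat}.
Implicit Types (B : 'M[R]_K) (M : 'I_K -> R).

Definition normalized_kernel B M : 'M[R]_K := \matrix_(i, j) (B i j / (M i * M j)).

Definition block_indicator n (sigma : 'I_n -> 'I_K) : 'M[R]_(n, K) :=
  \matrix_(u, i) (sigma u == i)%:R.

Lemma normalized_kernel_sym B M : B^T = B ->
  (normalized_kernel B M)^T = normalized_kernel B M.
Proof.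
by move=> Bs; apply/matrixP => i j; rewrite !mxE -{1}Bs mxE [M j * _]mulrC.
Qed.

Lemma mul_block_indicator_tr n (sigma : 'I_n -> 'I_K) m (s : 'M[R]_(m, K)) i u :
  (s *m (block_indicator sigma)^T) i u = s i (sigma u).
Proof.
rewrite mxE (bigD1 (sigma u)) //= big1 => [|j /negPf ju].
  by rewrite !mxE eqxx mulr1 addr0.
by rewrite !mxE eq_sym ju mulr0.
Qed.

Lemma Pmx_block B M n (sigma : 'I_n -> 'I_K) D :
  Pmx B M sigma D = (n%:R * avg_weight D)^-1 *:
    (block_indicator sigma *m normalized_kernel B M *m (block_indicator sigma)^T).
Proof.
apply/matrixP => u v; rewrite mxE [RHS]mxE; congr (_ * _).
rewrite mul_block_indicator_tr mxE (bigD1 (sigma u)) //= big1 => [|j /negPf ju].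
  by rewrite !mxE eqxx mul1r addr0.
by rewrite !mxE eq_sym ju mul0r.
Qed.

Lemma Pmx_sym B M n (sigma : 'I_n -> 'I_K) D : B^T = B ->
  (Pmx B M sigma D)^T = Pmx B M sigma D.
Proof.
by move=> Bs; apply/matrixP => u v; rewrite !mxE -{1}Bs mxE [M (sigma v) * _]mulrC.
Qed.

Variables (B : 'M[R]_K) (alpha : 'I_K -> R).
Hypothesis Bs : B^T = B.
Hypothesis alpha0 : forall k, 0 < alpha k.

Section Size.
Variables (n : nat) (sigma : 'I_n.+1 -> 'I_K) (D : 'I_n.+1 -> R).
Hypothesis blk : forall k, #|[pred u | sigma u == k]|%:R = alpha k * n.+1%:R.
Hypothesis D0 : 0 < avg_weight D.

Let Z := block_indicator sigma.
Let A : 'M[R]_K := diag_mx (\row_i alpha i).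
Let T : 'M[R]_K := diag_mx (\row_i Num.sqrt (alpha i)).
Let Ti : 'M[R]_K := diag_mx (\row_i (Num.sqrt (alpha i))^-1).
Let kappa := (n.+1%:R * avg_weight D)^-1.

Lemma block_indicator_gram : Z^T *m Z = n.+1%:R *: A.
Proof.
apply/matrixP => i j; rewrite !mxE.
have -> : \sum_u Z^T i u * Z u j = \sum_(u | sigma u == i) (i == j)%:R.
  rewrite [RHS]big_mkcond; apply: eq_bigr => u _; rewrite !mxE.
  by case: eqVneq => [->|_]; rewrite ?mul1r ?mul0r.
rewrite sumr_const -[#|_|]/(#|[pred u | sigma u == i]|) -[_ *+ #|_|]mulr_natl blk.
by case: eqVneq => [->|_]; rewrite ?mulr1 ?mulr1n ?mulr0 ?mulr0n ?mulr0 // mulrC.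
Qed.

Lemma weight_diag : T *m T = A.
Proof.
apply/matrixP => i j; rewrite mul_mx_diag !mxE.
case: eqVneq => [<-|_]; last by rewrite !mulr0n mul0r.
by rewrite !mulr1n -expr2 sqr_sqrtr // ltW.
Qed.

Lemma weight_diagV : Ti *m T = 1%:M.
Proof.
apply/matrixP => i j; rewrite mul_mx_diag !mxE.
case: eqVneq => [<-|_]; last by rewrite !mulr0n mul0r.
by rewrite !mulr1n mulVf // gt_eqF // sqrtr_gt0.
Qed.

Lemma block_norm (s : 'rV[R]_K) :
  euclid_norm (s *m Z^T) = Num.sqrt n.+1%:R * euclid_norm (s *m T).
Proof.
apply/eqP; rewrite -(@eqrXn2 _ 2) ?mulr_ge0 ?euclid_norm_ge0 ?sqrtr_ge0 //.
rewrite exprMn !euclid_norm_sqr sqr_sqrtr // dot_mulmx trmxK -mulmxA.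
rewrite block_indicator_gram -scalemxAr dotZr -weight_diag mulmxA.
by rewrite [dot (s *m T) _]dot_mulmx tr_diag_mx.
Qed.

(** With [r = v Z Ti], both norms are expressed through the symmetric matrix [T F T], because
    [Z^T Z] is a multiple of [T T]. A constant for this fixed [K x K] matrix therefore serves all
    sizes. *)
Lemma Pmx_range_bound M c :
  (forall r, c * euclid_norm (r *m (T *m normalized_kernel B M *m T)) <=
     euclid_norm (r *m (T *m normalized_kernel B M *m T) *m
                       (T *m normalized_kernel B M *m T))) ->
  forall v, c / avg_weight D * euclid_norm (v *m Pmx B M sigma D) <=
    euclid_norm (v *m Pmx B M sigma D *m Pmx B M sigma D).
Proof.
move=> hc v; set F := normalized_kernel B M in hc *.
have k0 : 0 <= kappa by rewrite invr_ge0 mulr_ge0 // ltW.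
pose r := v *m Z *m Ti.
have vP : v *m Pmx B M sigma D = kappa *: (v *m Z *m F *m Z^T).
  by rewrite Pmx_block -scalemxAr !mulmxA.
have n1 : euclid_norm (v *m Pmx B M sigma D) =
    kappa * (Num.sqrt n.+1%:R * euclid_norm (r *m (T *m F *m T))).
  rewrite vP euclid_normZ ger0_norm // block_norm /r !mulmxA.
  by rewrite -(mulmxA _ Ti) weight_diagV mulmx1.
have n2 : euclid_norm (v *m Pmx B M sigma D *m Pmx B M sigma D) =
    kappa * (kappa * n.+1%:R * (Num.sqrt n.+1%:R *
      euclid_norm (r *m (T *m F *m T) *m (T *m F *m T)))).
  rewrite vP -scalemxAl euclid_normZ ger0_norm // Pmx_block -scalemxAr.
  rewrite euclid_normZ ger0_norm // !mulmxA.
  rewrite -(mulmxA _ Z^T) block_indicator_gram -scalemxAr -scalemxAl -[in LHS]scalemxAl.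
  rewrite euclid_normZ ger0_norm // block_norm -weight_diag /r !mulmxA.
  by rewrite -(mulmxA _ Ti) weight_diagV mulmx1 !mulrA.
have kD : kappa * n.+1%:R = (avg_weight D)^-1.
  by rewrite /kappa invfM mulrC mulrA mulfV ?mul1r ?pnatr_eq0.
rewrite n1 n2 kD.
rewrite [leRHS](_ : _ = kappa * Num.sqrt n.+1%:R / avg_weight D *
  euclid_norm (r *m (T *m F *m T) *m (T *m F *m T))); last by ring.
rewrite [leLHS](_ : _ = kappa * Num.sqrt n.+1%:R / avg_weight D *
  (c * euclid_norm (r *m (T *m F *m T)))); last by ring.
by rewrite ler_wpM2l // mulr_ge0 ?invr_ge0 ?(ltW D0) // mulr_ge0 ?sqrtr_ge0.
Qed.

Lemma Pmx_norm_le M g v : 0 <= g ->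
  (forall i j, `|normalized_kernel B M i j| <= g) ->
  euclid_norm (v *m Pmx B M sigma D) <= g / avg_weight D * euclid_norm v.
Proof.
move=> g0 hg; apply: frobenius_bound; first by rewrite divr_ge0 // ltW.
apply: le_trans (_ : \sum_(i < n.+1) \sum_(j < n.+1) (kappa * g) ^+ 2 <= _).
  apply: ler_sum => u _; apply: ler_sum => v' _; rewrite mxE -/kappa exprMn [leRHS]exprMn.
  rewrite ler_wpM2l ?sqr_ge0 // -real_normK ?num_real // lerXn2r ?nnegrE //.
  by have := hg (sigma u) (sigma v'); rewrite mxE.
rewrite !sumr_const card_ord -[_ *+ _ *+ _]mulr_natr -[_ *+ _]mulr_natr.
rewrite le_eqVlt; apply/orP; left; apply/eqP; rewrite /kappa.
by field; rewrite gt_eqF // nat1r pnatr_eq0.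
Qed.

(** If [x P = a x], then [x Z] is an eigenvector of the small matrix; it is nonzero since
    [a x = x P] factors through [x Z]. *)
Lemma Pmx_eigenvalue M a : eigenvalue (Pmx B M sigma D) a -> a != 0 ->
  eigenvalue (normalized_kernel B M *m A) (a * avg_weight D).
Proof.
move=> /eigenvalueP [x xP x0] a0; apply/eigenvalueP.
have xZ : x *m Pmx B M sigma D = kappa *: (x *m Z *m normalized_kernel B M *m Z^T).
  by rewrite Pmx_block -scalemxAr !mulmxA.
exists (x *m Z); last first.
  apply: contraNneq x0 => h; move: xP; rewrite xZ h !mul0mx scaler0 => /esym/eqP.
  by rewrite scaler_eq0 (negPf a0).
have : x *m Pmx B M sigma D *m Z = a *: (x *m Z) by rewrite xP -scalemxAl.
rewrite xZ -scalemxAl -(mulmxA _ Z^T) block_indicator_gram -scalemxAr scalerA.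
move=> /(congr1 (fun y => avg_weight D *: y)); rewrite !scalerA.
rewrite (_ : avg_weight D * (kappa * n.+1%:R) = 1); last first.
  by rewrite /kappa; field; rewrite nat1r pnatr_eq0 gt_eqF.
by rewrite scale1r mulmxA mulrC.
Qed.

Lemma Pmx_eigenvalue0 M : (K < n.+1)%N -> eigenvalue (Pmx B M sigma D) 0.
Proof.
move=> Kn; have [|v vZ v0] := @rowV0Pn _ _ _ (kermx Z) _; last first.
  apply/eigenvalueP; exists v => //; rewrite scale0r Pmx_block -scalemxAr !mulmxA.
  by move/sub_kermxP: vZ => ->; rewrite !mul0mx scaler0.
rewrite -mxrank_eq0 mxrank_ker -lt0n subn_gt0.
exact: leq_ltn_trans (rank_leq_col Z) Kn.
Qed.

End Size.

Lemma Pmx_constants M : (exists i j, B i j / (M i * M j) != 0) ->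
  exists cl cu ci g : R, [/\ 0 < cl, 0 < ci, 0 <= g, 0 <= cu &
  forall n (sigma : 'I_n.+1 -> 'I_K) (D : 'I_n.+1 -> R), (K < n.+1)%N ->
   (forall k, #|[pred u | sigma u == k]|%:R = alpha k * n.+1%:R) ->
   0 < avg_weight D ->
   [/\ cl / avg_weight D <= eigengap (Pmx B M sigma D) <= cu / avg_weight D,
       forall v, euclid_norm (v *m Pmx B M sigma D) <= g / avg_weight D * euclid_norm v &
       forall v, ci / avg_weight D * euclid_norm (v *m Pmx B M sigma D) <=
         euclid_norm (v *m Pmx B M sigma D *m Pmx B M sigma D)]].
Proof.
move=> [i0 [j0 B0]].
pose T : 'M[R]_K := diag_mx (\row_i Num.sqrt (alpha i)).
pose F := normalized_kernel B M.
have Gs : (T *m F *m T)^T = T *m F *m T.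
  by rewrite !trmx_mul tr_diag_mx normalized_kernel_sym // mulmxA.
have [ci ci0 hci] := sym_range_bound Gs.
pose A : 'M[R]_K := diag_mx (\row_i alpha i).
have [s hs] := roots_seq (monic_neq0 (char_poly_monic (F *m A))).
(* [Pmx_eigenvalue] covers nonzero eigenvalues, so 0 is added by hand. Rescaled by the average
   weight, all eigenvalues lie in this fixed list, whose least distance bounds the gap from
   below. *)
have [cl cl0 hcl] := min_gap (0 :: s).
pose g : R := \sum_i \sum_j `|F i j|.
have g0 : 0 <= g by apply: sumr_ge0 => i _; apply: sumr_ge0.
have hg i j : `|F i j| <= g.
  rewrite /g (bigD1 i) //= (bigD1 j) //= -addrA lerDl addr_ge0 ?sumr_ge0 // => k _.
  exact: sumr_ge0.
exists cl, g, ci, g; split=> // n sigma D Kn blk D0.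
have hN v := @Pmx_norm_le n sigma D D0 M g v g0 hg.
split=> //; last exact: Pmx_range_bound.
have inl a : eigenvalue (Pmx B M sigma D) a -> a * avg_weight D \in 0 :: s.
  move=> ea; have [->|a0] := eqVneq a 0; first by rewrite mul0r mem_head.
  by rewrite inE hs ?orbT // -eigenvalue_root_char; exact: Pmx_eigenvalue.
have [a [x [x1 xP hx]]] := sym_eigen_max (Pmx_sym M sigma D Bs).
(* All blocks are nonempty, so some entry of [P] is a nonzero multiple of the given nonzero kernel
   entry. With 0 also an eigenvalue, the gap is then at most [|a|], hence at most the norm. *)
have a0 : a != 0.
  apply/eqP => a0.
  have blkn k : exists u, sigma u = k.
    have : #|[pred u | sigma u == k]| != 0%N.
      by rewrite -(pnatr_eq0 R) blk mulf_neq0 ?gt_eqF.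
    by rewrite -lt0n => /card_gt0P [u]; rewrite inE => /eqP; exists u.
  have [u ui] := blkn i0; have [v vj] := blkn j0.
  have := hx (delta_mx 0 u); rewrite a0 normr0 mul0r => h.
  have /euclid_norm_eq0 : euclid_norm (delta_mx 0 u *m Pmx B M sigma D) = 0.
    by apply/eqP; rewrite eq_le h euclid_norm_ge0.
  rewrite -rowE => /rowP /(_ v); rewrite !mxE ui vj => /eqP.
  rewrite mulf_eq0 (negPf B0) orbF invr_eq0 mulf_eq0 pnatr_eq0 /= => /eqP h0.
  by rewrite h0 ltxx in D0.
have ea : eigenvalue (Pmx B M sigma D) a.
  apply/eigenvalueP; exists x => //; apply: contra_eq_neq x1 => ->.
  by rewrite -(scale0r 0) dotZl mul0r eq_sym oner_eq0.
have e0 := Pmx_eigenvalue0 sigma D M Kn.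
have gapa : [set g : R | exists a b : R, [/\ a != b, eigenvalue (Pmx B M sigma D) a,
    eigenvalue (Pmx B M sigma D) b & g = `|a - b|]] `|a|.
  by exists a, 0; split=> //; rewrite subr0.
apply/andP; split.
  apply: lb_le_inf; first by exists `|a|.
  move=> _ [b [b' [bb' eb eb' ->]]]; rewrite ler_pdivrMr //.
  rewrite -[X in _ * X]ger0_norm ?(ltW D0) // -normrM mulrBl; apply: hcl.
  - exact: inl.
  - exact: inl.
  - by apply: contra_neq bb' => /mulIf; apply; rewrite gt_eqF.
apply: le_trans (_ : `|a| <= _).
  apply: ge_inf => //; exists 0 => _ [b [b' [_ _ _ ->]]]; exact: normr_ge0.
exact: eigenvalue_le hN ea.
Qed.

End BlockMatrix.

(** * Spectral embedding *)

Section Embedding.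
Context {R : realType}.

Lemma bessel n L (X : 'M[R]_(n, L)) (e : 'rV[R]_n) : X^T *m X = 1%:M ->
  \sum_j dot (col j X)^T e ^+ 2 <= dot e e.
Proof.
move=> XX; pose c := e *m X; have := dot_ge0 (e - c *m X^T).
have -> : \sum_j dot (col j X)^T e ^+ 2 = dot c c.
  apply: eq_bigr => j _; rewrite -expr2; congr (_ ^+ 2).
  by rewrite dotC /c mxE; apply: eq_bigr => i _; rewrite !mxE.
have h1 : dot e (c *m X^T) = dot c c by rewrite dotC dot_mulmx trmxK.
have h2 : dot (c *m X^T) (c *m X^T) = dot c c.
  by rewrite dot_mulmx trmxK -mulmxA XX mulmx1.
rewrite dotDl !dotDr !dotNl !dotNr h2 (dotC _ e) h1; lra.
Qed.

(** The block vector near [x j] is [x j P / a], at distance [|x j (H - P)| / |a|]. The total error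
    is a sum over the columns, so [L] must be bounded independently of [n]. *)
Lemma embedding_blocks n K L (sigma : 'I_n.+1 -> 'I_K) (H P : 'M[R]_n.+1)
    (X : 'M[R]_(n.+1, L)) (a0 : R) :
  H^T = H -> P^T = P ->
  (forall x : 'rV_n.+1, exists g : 'I_K -> R, forall u, (x *m P) 0 u = g (sigma u)) ->
  X^T *m X = 1%:M -> 0 < a0 -> spectral_radius (H - P) <= a0 / 2 ->
  (forall j, exists2 a : R, a0 <= `|a| & H *m col j X = a *: col j X) ->
  exists t : 'I_K -> 'rV[R]_L,
    \sum_u euclid_norm (Num.sqrt n.+1%:R *: row u X - t (sigma u)) ^+ 2 <=
    n.+1%:R * (9 * K%:R) * (spectral_radius (H - P) / a0) ^+ 2.
Proof.
move=> Hs Ps hP XX a0p hrho hX; set rho := spectral_radius _ in hrho *.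
have Ws : (H - P)^T = H - P by rewrite linearB /= Hs Ps.
have rho0 : 0 <= rho := spectral_radius_ge0 Ws.
pose x j : 'rV[R]_n.+1 := (col j X)^T.
have x1 j : dot (x j) (x j) = 1.
  have := congr1 (fun Y : 'M[R]_L => Y j j) XX; rewrite !mxE eqxx ; rewrite -[true%:R]/(1 : R) => <-.
  by apply: eq_bigr => i _; rewrite !mxE.
have /choice [y hy] : forall j, exists y : 'rV[R]_n.+1 * ('I_K -> R),
    euclid_norm (x j - y.1) <= rho / a0 /\ forall u, y.1 0 u = y.2 (sigma u).
  move=> j; have [a ha Ha] := hX j; have [g hg] := hP (x j).
  have xH : x j *m H = a *: x j.
    by rewrite -[x j *m H]trmxK trmx_mul trmxK Hs Ha linearZ.
  have an0 : a != 0 by rewrite -normr_gt0; exact: lt_le_trans ha.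
  exists (a^-1 *: (x j *m P), fun k => a^-1 * g k); split=> [|u] /=; last by rewrite mxE hg.
  have -> : x j - a^-1 *: (x j *m P) = a^-1 *: (x j *m (H - P)).
    by rewrite mulmxBr xH scalerBr scalerA mulVf // scale1r.
  rewrite euclid_normZ normfV mulrC.
  apply: le_trans (_ : rho / `|a| <= _).
    rewrite ler_wpM2r ?invr_ge0 //.
    by have := spectral_radius_bound (x j) Ws; rewrite (euclid_norm1 (x1 j)) mulr1.
  by rewrite ler_wpM2l // lef_pV2 ?posrE // normr_gt0.
exists (fun k => \row_j (Num.sqrt n.+1%:R * (y j).2 k)).
pose nb k : R := (#|[pred u | sigma u == k]|)%:R.
(* Normalised block indicators; an empty block gives the zero vector, so the norm is at most 1
   rather than equal to 1. *)
pose e k : 'rV[R]_n.+1 :=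
  \row_u ((sigma u == k)%:R / Num.sqrt (nb k)).
have e1 k : dot (e k) (e k) <= 1.
  rewrite /dot (eq_bigr (fun u => (sigma u == k)%:R / nb k)).
    rewrite -mulr_suml -natr_sum -big_mkcond /= sum1_card.
    by rewrite -/(nb k); have [->|h] := eqVneq (nb k) 0; rewrite ?mul0r // mulfV.
  move=> u _; rewrite !mxE mulrACA -invfM -(expr2 (Num.sqrt _)) sqr_sqrtr ?ler0n //.
  by rewrite -natrM mulnb andbb.
have yE j : (y j).1 = \sum_k ((y j).2 k * Num.sqrt (nb k)) *: e k.
  apply/rowP => u; rewrite summxE (bigD1 (sigma u)) //= big1 => [|k /negPf ku].
    rewrite !mxE eqxx addr0 mul1r mulfK ?(hy j).2 //.
    rewrite sqrtr_eq0 -ltNge ltr0n; apply/card_gt0P; exists u.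
    by rewrite inE.
  by rewrite !mxE eq_sym ku mul0r mulr0.
have yy j : dot (y j).1 (y j).1 =
    \sum_k ((y j).2 k * Num.sqrt (nb k)) ^+ 2.
  rewrite /dot (partition_big sigma xpredT) //=; apply: eq_bigr => k _.
  rewrite (eq_bigr (fun=> (y j).2 k ^+ 2)) => [|u /eqP uk]; last first.
    by rewrite (hy j).2 uk.
  by rewrite sumr_const exprMn sqr_sqrtr // mulr_natr.
(* The vector [(y j).1] lies in the span of the [e k], has norm at most [3/2] and inner product at
   least [1/2] with [x j]; Cauchy-Schwarz gives [(1/2) ^ 2 / (3/2) ^ 2 = 1/9]. *)
have near j : 1 / 9 <= \sum_k dot (x j) (e k) ^+ 2.
  have h1 := (hy j).1; set eta := rho / a0 in h1.
  have eta2 : eta <= 2^-1 by rewrite ler_pdivrMr // mulrC.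
  have n1 : euclid_norm (x j) = 1 by exact: euclid_norm1.
  have ny : euclid_norm (y j).1 <= 3 / 2.
    have := euclid_normB (x j) (x j - (y j).1); rewrite subKr n1; lra.
  have xy : 1 / 2 <= dot (x j) (y j).1.
    have -> : (y j).1 = x j - (x j - (y j).1) by rewrite subKr.
    rewrite dotDr dotNr x1; have := normr_dot (x j) (x j - (y j).1).
    by rewrite n1 mul1r; have := ler_norm (dot (x j) (x j - (y j).1)); lra.
  set S := \sum_k _.
  pose c : 'rV[R]_K := \row_k ((y j).2 k * Num.sqrt (nb k)).
  pose d : 'rV[R]_K := \row_k dot (x j) (e k).
  have cd : dot c d = dot (x j) (y j).1.
    rewrite yE /dot; under [RHS]eq_bigr do rewrite summxE mulr_sumr.
    rewrite exchange_big /=; apply: eq_bigr => k _; rewrite !mxE mulr_sumr.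
    by apply: eq_bigr => u _; rewrite [X in _ = _ * X]mxE mulrCA.
  have cc : dot c c = dot (y j).1 (y j).1.
    by rewrite yy; apply: eq_bigr => k _; rewrite mxE expr2.
  have dd : dot d d = S by apply: eq_bigr => k _; rewrite mxE expr2.
  have := cauchy_schwarz c d; rewrite cd cc dd -euclid_norm_sqr.
  have S0 : 0 <= S by rewrite -dd dot_ge0.
  move: xy ny (euclid_norm_ge0 (y j).1); set q := dot _ _; set z := euclid_norm _.
  clear -S0 => h1 h2 h3 h4.
  have z2 : z ^+ 2 <= 9 / 4 by nra.
  have := ler_wpM2r S0 z2; have : 1 / 4 <= q ^+ 2 by nra.
  lra.
have LK : L%:R <= 9 * K%:R :> R.
  have : \sum_(j < L) (1 / 9 : R) <= \sum_(k < K) 1.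
    apply: le_trans (_ : \sum_j \sum_k dot (x j) (e k) ^+ 2 <= _).
      by apply: ler_sum => j _; exact: near.
    rewrite exchange_big /=; apply: ler_sum => k _.
    exact: le_trans (bessel _ XX) (e1 k).
  rewrite !sumr_const !card_ord -[_ *+ L]mulr_natl; lra.
have -> : \sum_u euclid_norm (Num.sqrt n.+1%:R *: row u X -
      \row_j (Num.sqrt n.+1%:R * (y j).2 (sigma u))) ^+ 2 =
    n.+1%:R * \sum_j euclid_norm (x j - (y j).1) ^+ 2.
  under eq_bigr do rewrite euclid_norm_sqr /dot.
  rewrite exchange_big mulr_sumr /=; apply: eq_bigr => j _.
  rewrite euclid_norm_sqr /dot mulr_sumr; apply: eq_bigr => u _.
  rewrite !mxE (hy j).2 -mulrBr mulrACA -expr2 sqr_sqrtr //.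
rewrite -mulrA ler_wpM2l //.
apply: le_trans (_ : \sum_(j < L) (rho / a0) ^+ 2 <= _).
  apply: ler_sum => j _; rewrite lerXn2r ?nnegrE ?euclid_norm_ge0 //.
    by rewrite divr_ge0 // ltW.
  exact: (hy j).1.
by rewrite sumr_const card_ord -[_ *+ L]mulr_natl ler_wpM2r // sqr_ge0.
Qed.

(** Markov's inequality for squares with [err ^ 3 = delta ^ 2]: the count times [(c0 err) ^ 2] is at
    most [N b err ^ 3], and [b <= c0 ^ 3]. For [delta = 0] every [s u] vanishes. *)
Lemma count_large (T : finType) (s : T -> R) (b c0 N delta : R) :
  (forall u, 0 <= s u) -> 0 <= delta -> 0 <= N -> 0 <= b -> 1 <= c0 -> b <= c0 ->
  \sum_u s u ^+ 2 <= N * b * delta ^+ 2 ->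
  #|[pred u | ~~ (s u <= c0 * delta `^ (2%:R / 3%:R))]|%:R <=
    c0 * (N * delta `^ (2%:R / 3%:R)).
Proof.
move=> s0 d0 N0 b0 c1 bc hs; set err := delta `^ _.
have err0 : 0 <= err by exact: powR_ge0.
have err3 : err ^+ 3 = delta ^+ 2.
  rewrite -powR_mulrn // -powR_mulrn // /err -powRrM; congr (_ `^ _).
  by rewrite divfK // pnatr_eq0.
have cp : 0 < c0 by apply: lt_le_trans c1.
have [dz|dz] := eqVneq delta 0.
  have e0 : err = 0.
    have /eqP : err ^+ 3 = 0 by rewrite err3 dz expr0n.
    by rewrite expf_eq0 => /andP [_ /eqP].
  move: hs; rewrite dz expr0n /= mulr0 => hs.
  have sz u : s u = 0.
    apply/eqP; rewrite -sqrf_eq0 eq_le sqr_ge0 andbT.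
    apply: le_trans hs; rewrite (bigD1 u) //= lerDl.
    by apply: sumr_ge0 => v _; exact: sqr_ge0.
  rewrite e0 !mulr0 eq_card0 // => u; rewrite inE sz lexx //.
have dp : 0 < delta by rewrite lt_def dz.
have ep : 0 < err by apply: powR_gt0.
set A := [pred u | _].
have h : #|A|%:R * (c0 * err) ^+ 2 <= N * b * delta ^+ 2.
  apply: le_trans hs.
  rewrite -sum1_card natr_sum mulr_suml big_mkcond /=; apply: ler_sum => u _.
  case: ifP => [|_]; last exact: sqr_ge0.
  rewrite inE -ltNge mul1r => /ltW hu.
  by rewrite lerXn2r ?nnegrE ?mulr_ge0 // ltW.
have h2 : 0 < (c0 * err) ^+ 2 by rewrite exprn_gt0 // mulr_gt0.
rewrite -(ler_pM2r h2); apply: le_trans h _.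
rewrite -err3 [leRHS](_ : _ = N * (c0 ^+ 3) * err ^+ 3); last by ring.
rewrite ler_wpM2r ?exprn_ge0 // ler_wpM2l //.
apply: le_trans bc _; rewrite !exprS expr0 mulr1.
have : 1 <= c0 * c0 by nra.
nra.
Qed.

End Embedding.

(** * Degrees *)

Section Degrees.
Context {R : realType} {n : nat}.
Variable p : 'M[R]_n.
Hypothesis p01 : forall u v, 0 <= p u v <= 1.
Hypothesis ps : p^T = p.

(** Independence of the edges at [u]; [oth] recovers the other endpoint from the sorted pair. *)
Lemma graph_ex_star (u : 'I_n) (f : 'I_n -> bool -> R) :
  graph_ex p (fun A => \prod_(v | v != u) f v (A u v)) =
  \prod_(v | v != u) (p u v * f v true + (1 - p u v) * f v false).
Proof.
pose s := [seq edge u v | v <- index_enum 'I_n & v != u].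
pose oth (e : 'I_n * 'I_n) := if e.1 == u then e.2 else e.1.
have othE v : v != u -> oth (edge u v) = v.
  move=> vu; have [->|->] := edgeP u v; rewrite /oth /= ?eqxx //.
  by rewrite (negPf vu).
have slt : all (fun e : 'I_n * 'I_n => (e.1 < e.2)%N) s.
  apply/allP => e /mapP [v]; rewrite mem_filter => /andP [vu _] ->.
  rewrite /edge; case: (ltngtP u v) => //= h.
  by move: vu; rewrite (ord_inj h) eqxx.
have us : uniq s.
  rewrite map_inj_in_uniq; first by apply: filter_uniq; exact: index_enum_uniq.
  move=> v w.
  rewrite !mem_filter => /andP [vu _] /andP [wu _] h.
  by rewrite -(othE v vu) h othE.
have bigs (F : 'I_n * 'I_n -> R) : \prod_(e <- s) F e = \prod_(v | v != u) F (edge u v).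
  by rewrite big_map big_filter.
have := graph_ex_seq p (fun e => f (oth e)) slt.
rewrite (@eq_graph_ex _ _ _ _ (fun A => \prod_(v | v != u) f v (A u v))); last first.
  move=> A /simple_graphP [_ As]; rewrite bigs; apply: eq_bigr => v vu; rewrite othE //.
  by have [->|->] := edgeP u v => //=; rewrite As.
move=> ->; rewrite -[LHS](_ : \prod_(e <- s) (p e.1 e.2 * f (oth e) true +
    (1 - p e.1 e.2) * f (oth e) false) = _).
  rewrite bigs; apply: eq_bigr => v vu; rewrite othE //.
  by have [->|->] := edgeP u v => //=; rewrite -{1 2}ps !mxE.
rewrite big_uniq //= big_mkcond [RHS]big_mkcond; apply: eq_bigr => e _.
rewrite (count_uniq_mem e us); have [es|_] := boolP (e \in s).
  by rewrite (allP slt) // !expr1.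
by rewrite !expr0 !mulr1 addrC subrK if_same.
Qed.

Lemma degreeE (A : 'M[bool]_n) u : simple_graph A ->
  (degree A u)%:R = \sum_(v | v != u) (A u v)%:R :> R.
Proof.
case/simple_graphP => Ad _; rewrite /degree natr_sum (bigD1 u) //= Ad add0r //.
Qed.

(** Chernoff's bound with parameter 1: by [exp (-1) <= 1/2] each edge contributes at most
    [1 - p / 2 <= exp (- p / 2)], so [exp (- degree)] has mean at most [exp (- mu / 2)]. *)
Lemma degree_lower_tail u (mu : R) : mu = \sum_(v | v != u) p u v ->
  graph_pr p (fun A => (degree A u)%:R <= mu / 4) <= expR (- (mu / 4)).
Proof.
move=> muE.
apply: le_trans (_ : graph_pr p (fun A =>
    expR (- (mu / 4)) <= expR (- (degree A u)%:R)) <= _).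
  by apply: graph_pr_le => // A _ h; rewrite ler_expR lerN2.
apply: le_trans (graph_markov p01 (expR_gt0 _) _) _ => [A _|]; first exact: expR_ge0.
rewrite ler_pdivrMr ?expR_gt0 // -expRD.
rewrite (@eq_graph_ex _ _ _ _ (fun A => \prod_(v | v != u) if A u v then expR (-1) else 1)); last first.
  move=> A sA; rewrite degreeE // -sumrN expR_sum; apply: eq_bigr => v _.
  by case: (A u v); rewrite ?oppr0 ?expR0.
rewrite (graph_ex_star u (fun _ b => if b then expR (-1) else 1)).
rewrite (_ : - (mu / 4) + - (mu / 4) = \sum_(v | v != u) - (p u v / 2)); last first.
  by rewrite sumrN -mulr_suml -muE; lra.
rewrite expR_sum; apply: ler_prod => v _; have /andP [q0 q1] := p01 u v.
have e1 : expR (-1) <= 1 / 2 :> R.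
  rewrite expRN div1r lef_pV2 ?posrE ?expR_gt0 //.
  by have := expR_ge1Dx (1 : R); lra.
have e0 := expR_gt0 (-1 : R); have := expR_ge1Dx (- (p u v / 2)).
by move=> h; apply/andP; split; nra.
Qed.

(** The centring contains the loop term [p u u], absent from the degree. Splitting it off costs the
    factor 2, and [p u u ^ 2 <= p u u] puts it back into the sum. *)
Lemma degree_variance u : graph_ex p (fun A => ((degree A u)%:R - \sum_v p u v) ^+ 2)
  <= 2 * \sum_v p u v.
Proof.
have /andP [q0 q1] := p01 u u.
pose S (A : 'M[bool]_n) : R := \sum_(v | v != u) ((A u v)%:R - p u v).
have SE : graph_ex p (fun A => S A ^+ 2) <= \sum_(v | v != u) p u v.
  rewrite (@eq_graph_ex _ _ _ _ (fun A => \sum_(v | v != u) \sum_(w | w != u)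
     ((A u v)%:R - p u v) * ((A u w)%:R - p u w))); last first.
    by move=> A _; rewrite expr2 /S big_distrlr.
  rewrite graph_ex_sum; apply: ler_sum => v vu; rewrite graph_ex_sum.
  rewrite (bigD1 v) //= [X in _ + X]big1 => [|w /andP [wu wv]].
    rewrite addr0 (@eq_graph_ex _ _ _ _ (fun A => \prod_(x | x != u)
      if x == v then ((A u x)%:R - p u x) ^+ 2 else 1)); last first.
      move=> A _; rewrite (bigD1 v) //= eqxx big1 ?mulr1 ?expr2 // => x /andP [_ /negPf ->] //.
    rewrite (graph_ex_star u (fun x b => if x == v then (b%:R - p u x) ^+ 2 else 1)).
    rewrite (bigD1 v) //= eqxx big1 => [|x /andP [_ /negPf ->]]; last first.
      by rewrite !mulr1 addrC subrK.
    have /andP [h0 h1] := p01 u v; rewrite mulr1 mulr1n mulr0n sub0r.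
    nra.
  rewrite (@eq_graph_ex _ _ _ _ (fun A => \prod_(x | x != u)
      if x == v then (A u x)%:R - p u x else if x == w then (A u x)%:R - p u x else 1)); last first.
    move=> A _; rewrite (bigD1 v) //= eqxx (bigD1 w) /=; last by rewrite wu wv.
    rewrite (negPf wv) eqxx big1 ?mulr1 // => x /andP [/andP [_ /negPf ->] /negPf ->] //.
  rewrite (graph_ex_star u (fun x b => if x == v then b%:R - p u x else if x == w then b%:R - p u x else 1)).
  rewrite (bigD1 v) //= eqxx [X in X * _](_ : _ = 0) ?mul0r //.
  by rewrite mulr1n mulr0n; ring.
have E : \sum_v p u v = p u u + \sum_(v | v != u) p u v by rewrite (bigD1 u).
have h : graph_ex p (fun A => ((degree A u)%:R - \sum_v p u v) ^+ 2) <=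
    graph_ex p (fun A => 2 * S A ^+ 2 + 2 * (p u u ^+ 2) * 1).
  apply: graph_ex_le => // A sA; rewrite degreeE // E /S big_split /= sumrN.
  set a := \sum_(v | _) _%:R; set b := \sum_(v | _) p u v.
  have := sqr_ge0 (a - b + p u u); nra.
apply: le_trans h _.
rewrite graph_exD !graph_exZ graph_ex1 mulr1 E; nra.
Qed.

Lemma avg_degree_mean : (0 < n)%N ->
  graph_ex p (@avg_degree R n) <= (\sum_u \sum_v p u v) / n%:R.
Proof.
move=> n0; rewrite (@eq_graph_ex _ _ _ _ (fun A => n%:R^-1 * \sum_u (degree A u)%:R)); last first.
  by move=> A _; rewrite mulrC.
rewrite graph_exZ graph_ex_sum mulrC ler_wpM2r ?invr_ge0 //; apply: ler_sum => u _.
rewrite (@eq_graph_ex _ _ _ _ (fun A => \sum_(v | v != u) (A u v)%:R)); last first.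
  by move=> A sA; exact: degreeE.
rewrite graph_ex_sum [leRHS](bigD1 u) //=.
apply: le_trans (_ : \sum_(v | v != u) p u v <= _); last first.
  by rewrite lerDr; case/andP: (p01 u u).
apply: ler_sum => v vu.
rewrite (@eq_graph_ex _ _ _ _ (fun A => \prod_(x | x != u)
   if x == v then (A u x)%:R else 1)); last first.
  by move=> A _; rewrite (bigD1 v) //= eqxx big1 ?mulr1 // => x /andP [_ /negPf ->].
rewrite (graph_ex_star u (fun x b => if x == v then b%:R else 1)).
rewrite (bigD1 v) //= eqxx big1 => [|x /andP [_ /negPf ->]].
  by rewrite !mulr1 mulr0 addr0.
by rewrite !mulr1 addrC subrK.
Qed.

End Degrees.

(** * Decomposition of W *)

Section Decomposition.
Context {R : realType} {K n : nat}.
Variables (B : 'M[R]_K) (sigma : 'I_n.+1 -> 'I_K) (D : 'I_n.+1 -> R) (m : 'I_K -> R).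
Local Notation N := (n.+1%:R : R).
Local Notation p := (edge_prob B sigma D).
Local Notation Dbar := (avg_weight D).
Hypothesis Bs : B^T = B.
Hypothesis B0 : forall i j, 0 <= B i j.
Hypothesis D0 : forall u, 0 < D u.
Hypothesis m0 : forall i, 0 < m i.
Variable b : R.
Hypothesis hb : forall i j, B i j / (m i * m j) <= b.

(** For the finite averages [m] this is the full row sum of [p], loop included. *)
Definition mean_degree (u : 'I_n.+1) : R := D u * m (sigma u).
Local Notation c := mean_degree.

Definition centred_entry (e : 'I_n.+1 * 'I_n.+1) (x : bool) : R :=
  (x%:R - p e.1 e.2) / (c e.1 * c e.2).

Definition degree_error (A : 'M[bool]_n.+1) : R :=
  (\sum_u ((degree A u)%:R - c u) ^+ 2 / c u ^+ 2) / N.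

Lemma avg_weight_gt0 : 0 < Dbar.
Proof.
rewrite /avg_weight divr_gt0 // (bigD1 ord0) //= ltr_pwDl //.
by apply: sumr_ge0 => u _; rewrite ltW.
Qed.

Lemma mean_degree_gt0 u : 0 < c u.
Proof. by rewrite mulr_gt0. Qed.

Lemma edge_prob_sym : p^T = p.
Proof. by apply/matrixP => u v; rewrite !mxE -{1}Bs mxE [D v * _]mulrC. Qed.

Lemma edge_prob_ge0 u v : 0 <= p u v.
Proof.
have D0' w : 0 <= D w := ltW (D0 w).
have a0 := ltW avg_weight_gt0.
by rewrite mxE mulr_ge0 // divr_ge0 // mulr_ge0.
Qed.

Lemma PmxE u v : Pmx B m sigma D u v = p u v / (c u * c v).
Proof.
rewrite !mxE /mean_degree; have a0 := avg_weight_gt0.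
have [du dv mu mv] : [/\ D u != 0, D v != 0, m (sigma u) != 0 & m (sigma v) != 0].
  by split; rewrite gt_eqF.
by field; rewrite du dv mu mv gt_eqF //= nat1r pnatr_eq0.
Qed.

Lemma Pmx_entry u v : 0 <= Pmx B m sigma D u v <= b / (N * Dbar).
Proof.
have a0 := avg_weight_gt0.
rewrite mxE mulrC; apply/andP; split.
  have m0' i : 0 <= m i := ltW (m0 i).
  by apply: mulr_ge0; [rewrite divr_ge0 ?mulr_ge0 | rewrite invr_ge0 mulr_ge0 // ltW].
by rewrite ler_wpM2r // invr_ge0 mulr_ge0 // ltW.
Qed.

(** Off the diagonal [Hhat] is [e u e v A u v / (c u c v)] and the block matrix is
    [p u v / (c u c v)], so the remainder is [(e u e v - 1)] times the block matrix; on the diagonal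
    it is minus that matrix. Its entries are at most [b / (N Dbar)], which makes the remainder small
    in Frobenius norm. *)
Lemma Wmx_decomposition (A : 'M[bool]_n.+1) : simple_graph A ->
  (forall u, c u / 8 <= (degree A u)%:R) ->
  exists Rm : 'M[R]_n.+1,
   let E := diag_mx (\row_u (c u / (degree A u)%:R)) in
   Wmx B m sigma D A = E *m graph_mx centred_entry A *m E + Rm /\
   \sum_u \sum_v Rm u v ^+ 2 <= (b / Dbar) ^+ 2 * (100 * 100 * degree_error A + N^-1).
Proof.
move=> sA hdeg; have [Ad As] := simple_graphP _ sA.
have a0 := avg_weight_gt0.
pose e u : R := c u / (degree A u)%:R.
have c0 := mean_degree_gt0.
have dg u : 0 < (degree A u)%:R :> R by apply: lt_le_trans (hdeg u); rewrite divr_gt0.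
pose x u : R := ((degree A u)%:R - c u) ^+ 2 / c u ^+ 2.
have e0 u : 0 <= e u <= 8.
  rewrite divr_ge0 ?(ltW (c0 _)) ?(ltW (dg _)) //= ler_pdivrMr //.
  by have := hdeg u; lra.
have ex u : (e u - 1) ^+ 2 <= 64 * x u.
  have -> : (e u - 1) ^+ 2 = e u ^+ 2 * x u.
    by rewrite /e /x; field; rewrite !gt_eqF.
  rewrite ler_wpM2r ?divr_ge0 ?sqr_ge0 //.
  by have := e0 u; nra.
pose Rm : 'M[R]_n.+1 := \matrix_(u, v)
  if u == v then - Pmx B m sigma D u v else (e u * e v - 1) * Pmx B m sigma D u v.
exists Rm => /=; split.
  apply/matrixP => u v; rewrite [RHS]mxE mul_mx_diag [X in _ = X + _]mxE mul_diag_mx !mxE.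
  have [->|uv] := eqVneq u v; first by rewrite Ad mulr0 mul0r !add0r.
  have -> : (n.+1%:R * avg_weight D)^-1 * (B (sigma u) (sigma v) / (m (sigma u) * m (sigma v)))
    = p u v / (c u * c v) by rewrite -PmxE mxE.
  have -> : centred_entry (edge u v) (A u v) = ((A u v)%:R - p u v) / (c u * c v).
    rewrite /centred_entry; have [->|->] //= := edgeP u v.
    by rewrite -{1}edge_prob_sym [in p^T _ _]mxE [c v * _]mulrC.
  rewrite /e; case: (A u v) => /=; rewrite ?mulr1n ?mulr0n; field;
    by rewrite !gt_eqF.
have pi0 : 0 <= (b / (N * Dbar)) ^+ 2 by exact: sqr_ge0.
have Psq u v : Pmx B m sigma D u v ^+ 2 <= (b / (N * Dbar)) ^+ 2.
  by have /andP [h1 h2] := Pmx_entry u v; rewrite lerXn2r ?nnegrE // (le_trans h1).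
have x0 u : 0 <= x u by rewrite divr_ge0 ?sqr_ge0.
(* With [e <= 8] and [(a1 + a2) ^ 2 <= 2 a1 ^ 2 + 2 a2 ^ 2] the coefficients are [2 * 64 * 64] and
   [2 * 64]; their sum is below [100 * 100], a square that is convenient for taking roots. *)
apply: le_trans (_ : \sum_u \sum_v (b / (N * Dbar)) ^+ 2 *
    (128 * 64 * x u + 128 * x v + (u == v)%:R) <= _).
  apply: ler_sum => u _; apply: ler_sum => v _; rewrite mxE.
  have [->|uv] := eqVneq u v.
    rewrite sqrrN; apply: le_trans (Psq v v) _; rewrite ler_peMr //.
    by have := x0 v; rewrite mulr1n; lra.
  rewrite exprMn addr0 mulrC; apply: le_trans (ler_wpM2r (sqr_ge0 _) (Psq u v)) _.
  rewrite ler_wpM2l //.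
  have -> : e u * e v - 1 = (e u - 1) * e v + (e v - 1) by ring.
  have h1 : ((e u - 1) * e v) ^+ 2 <= 64 * (64 * x u).
    rewrite exprMn mulrC; have /andP [g1 g2] := e0 v.
    apply: ler_pM; rewrite ?sqr_ge0 ?ex //; nra.
  have h2 := ex v.
  have := sqr_ge0 ((e u - 1) * e v - (e v - 1)).
  move: h1 h2; move: ((e u - 1) * e v) (e v - 1) (x u) (x v) => a1 a2 a3 a4 h1 h2 h3.
  have : (a1 + a2) ^+ 2 <= 2 * a1 ^+ 2 + 2 * a2 ^+ 2 by move: h3; rewrite !expr2; lra.
  lra.
have -> : \sum_u \sum_v (b / (N * Dbar)) ^+ 2 * (128 * 64 * x u + 128 * x v + (u == v)%:R) =
   (b / (N * Dbar)) ^+ 2 * (N * (128 * 64 * \sum_u x u) + N * (128 * \sum_u x u) + N).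
  have cst (a : R) : \sum_(u < n.+1) a = N * a.
    by rewrite sumr_const card_ord mulr_natl.
  rewrite (eq_bigr (fun u => (b / (N * Dbar)) ^+ 2 *
      (N * (128 * 64 * x u) + 128 * (\sum_v x v) + 1))) => [|u _]; last first.
    rewrite -mulr_sumr !big_split /= cst -mulr_sumr; congr (_ * (_ + _)).
    by rewrite (bigD1 u) //= eqxx big1 ?addr0 // => v /negPf; rewrite eq_sym => ->.
  by rewrite -mulr_sumr !big_split /= !cst mulr1 -mulr_sumr -mulr_sumr.
rewrite /degree_error -/x; set S := \sum_u x u.
have S0 : 0 <= S by apply: sumr_ge0.
have -> : (b / Dbar) ^+ 2 * (100 * 100 * (S / N) + N^-1) =
   (b / (N * Dbar)) ^+ 2 * (100 * 100 * (N * S) + N).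
  by field; rewrite gt_eqF //= nat1r pnatr_eq0.
rewrite ler_wpM2l //; have : 0 <= N * S by rewrite mulr_ge0.
lra.
Qed.

Lemma Wmx_norm (A : 'M[bool]_n.+1) (y q r : R) : simple_graph A -> 0 <= b ->
  0 <= y -> 0 <= q -> 0 <= r ->
  (forall u, c u / 8 <= (degree A u)%:R) ->
  degree_error A <= q ^+ 2 -> N^-1 <= r ^+ 2 ->
  (forall v, euclid_norm (v *m graph_mx centred_entry A) <= y * euclid_norm v) ->
  forall v, euclid_norm (v *m Wmx B m sigma D A) <=
    (64 * y + b / Dbar * (100 * q + r)) * euclid_norm v.
Proof.
move=> sA b0 y0 q0 r0 hdeg hq hr hy v.
have [Rm [-> hRm]] := Wmx_decomposition sA hdeg.
have a0 := avg_weight_gt0.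
set E := diag_mx _.
have hE w : euclid_norm (w *m E) <= 8 * euclid_norm w.
  apply: diag_mx_norm_le => // u; rewrite mxE.
  have dg : 0 < (degree A u)%:R :> R.
    by apply: lt_le_trans (hdeg u); rewrite divr_gt0 // mean_degree_gt0.
  rewrite ger0_norm ?divr_ge0 ?(ltW dg) ?(ltW (mean_degree_gt0 _)) // ler_pdivrMr //.
  by have := hdeg u; lra.
have hR : euclid_norm (v *m Rm) <= b / Dbar * (100 * q + r) * euclid_norm v.
  apply: frobenius_bound.
    by apply: mulr_ge0; [apply: divr_ge0 => //; exact: ltW | apply: addr_ge0 => //; apply: mulr_ge0].
  apply: le_trans hRm _; rewrite [leRHS]exprMn ler_wpM2l ?sqr_ge0 //.
  have qr : 0 <= q * r by rewrite mulr_ge0.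
  have -> : (100 * q + r) ^+ 2 = 100 * 100 * q ^+ 2 + 200 * (q * r) + r ^+ 2 by ring.
  by apply: lerD hr; lra.
rewrite mulmxDr !mulmxA mulrDl; apply: le_trans (euclid_normD _ _) _.
apply: lerD hR; apply: le_trans (hE _) _.
have := hy (v *m E); have := ler_wpM2l y0 (hE v); lra.
Qed.

End Decomposition.

(** Four exceptional events: a degree far below its mean, a large centred matrix, a large degree
    error, a large average degree. The first two have probability at most [1 / n.+1] each, the
    others at most [h ^- 2] and [b / h]. *)
Lemma spectral_concentration (R : realType) (b M0 c1 : R) :
  0 < b -> 0 < M0 -> 0 < c1 -> exists2 C2 : R, 0 < C2 &
  forall (K n : nat) (B : 'M[R]_K) (sigma : 'I_n.+1 -> 'I_K) (D : 'I_n.+1 -> R)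
    (m : 'I_K -> R) (h : R),
  let p := edge_prob B sigma D in
  let l := ln n.+1%:R in
  let Dbar := avg_weight D in
  B^T = B -> (forall i j, 0 <= B i j) -> (forall u, 0 < D u) ->
  (forall u, D ord0 <= D u) -> (forall u v, p u v <= 1) ->
  (forall i, M0 <= m i <= b) -> (forall i j, B i j / (m i * m j) <= b) ->
  (forall u, \sum_v p u v = D u * m (sigma u)) ->
  c1 * l * Dbar <= D ord0 ^+ 2 -> 16 * l <= D ord0 * M0 -> 1 <= l -> 0 < h ->
  1 - (2 / n.+1%:R + h ^- 2 + b / h) <= graph_pr p (fun A =>
    [/\ forall u, (0 < degree A u)%N, avg_degree A <= h * Dbar &
     forall v, euclid_norm (v *m Wmx B m sigma D A) <=
       C2 * (1 + h) / (Num.sqrt l * Dbar) * euclid_norm v]).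
Proof.
move=> b0 M00 c10.
have aux1 (a q t : R) : 16 * t <= a -> a / 2 <= q -> 2 * t <= q / 4 by lra.
have aux2 (a q t r : R) : 16 * t <= a -> 1 <= t -> r <= 1 -> a = r + q -> a / 2 <= q.
  by lra.
have aux3 (a t : R) : 16 * t <= a -> 1 <= t -> 2 * t <= a by lra.
have aux4 (a q r : R) : a / 2 <= q -> q / 4 < r -> a / 8 <= r by lra.
have aux5 (t : R) : t - 2 * t <= - t by lra.
have [C C0 hC] := graph_ex_spectral_radius R.
(* After scaling by [tau], the first term keeps the variances below [1 / n.+1] and the second the
   squared entries below [1 / k], where [k <= 2 l]; both rest on [c1 * l * Dbar <= D ord0 ^+ 2]. *)
pose k2 : R := Num.min (c1 * M0 ^+ 2 / b) (c1 ^+ 2 * M0 ^+ 4 / 2).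
have k20 : 0 < k2.
  by rewrite lt_min !divr_gt0 // !mulr_gt0 // ?exprn_gt0.
pose kap := Num.sqrt k2; have kap2 : kap ^+ 2 = k2 by rewrite sqr_sqrtr // ltW.
have kap0 : 0 < kap by rewrite sqrtr_gt0.
pose T := expR 1 * Num.sqrt C.
have T0 : 0 < T by rewrite mulr_gt0 ?expR_gt0 // sqrtr_gt0.
exists (64 * (T / kap) + 100 * b); first by rewrite addr_gt0 // mulr_gt0 // divr_gt0.
move=> K n B sigma D m h p l Dbar Bs B0 D0 D1 p1 mM mb rs cl l16 l1 h0.
have m0 i : 0 < m i by have /andP [/(lt_le_trans M00)] := mM i.
have m00 i : M0 <= m i by case/andP: (mM i).
have Dbar0 : 0 < Dbar by exact: avg_weight_gt0.
have N0 : 0 < n.+1%:R :> R by [].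
have p01 u v : 0 <= p u v <= 1 by rewrite edge_prob_ge0 // p1.
have ps : p^T = p by exact: edge_prob_sym.
have l0 : 0 < l by apply: lt_le_trans l1.
have l00 := ltW l0; have Dbar00 := ltW Dbar0.
have lD0 : 0 <= l * Dbar by exact: mulr_ge0.
have Nl : n.+1%:R = expR l by rewrite lnK ?posrE.
have lN : l + 1 <= n.+1%:R by rewrite Nl addrC expR_ge1Dx.
pose c := mean_degree sigma D m.
have c0 u : 0 < c u by exact: mean_degree_gt0.
have c16 u : 16 * l <= c u.
  apply: le_trans l16 _; rewrite /c /mean_degree.
  by rewrite ler_pM // ltW.
pose k := (Num.truncn l).+1.
have /andP [kl lk] := truncn_itv (ltW l0).
have kl1 : k%:R <= l + 1 by rewrite -natr1 lerD2r.
have kR0 : 0 < k%:R :> R by [].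
have kn : (k <= n.+1)%N by rewrite -(ler_nat R); exact: le_trans lN.
pose tau := kap * Num.sqrt l * Dbar.
have sl0 : 0 < Num.sqrt l by rewrite sqrtr_gt0.
have sl2 : Num.sqrt l ^+ 2 = l by rewrite sqr_sqrtr // ltW.
have tau0 : 0 < tau by apply: mulr_gt0 => //; exact: mulr_gt0.
have tau2 : tau ^+ 2 = k2 * l * Dbar ^+ 2 by rewrite /tau !exprMn kap2 sl2.
pose hh e x := tau * centred_entry B sigma D m e x.
have hhE A : graph_mx hh A = tau *: graph_mx (centred_entry B sigma D m) A.
  by apply/matrixP => u v; rewrite !mxE; case: eqP => _; rewrite ?mulr0.
pose d1 := D ord0; have d10 : 0 < d1 := D0 _.
have cc u v : d1 ^+ 2 * M0 ^+ 2 <= c u * c v.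
  rewrite (_ : _ * _ = (d1 * M0) * (d1 * M0)); last by ring.
  by rewrite ler_pM ?mulr_ge0 ?(ltW d10) ?(ltW M00) // /c /mean_degree ler_pM ?(ltW d10) ?(ltW M00).
have cc0 : 0 < d1 ^+ 2 * M0 ^+ 2 by rewrite mulr_gt0 // exprn_gt0.
have E2 : graph_ex p (fun A => spectral_radius (graph_mx hh A) ^+ k.*2) <= n.+1%:R * C ^+ k.
  apply: hC => // [e elt|e elt|e x elt].
  - by rewrite /hh /centred_entry -/p mulr1n mulr0n; ring.
  - have /andP [q0 q1] := p01 e.1 e.2.
    have -> : p e.1 e.2 * hh e true ^+ 2 + (1 - p e.1 e.2) * hh e false ^+ 2 =
        tau ^+ 2 * (1 - p e.1 e.2) * (p e.1 e.2 / (c e.1 * c e.2)) / (c e.1 * c e.2).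
      rewrite /hh /centred_entry -/p -/c mulr1n mulr0n; field.
      by rewrite !gt_eqF.
    have P1 : p e.1 e.2 / (c e.1 * c e.2) <= b / (n.+1%:R * Dbar).
      have := @Pmx_entry _ _ _ B sigma D m B0 D0 m0 b mb e.1 e.2.
      by rewrite PmxE // => /andP [].
    have P0 : 0 <= p e.1 e.2 / (c e.1 * c e.2) by rewrite divr_ge0 // mulr_ge0 // ltW.
    apply: le_trans (_ : tau ^+ 2 * (b / (n.+1%:R * Dbar)) / (d1 ^+ 2 * M0 ^+ 2) <= _).
      apply: ler_pM => //; last by rewrite lef_pV2 ?posrE // mulr_gt0.
      + by apply: mulr_ge0 => //; rewrite mulr_ge0 ?sqr_ge0 // subr_ge0.
      + by rewrite invr_ge0 mulr_ge0 // ltW.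
      apply: ler_pM => //; first by rewrite mulr_ge0 ?sqr_ge0 // subr_ge0.
      by rewrite ler_piMr ?sqr_ge0 // lerBlDr lerDl.
    rewrite tau2 ler_pdivrMr // [leLHS](_ : _ = (k2 * b) * (l * Dbar) / n.+1%:R); last first.
      by field; rewrite ?nat1r ?pnatr_eq0 ?(gt_eqF Dbar0).
    rewrite [leRHS]mulrC ler_wpM2r ?invr_ge0 //.
    apply: le_trans (_ : (c1 * M0 ^+ 2) * (l * Dbar) <= _).
      rewrite ler_wpM2r // -ler_pdivlMr //.
      by rewrite ge_min lexx.
    rewrite [leLHS](_ : _ = M0 ^+ 2 * (c1 * l * Dbar)); last by ring.
    by rewrite mulrC ler_wpM2r ?sqr_ge0.
  have /andP [q0 q1] := p01 e.1 e.2.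
  have x1 : (x%:R - p e.1 e.2) ^+ 2 <= 1 by case: x => /=; rewrite ?mulr1n ?mulr0n; nra.
  rewrite /hh /centred_entry -/p -/c exprMn expr_div_n.
  apply: le_trans (_ : tau ^+ 2 * (1 / (d1 ^+ 2 * M0 ^+ 2) ^+ 2) <= _).
    rewrite ler_wpM2l ?sqr_ge0 //; apply: ler_pM; rewrite ?sqr_ge0 ?invr_ge0 ?sqr_ge0 //.
    rewrite lef_pV2 ?posrE ?exprn_gt0 // ?mulr_gt0 //.
    apply: lerXn2r (cc _ _); rewrite nnegrE ltW //; exact: mulr_gt0.
  rewrite mul1r ler_pdivrMr ?exprn_gt0 // tau2 [leRHS]mulrC ler_pdivlMr //.
  have k2l : k2 <= c1 ^+ 2 * M0 ^+ 4 / 2 by rewrite ge_min lexx orbT.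
  apply: le_trans (_ : (c1 ^+ 2 * M0 ^+ 4 / 2) * l * Dbar ^+ 2 * (2 * l) <= _).
    apply: ler_pM; rewrite ?(ltW kR0) //.
    - by apply: mulr_ge0 (sqr_ge0 _); apply: mulr_ge0 => //; exact: ltW.
    - by rewrite ler_wpM2r ?sqr_ge0 // ler_wpM2r.
    - lra.
  rewrite [leLHS](_ : _ = M0 ^+ 4 * (c1 * l * Dbar) ^+ 2); last by field.
  rewrite [leRHS](_ : _ = M0 ^+ 4 * (d1 ^+ 2) ^+ 2); last by ring.
  rewrite ler_wpM2l ?exprn_ge0 ?(ltW M00) //.
  apply: lerXn2r cl; rewrite nnegrE ?sqr_ge0 //.
  by apply: mulr_ge0 => //; apply: mulr_ge0 => //; exact: ltW.
pose mu u := \sum_(v | v != u) p u v.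
(* Removing the loop costs at most 1, which is below half of [c u >= 16 l]. Hence [mu u / 4 >= 2 l],
   as the union bound over the vertices requires. *)
have muc u : c u / 2 <= mu u.
  by apply: aux2 (c16 u) l1 (p1 u u) _; rewrite -[c u]rs (bigD1 u).
pose q := h / Num.sqrt l.
have q0 : 0 < q by rewrite divr_gt0.
have q2 : q ^+ 2 = h ^+ 2 / l by rewrite expr_div_n sl2.
pose F1 (A : 'M[bool]_n.+1) := exists u, (degree A u)%:R <= mu u / 4.
pose F2 (A : 'M[bool]_n.+1) := T ^+ k.*2 <= spectral_radius (graph_mx hh A) ^+ k.*2.
pose F3 (A : 'M[bool]_n.+1) := q ^+ 2 <= degree_error sigma D m A.
pose F4 (A : 'M[bool]_n.+1) := h * Dbar <= avg_degree A.
have pr1 : graph_pr p F1 <= 1 / n.+1%:R.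
  apply: le_trans (graph_prU_big p01 _) _.
  apply: le_trans (_ : \sum_(u < n.+1) expR (- (2 * l)) <= _).
    apply: ler_sum => u _; apply: le_trans (degree_lower_tail p01 ps (erefl (mu u))) _.
    by rewrite ler_expR lerN2; exact: aux1 (c16 u) (muc u).
  rewrite sumr_const card_ord -[leLHS]mulr_natl Nl -expRD div1r -expRN ler_expR.
  exact: aux5.
have pr2 : graph_pr p F2 <= 1 / n.+1%:R.
  apply: le_trans (graph_markov p01 _ _) _; first by rewrite exprn_gt0.
    move=> A sA; rewrite exprn_ge0 // spectral_radius_ge0 // graph_mx_sym //.
  rewrite ler_pdivrMr ?exprn_gt0 //; apply: le_trans E2 _.
  have -> : T ^+ k.*2 = expR (2 * k%:R) * C ^+ k.
    have T2 : T ^+ 2 = expR 2 * C.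
      by rewrite /T exprMn (sqr_sqrtr (ltW C0)) -expRM_natl mulr1.
    by rewrite -mul2n exprM T2 exprMn -expRM_natr.
  rewrite mulrA ler_wpM2r ?exprn_ge0 ?(ltW C0) //.
  rewrite Nl div1r -expRN -expRD ler_expR; move: lk; rewrite -/k; lra.
(* The mean square deviation of a degree is at most [2 c u], so [degree_error] has mean at most
   [1 / l], to be compared with [q ^ 2 = h ^ 2 / l]. *)
have pr3 : graph_pr p F3 <= h ^- 2.
  apply: le_trans (graph_markov p01 _ _) _; first by rewrite exprn_gt0.
    by move=> A _; rewrite divr_ge0 // sumr_ge0 // => u _; rewrite divr_ge0 ?sqr_ge0.
  rewrite ler_pdivrMr ?exprn_gt0 //.
  rewrite (@eq_graph_ex _ _ _ _ (fun A => n.+1%:R^-1 *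
      \sum_u (c u ^- 2 * ((degree A u)%:R - \sum_v p u v) ^+ 2))); last first.
    move=> A _; rewrite /degree_error mulrC; congr (_ * _); apply: eq_bigr => u _.
    by rewrite rs mulrC.
  rewrite graph_exZ graph_ex_sum.
  apply: le_trans (_ : n.+1%:R^-1 * \sum_(u < n.+1) l^-1 <= _).
    rewrite ler_wpM2l ?invr_ge0 //; apply: ler_sum => u _; rewrite graph_exZ.
    apply: le_trans (_ : c u ^- 2 * (2 * c u) <= _).
      rewrite ler_wpM2l ?invr_ge0 ?sqr_ge0 //.
      by have := degree_variance p01 ps u; rewrite rs.
    rewrite [leLHS](_ : _ = 2 / c u); last by field; rewrite gt_eqF.
    by rewrite ler_pdivrMr // mulrC ler_pdivlMr // aux3.
  have -> : \sum_(u < n.+1) l^-1 = n.+1%:R * l^-1 by rewrite sumr_const card_ord mulr_natl.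
  rewrite mulrA mulVf ?pnatr_eq0 // mul1r q2.
  by rewrite mulrA mulVf ?mul1r // gt_eqF // exprn_gt0.
have pr4 : graph_pr p F4 <= b / h.
  apply: le_trans (graph_markov p01 _ _) _; first by rewrite mulr_gt0.
    by move=> A _; rewrite divr_ge0 // sumr_ge0.
  rewrite (ler_pdivrMr _ _ (mulr_gt0 h0 Dbar0)).
  apply: le_trans (avg_degree_mean p01 ps (ltn0Sn n)) _.
  rewrite [leRHS](_ : _ = b * Dbar); last by field; rewrite gt_eqF.
  have SD : \sum_u D u = Dbar * n.+1%:R by rewrite divfK ?pnatr_eq0.
  rewrite -(ler_pM2r N0) divfK ?pnatr_eq0 // -[leRHS]mulrA -SD mulr_sumr.
  apply: ler_sum => u _; rewrite rs mulrC ler_wpM2r ?(ltW (D0 u)) //.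
  by case/andP: (mM (sigma u)).
rewrite (graph_prC p) lerD2l lerN2.
apply: le_trans (_ : graph_pr p (fun A => F1 A \/ (F2 A \/ (F3 A \/ F4 A))) <= _); last first.
  apply: le_trans (graph_prU p01 _ _) _.
  apply: le_trans (_ : 1 / n.+1%:R + (1 / n.+1%:R + (h ^- 2 + b / h)) <= _); last first.
    by rewrite le_eqVlt; apply/orP; left; apply/eqP; ring.
  apply: lerD pr1 _; apply: le_trans (graph_prU p01 _ _) _.
  apply: lerD pr2 _; apply: le_trans (graph_prU p01 _ _) _.
  exact: lerD pr3 pr4.
apply: graph_pr_le => // A sA; apply: contra_notP => /not_orP [nF1 /not_orP [nF2 /not_orP [nF3 nF4]]].
have dg u : c u / 8 <= (degree A u)%:R.
  have : mu u / 4 < (degree A u)%:R by rewrite ltNge; apply/negP => ?; apply: nF1; exists u.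
  exact: aux4 (muc u).
split.
- move=> u; rewrite -(ltr_nat R); apply: lt_le_trans (dg u); rewrite divr_gt0 //.
- by rewrite leNgt; apply/negP => /ltW.
have Ys : (graph_mx hh A)^T = graph_mx hh A by exact: graph_mx_sym.
have rho : spectral_radius (graph_mx hh A) <= T.
  rewrite leNgt; apply/negP => Tr; apply: nF2; rewrite /F2 lerXn2r ?nnegrE ?(ltW T0) ?(ltW Tr) //.
  exact: spectral_radius_ge0.
have hy v : euclid_norm (v *m graph_mx (centred_entry B sigma D m) A) <=
    (T / tau) * euclid_norm v.
  rewrite mulrAC ler_pdivlMr // mulrC -[X in X * _]ger0_norm ?(ltW tau0) //.
  rewrite -euclid_normZ scalemxAr -hhE; apply: le_trans (spectral_radius_bound _ Ys) _.
  by rewrite ler_wpM2r // euclid_norm_ge0.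
move=> v; have := @Wmx_norm _ _ _ B sigma D m Bs B0 D0 m0 b mb A (T / tau) q (Num.sqrt l)^-1
  sA (ltW b0) _ (ltW q0) _ dg _ _ hy v.
move=> W; apply: le_trans (W _ _ _ _) _.
- by rewrite divr_ge0 ?(ltW T0) ?(ltW tau0).
- by rewrite invr_ge0 ltW.
- by rewrite leNgt; apply/negP => /ltW.
- by rewrite exprVn sl2 lef_pV2 ?posrE //; lra.
rewrite ler_wpM2r ?euclid_norm_ge0 //.
rewrite [leLHS](_ : _ = (64 * (T / kap) + b * (100 * h + 1)) * (Num.sqrt l * Dbar)^-1); last first.
  by rewrite /tau /q -/Dbar; field; rewrite !gt_eqF.
have sD0 : 0 <= (Num.sqrt l * Dbar)^-1 by rewrite invr_ge0; exact: ltW (mulr_gt0 sl0 Dbar0).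
apply: (ler_wpM2r sD0).
have : 0 <= T / kap * h by apply: ltW; apply: mulr_gt0 h0; exact: divr_gt0.
have : 0 <= b * h by apply: ltW; exact: mulr_gt0.
by move: b0; clear; move: (T / kap) => z; lra.
Qed.

(** * Conclusion *)

Section Conclusion.
Context {R : realType} {K n : nat}.
Variables (B : 'M[R]_K) (M m : 'I_K -> R) (sigma : 'I_n.+1 -> 'I_K) (D : 'I_n.+1 -> R).
Variable A : 'M[bool]_n.+1.
Local Notation Dbar := (avg_weight D).
Local Notation P := (Pmx B M sigma D).
Local Notation P' := (Pmx B m sigma D).
Hypothesis Bs : B^T = B.
Hypothesis M0 : forall i, 0 < M i.
Hypothesis m0 : forall i, 0 < m i.
Hypothesis Dbar0 : 0 < Dbar.
Hypothesis sA : simple_graph A.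
Variables (cl cu ci g eta b w h f : R).
Hypothesis cl0 : 0 < cl.
Hypothesis ci0 : 0 < ci.
Hypothesis g0 : 0 <= g.
Hypothesis gap : cl / Dbar <= eigengap P <= cu / Dbar.
Hypothesis Pnorm : forall v, euclid_norm (v *m P) <= g / Dbar * euclid_norm v.
Hypothesis Prange :
  forall v, ci / Dbar * euclid_norm (v *m P) <= euclid_norm (v *m P *m P).
Hypothesis P'norm : forall v, euclid_norm (v *m P') <= b / Dbar * euclid_norm v.
Hypothesis b0 : 0 <= b.
Hypothesis w0 : 0 <= w.
Hypothesis W'norm : forall v,
  euclid_norm (v *m Wmx B m sigma D A) <= w / Dbar * euclid_norm v.
Hypothesis eta0 : 0 <= eta <= 2^-1.
Hypothesis etaE : forall i, `|M i / m i - 1| <= eta.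
Hypothesis etag : 3 * eta * g <= ci / 2.

Lemma Hhat_sym : (Hhat A)^T = Hhat A :> 'M[R]_n.+1.
Proof.
have [_ As] := simple_graphP _ sA.
by apply/matrixP => u v; rewrite !mxE As [X in X^-1]mulrC.
Qed.

Let E : 'M[R]_n.+1 := diag_mx (\row_u (M (sigma u) / m (sigma u))).

Lemma Pmx_diag : P' = E *m P *m E.
Proof.
apply/matrixP => u v; rewrite mul_mx_diag [RHS]mxE mul_diag_mx !mxE.
by field; rewrite !gt_eqF //= nat1r pnatr_eq0.
Qed.

Lemma Pmx_range_perturbed v :
  ci / Dbar / 8 * euclid_norm (v *m P') <= euclid_norm (v *m P' *m P').
Proof.
rewrite Pmx_diag; apply: (range_bound_diag (eta := eta) (g := g / Dbar)) => //.
- by move=> u; rewrite mxE.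
- by rewrite divr_ge0 // ltW.
- by rewrite divr_ge0 // ltW.
- rewrite mulrA [leRHS](_ : _ = ci / 2 / Dbar); last by rewrite mulrAC.
  by rewrite ler_wpM2r // invr_ge0 ltW.
Qed.

(** [P' - P = (E - 1) P E + P (E - 1)] with [|E - 1| <= eta] and [|E| <= 2], which gives the factor
    [2 + 1]. *)
Lemma Pmx_perturbation v :
  euclid_norm (v *m (P' - P)) <= 3 * eta * g / Dbar * euclid_norm v.
Proof.
have /andP [e0 e1] := eta0.
have -> : P' - P = (E - 1%:M) *m P *m E + P *m (E - 1%:M).
  rewrite Pmx_diag !mulmxBl !mulmxBr mul1mx mulmx1 addrA.
  by rewrite subrK.
have E1 u : euclid_norm (u *m (E - 1%:M)) <= eta * euclid_norm u.
  have -> : E - 1%:M = diag_mx (\row_u (M (sigma u) / m (sigma u) - 1)).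
    apply/matrixP => i j; rewrite !mxE.
    by case: eqVneq => [_|_]; rewrite ?mulr1n ?mulr0n ?subrr.
  by apply: diag_mx_norm_le => // i; rewrite mxE.
have E2 u : euclid_norm (u *m E) <= 2 * euclid_norm u.
  apply: diag_mx_norm_le => // i; rewrite mxE.
  by have := etaE (sigma i); rewrite ler_distl ler_norml => /andP [h1 h2]; lra.
have gD : 0 <= g / Dbar by rewrite divr_ge0 // ltW.
rewrite mulmxDr !mulmxA; apply: le_trans (euclid_normD _ _) _.
apply: le_trans (_ : 2 * (g / Dbar * (eta * euclid_norm v)) +
  eta * (g / Dbar * euclid_norm v) <= _); last first.
  by rewrite le_eqVlt; apply/orP; left; apply/eqP; ring.
apply: lerD.
  apply: le_trans (E2 _) _; rewrite ler_wpM2l //.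
  by apply: le_trans (Pnorm _) _; rewrite ler_wpM2l.
by apply: le_trans (E1 _) _; rewrite ler_wpM2l.
Qed.

Lemma Wmx_radius :
  0 <= spectral_radius (Wmx B M sigma D A) <= (w + 3 * eta * g) / Dbar.
Proof.
have Ws : (Wmx B M sigma D A)^T = Wmx B M sigma D A.
  by rewrite /Wmx linearB /= Hhat_sym Pmx_sym.
rewrite spectral_radius_ge0 //=; apply: spectral_radius_le => // v.
have -> : Wmx B M sigma D A = Wmx B m sigma D A + (P' - P).
  by rewrite /Wmx addrA subrK.
rewrite mulmxDr mulrDl mulrDl; apply: le_trans (euclid_normD _ _) _.
by apply: lerD; [exact: W'norm | exact: Pmx_perturbation].
Qed.

Hypothesis h0 : 0 < h.
Hypothesis deg0 : forall u, (0 < degree A u)%N.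
Hypothesis avgh : avg_degree A <= h * Dbar.
Hypothesis wf : w * (1 + 16 * b / ci) <= f / h.
Hypothesis wci : w + 3 * eta * g <= ci / 32.
Hypothesis wcl : (w + 3 * eta * g) / cl <= 1.

(** [P'], with the noise bound [w], decides which eigenvalues pass the threshold; the error and the
    gap are then measured with [P]. *)
Lemma embedding_conclusion :
  let err := embedding_error B M sigma D A in
  let C0 := 1 + 9 * K%:R * (16 * cu / ci) ^+ 2 in
  err <= Num.sqrt ((w + 3 * eta * g) / cl) /\
  forall (L : nat) (X : 'M[R]_(n.+1, L)), spectral_embedding A f X ->
    exists t : 'I_K -> 'rV[R]_L,
      #|[pred u | ~~ (euclid_norm (Num.sqrt n.+1%:R *: row u X
                                   - t (sigma u)) <= C0 * err)]|%:R
        <= C0 * (n.+1%:R * err).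
Proof.
move=> err C0; have /andP [r0 r1] := Wmx_radius; have /andP [gap1 gap2] := gap.
set rho := spectral_radius _ in r0 r1.
pose x := (w + 3 * eta * g) / cl.
have gap0 : 0 < eigengap P by apply: lt_le_trans gap1; rewrite divr_gt0.
pose delta := rho / eigengap P.
have d0 : 0 <= delta by rewrite divr_ge0 // ltW.
have dx : delta <= x.
  rewrite ler_pdivrMr // (le_trans r1) // /x.
  rewrite [leLHS](_ : _ = (w + 3 * eta * g) / cl * (cl / Dbar)).
    rewrite ler_wpM2l // divr_ge0 ?(ltW cl0) //.
    have /andP [e0 _] := eta0; by rewrite addr_ge0 // !mulr_ge0.
  by field; rewrite !gt_eqF.
split.
  rewrite /err /embedding_error -/rho -/delta.
  have [dz|dz] := eqVneq delta 0.
    by rewrite dz powR0 ?sqrtr_ge0 // mulf_neq0 ?invr_eq0 ?pnatr_eq0.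
  have dp : 0 < delta by rewrite lt_def dz.
  (* Since [delta <= 1], lowering the exponent from [2/3] to [1/2] increases the power; a square
     root suffices for the limit. *)
  apply: le_trans (_ : delta `^ 2^-1 <= _).
    rewrite ger_powR //; first by rewrite dp (le_trans dx).
    lra.
  by rewrite powR12_sqrt // ler_wsqrtr.
move=> L X [_ XX hX].
(* [Pmx_range_perturbed] gives [ci / Dbar / 8] and the dichotomy halves it; the condition
   [rho <= a0 / 2] is where the [ci / 32] of [wci] comes from. *)
pose a0 := ci / Dbar / 16.
have a00 : 0 < a0 by rewrite divr_gt0 // divr_gt0.
have avg0 : 0 < avg_degree A :> R.
  rewrite /avg_degree divr_gt0 // (bigD1 ord0) //= ltr_pwDl ?ltr0n //.
  by rewrite sumr_ge0.
have thr : w / Dbar * (1 + 2 * (b / Dbar) / (ci / Dbar / 8)) <= f / avg_degree A.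
  apply: le_trans (_ : f / (h * Dbar) <= _); last first.
    have f0 : 0 <= f.
      have : 0 <= f / h by apply: le_trans wf; rewrite mulr_ge0 // addr_ge0 // divr_ge0 ?mulr_ge0 // ltW.
      by rewrite pmulr_lge0 // invr_gt0.
    by rewrite ler_wpM2l // lef_pV2 ?posrE // mulr_gt0.
  rewrite [leLHS](_ : _ = w * (1 + 16 * b / ci) / Dbar); last first.
    by field; rewrite !gt_eqF.
  rewrite [leRHS](_ : _ = f / h / Dbar); last by rewrite invfM mulrA.
  by rewrite ler_wpM2r // invr_ge0 ltW.
have Heig j : exists2 a : R, a0 <= `|a| & Hhat A *m col j X = a *: col j X.
  have [a ta Ha] := hX j; exists a => //.
  have x1 : euclid_norm (col j X)^T = 1.
    apply: euclid_norm1; have := congr1 (fun Y : 'M[R]_L => Y j j) XX.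
    rewrite !mxE eqxx -[true%:R]/(1 : R) => <-.
    by apply: eq_bigr => i _; rewrite !mxE.
  have xa : (col j X)^T *m (P' + Wmx B m sigma D A) = a *: (col j X)^T.
    rewrite /Wmx addrC subrK -[LHS]trmxK trmx_mul trmxK Hhat_sym Ha.
    by rewrite linearZ.
  have := eigenvalue_dichotomy W'norm P'norm Pmx_range_perturbed _ _ x1 xa (le_lt_trans thr ta).
  have -> : a0 = ci / Dbar / 8 / 2 by rewrite /a0; field; rewrite gt_eqF.
  by move=> H; apply: ltW; apply: H; [rewrite divr_gt0 // divr_gt0 | rewrite divr_ge0 // ltW].
have Pb (y : 'rV_n.+1) : exists q : 'I_K -> R, forall u, (y *m P) 0 u = q (sigma u).
  exists (fun k => \sum_v y 0 v * ((n.+1%:R * Dbar)^-1 *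
    (B (sigma v) k / (M (sigma v) * M k)))) => u.
  by rewrite mxE; apply: eq_bigr => v _; rewrite mxE.
have ra : rho <= a0 / 2.
  apply: le_trans r1 _; rewrite [leRHS](_ : _ = ci / 32 / Dbar).
    by rewrite ler_wpM2r // invr_ge0 ltW.
  by rewrite /a0; field; rewrite gt_eqF.
have [t ht] := embedding_blocks Hhat_sym (Pmx_sym M sigma D Bs) Pb XX a00 ra Heig.
(* [rho / a0 = 16 rho Dbar / ci], and [Dbar <= cu / eigengap P] turns this into at most
   [(16 cu / ci) delta]. *)
exists t; apply: (count_large (b := 9 * K%:R * (16 * cu / ci) ^+ 2)) => //.
- by move=> u; exact: euclid_norm_ge0.
- by rewrite mulr_ge0 ?sqr_ge0 // mulr_ge0.
- by rewrite lerDl mulr_ge0 ?sqr_ge0 // mulr_ge0.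
- by rewrite lerDr.
apply: le_trans ht _; rewrite -/(Wmx B M sigma D A) -/rho -/delta.
rewrite [leRHS](_ : _ = n.+1%:R * (9 * K%:R) * ((16 * cu / ci) * delta) ^+ 2); last by ring.
rewrite ler_wpM2l ?mulr_ge0 //; apply: lerXn2r; rewrite ?nnegrE.
- by rewrite divr_ge0 // ltW.
- rewrite mulr_ge0 // !mulr_ge0 ?invr_ge0 ?(ltW ci0) //.
  have : 0 < cu / Dbar by apply: lt_le_trans gap2.
  by rewrite pmulr_lgt0 ?invr_gt0 // => /ltW.
rewrite [leLHS](_ : _ = 16 / ci * (rho * Dbar)); last by rewrite /a0; field; rewrite !gt_eqF.
rewrite [leRHS](_ : _ = 16 / ci * (cu * delta)); last by ring.
rewrite ler_wpM2l ?divr_ge0 ?(ltW ci0) //.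
rewrite /delta mulrA ler_pdivlMr // mulrAC -mulrA [cu * _]mulrC ler_wpM2l //.
by rewrite -ler_pdivlMr.
Qed.

End Conclusion.

(** * Asymptotics along the sequence of models *)

Lemma graph_pr_exists (R : realType) n (p : 'M[R]_n) E :
  0 < graph_pr p E -> exists2 A, simple_graph A & E A.
Proof.
move=> h; apply: contrapT => nE; move: h; rewrite /graph_pr big_pred0 ?ltxx // => A.
apply/negbTE/negP => /andP [sA /asboolP EA]; apply: nE; by exists A.
Qed.

Lemma near_ln_ge (R : realType) (T : R) : \forall k \near \oo, T <= ln k%:R.
Proof.
exists (Num.truncn (expR T)).+1 => // k /= hk.
have eT : expR T <= k%:R.
  have /andP [_ h] := truncn_itv (expR_ge0 T).
  by apply: le_trans (ltW h) _; rewrite ler_nat.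
by rewrite -[leLHS]expRK ler_ln // posrE ?expR_gt0 // (lt_le_trans _ eT) ?expR_gt0.
Qed.

Theorem lemma5p7 (R : realType) (K : nat) (B : 'M[R]_K) (M : 'I_K -> R)
    (rate : nat -> R)
    (B_sym : B^T = B) (B_ge0 : forall i j, 0 <= B i j)
    (M_gt0 : forall i, 0 < M i)
    (rate_cvg : rate n @[n --> \oo] --> (0 : R)) :
  exists C : R,
  forall (alpha d : 'I_K -> R) (N : nat -> nat)
    (sigma : forall m, 'I_(N m).+1 -> 'I_K)
    (D : forall m, 'I_(N m).+1 -> R)
    (f : nat -> R),
  let n := fun m => (N m).+1 in
  let logn := fun m => ln (n m)%:R : R in
  let p := fun m => edge_prob B (sigma m) (D m) in
  let D1 := fun m => D m ord0 in
  let Dn := fun m => D m ord_max in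
  let regime1 := D1 m / logn m @[m --> \oo] --> +oo in
  let regime2 := (forall m, C * logn m <= D1 m) /\
    exists2 c : R, c < 2%:R^-1 &
      Dn m ^+ 2 / (n m)%:R `^ c @[m --> \oo] --> (0 : R) in
  (* the model *)
  {homo N : m m' / (m < m')%N} ->
  (forall k, 0 < alpha k) -> \sum_k alpha k = 1 ->
  (forall m k, #|[pred u | sigma m u == k]|%:R = alpha k * (n m)%:R) ->
  (forall m u, 0 < D m u) ->
  (forall m, {homo D m : u v / (u <= v)%N >-> u <= v}) ->
  (* M is the limit of M_i / sum_l D_l, attained at the given rate *)
  (forall i, M i = \sum_k B i k * alpha k * d k) ->
  (forall m i,
    `|Mvol B (sigma m) (D m) i / (\sum_l D m l) - M i| <= rate (n m)) ->
  (* (i) *)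
  (forall m u v, p m u v <= 1) ->
  (* (ii) *)
  (forall i, d i != 0 /\
    block_avg_weight alpha (sigma m) (D m) i / avg_weight (D m)
      @[m --> \oo] --> d i) ->
  (* (iii) *)
  (forall i l, i != l -> exists j, B i j / M i != B l j / M l) ->
  (* (iv) *)
  (exists2 c : R, 0 < c &
    \forall m \near \oo, c * logn m <= D1 m ^+ 2 / avg_weight (D m)) ->
  (* (v), together with the choice of f in each regime *)
  f k @[k --> \oo] --> (0 : R) ->
  (regime1 /\
   forall T : R, whp p (fun m A =>
     let deg1 := (degree A ord0)%:R : R in
     0 < deg1 /\
     T * (deg1^-1 + (Num.sqrt (logn m))^-1 + Num.sqrt (logn m / deg1))
       < f (n m)))
  \/
  (regime2 /\
   forall T : R, whp p (fun m A =>
     let deg1 := (degree A ord0)%:R : R in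
     0 < deg1 /\
     T * (deg1^-1 + (Num.sqrt (logn m))^-1 + (logn m `^ 3%:R^-1)^-1)
       < f (n m))) ->
  exists (C0 : R) (eps : nat -> R),
    [/\ 0 < C0, eps m @[m --> \oo] --> (0 : R) &
    whp p (fun m A =>
      let err := embedding_error B M (sigma m) (D m) A in
      err <= eps m /\
      forall (L : nat) (X : 'M[R]_(n m, L)),
        spectral_embedding A (f (n m)) X ->
        exists t : 'I_K -> 'rV[R]_L,
          #|[pred u | ~~ (euclid_norm (Num.sqrt (n m)%:R *: row u X
                                       - t (sigma m u)) <= C0 * err)]|%:R
            <= C0 * ((n m)%:R * err))].
Proof.
(* At most half of every [M i], so the finite averages exceed it once the rate is below it. It
   depends on [M] alone and may enter the constant [C]. *)
pose M0 : R := (\sum_i 2 / M i + 1)^-1.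
have S0 : 0 <= \sum_i 2 / M i by apply: sumr_ge0 => i _; rewrite divr_ge0 // ltW.
have M00 : 0 < M0 by rewrite invr_gt0 ltr_wpDl.
have M2 i : 2 * M0 <= M i.
  have : 2 / M i <= M0^-1.
    rewrite invrK (bigD1 i) //= -addrA lerDl addr_ge0 // sumr_ge0 // => j _.
    by rewrite divr_ge0 // ltW.
  by rewrite ler_pdivrMr // mulrC ler_pdivlMr.
(* The constant makes every expected degree at least [16 * ln n]. *)
exists (16 / M0) => alpha d N sigma D f n logn p D1 Dn regime1 regime2.
move=> Nmono alpha0 alpha1 blk D0 Dmono ME Mrate p1 dlim distinct [c1 c10 hiv] fcvg hv.
have nm m : (m <= n m)%N.
  elim: m => // m IH; rewrite /n ltnS; apply: leq_trans (Nmono _ _ (ltnSn m)).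
  exact: IH.
have near_n (Q : nat -> Prop) : (\forall k \near \oo, Q k) -> \forall m \near \oo, Q (n m).
  by case=> k0 _ hk; exists k0 => // m /= km; apply: hk; apply: leq_trans km (nm m).
have cvg_n (u : nat -> R) : u k @[k --> \oo] --> (0 : R) -> u (n m) @[m --> \oo] --> (0 : R).
  move=> /cvgrPdist_le hu; apply/cvgrPdist_le => e e0.
  exact: (near_n (fun k => `|0 - u k| <= e)) (hu e e0).
have near_l T : \forall m \near \oo, T <= logn m := near_n _ (near_ln_ge T).
pose i0 := sigma 0%N ord0.
(* Positivity of [M i0] forces a nonzero entry of [B], so that [P] does not vanish. *)
have [k0 Bk0] : exists k, B i0 k != 0.
  apply: contrapT => nB; have := M_gt0 i0; rewrite ME big1 ?ltxx // => k _.
  have [->|Bk] := eqVneq (B i0 k) 0; first by rewrite !mul0r.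
  by case: nB; exists k.
pose b : R := \sum_i (M i + M0) + \sum_i \sum_j B i j / M0 ^+ 2 + 1.
have BM0 i j : 0 <= B i j / M0 ^+ 2 by rewrite divr_ge0 ?sqr_ge0.
have b1 : 0 <= \sum_i (M i + M0) by apply: sumr_ge0 => i _; rewrite addr_ge0 // ltW.
have b2 : 0 <= \sum_i \sum_j B i j / M0 ^+ 2.
  by apply: sumr_ge0 => i _; apply: sumr_ge0.
have b0 : 0 < b by rewrite ltr_wpDl // addr_ge0.
have bM i : M i + M0 <= b.
  apply: le_trans (_ : \sum_i (M i + M0) <= _); last by rewrite /b -addrA lerDl addr_ge0.
  rewrite (bigD1 i) //= lerDl; apply: sumr_ge0 => j _.
  by rewrite addr_ge0 // ltW.
have bB i j : B i j / M0 ^+ 2 <= b.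
  apply: le_trans (_ : \sum_i \sum_j B i j / M0 ^+ 2 <= _); last first.
    by rewrite /b addrAC lerDr addr_ge0.
  rewrite (bigD1 i) //= (bigD1 j) //= -addrA lerDl addr_ge0 ?sumr_ge0 // => k _.
  exact: sumr_ge0.
have [C2 C20 hC2] := spectral_concentration b0 M00 c10.
have [|cl [cu [ci [g [cl0 ci0 g0 _ hP]]]]] := @Pmx_constants R K B alpha B_sym alpha0 M.
  by exists i0, k0; rewrite mulf_neq0 // invr_eq0 mulf_neq0 ?gt_eqF.
have g10 : 0 < g + 1 by rewrite ltr_wpDl.
pose Gam := 1 + 16 * b / ci.
have Gam0 : 1 <= Gam by rewrite lerDl divr_ge0 ?mulr_ge0 // ltW.
(* [s] diverges because [f] dominates [1 / sqrt (log n)]. Its fourth root [h] is used because a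
   constant times [(1 + h) * h] must stay below [s]. *)
pose s m := f (n m) * Num.sqrt (logn m).
pose h m := Num.sqrt (Num.sqrt (s m)).
pose y m := 2 * C2 * f (n m) + 3 * (rate (n m) / M0) * g.
have near_s T : \forall m \near \oo, T < s m.
  have aux (dg x : forall m, 'M[bool]_(n m) -> R) :
      (forall m A, 0 <= x m A) ->
      (forall T : R, whp p (fun m A => 0 < dg m A /\
         T * ((dg m A)^-1 + (Num.sqrt (logn m))^-1 + x m A) < f (n m))) ->
      \forall m \near \oo, T < s m.
    move=> x0 /(_ `|T|) /cvgr_gt /(_ 0 ltr01) hp; near=> m.
    (* The condition on [f] holds with positive probability, hence for some graph; dropping the
       nonnegative terms that involve its degrees leaves a deterministic inequality. *)
    have /graph_pr_exists [A _ [dg0 hA]] :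
      0 < graph_pr (p m) (fun A => 0 < dg m A /\
         `|T| * ((dg m A)^-1 + (Num.sqrt (logn m))^-1 + x m A) < f (n m)) by near: m.
    have l1 : 1 <= logn m by near: m.
    have sl : 0 < Num.sqrt (logn m) by rewrite sqrtr_gt0 (lt_le_trans _ l1).
    apply: le_lt_trans (ler_norm T) _; rewrite /s -ltr_pdivrMr //.
    apply: le_lt_trans hA; rewrite ler_wpM2l //.
    rewrite -addrA addrCA lerDl addr_ge0 ?invr_ge0 ?(ltW dg0) //.
  case: hv => [[_ hv]|[_ hv]].
    apply: (aux (fun m A => (degree A ord0)%:R)
      (fun m A => Num.sqrt (logn m / (degree A ord0)%:R))) => // m A.
  apply: (aux (fun m A => (degree A ord0)%:R) (fun m A => (logn m `^ 3%:R^-1)^-1)) => // m A.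
  by rewrite invr_ge0 powR_ge0.
have near_h T : \forall m \near \oo, T <= h m.
  near=> m; apply: le_trans (ler_norm T) _.
  have sT : `|T| ^+ 2 ^+ 2 <= s m by apply: ltW; near: m; exact: near_s.
  have /ler_wsqrtr : Num.sqrt (`|T| ^+ 2 ^+ 2) <= Num.sqrt (s m) by exact: ler_wsqrtr.
  by rewrite !sqrtr_sqr normrX normr_id sqrtr_sqr normr_id.
have near_f : \forall m \near \oo, `|f (n m)| <= 1.
  have /cvgr0_norm_le := cvg_n _ fcvg; exact.
have near_rate e : 0 < e -> \forall m \near \oo, `|rate (n m)| <= e.
  by move=> e0; have /cvgr0_norm_le := cvg_n _ rate_cvg; exact.
have y_cvg : y m @[m --> \oo] --> (0 : R).
  rewrite -[0 : R]addr0; apply: cvgD.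
    by rewrite -[X in _ --> X](mulr0 (2 * C2)); apply: cvgMr; exact: cvg_n.
  rewrite (_ : (fun m => 3 * (rate (n m) / M0) * g) = fun m => (3 / M0 * g) * rate (n m)); last first.
    by apply/funext => m; ring.
  rewrite -[X in _ --> X](mulr0 (3 / M0 * g)); apply: cvgMr; exact: cvg_n.
have near_y e : 0 < e -> \forall m \near \oo, `|y m| <= e.
  by move=> e0; have /cvgr0_norm_le := y_cvg; exact.
have near_D1 : \forall m \near \oo, 16 * logn m <= D1 m * M0.
  case: hv => [[reg1 _]|[[reg2 _] _]].
    have /cvgryPge /(_ (16 / M0)) hD := reg1; near=> m.
    have : 16 / M0 <= D1 m / logn m by near: m.
    have l1 : 1 <= logn m by near: m.
    have l0 : 0 < logn m by apply: lt_le_trans l1.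
    by rewrite ler_pdivlMr // mulrAC ler_pdivrMr.
  near=> m; have := reg2 m.
  by rewrite -ler_pdivrMr // mulrAC.
(* [y] bounds the noise [w] plus the effect of the rate of convergence of [M_i], and [cl] is the
   lower constant of the gap. *)
exists (1 + 9 * K%:R * (16 * cu / ci) ^+ 2), (fun m => Num.sqrt (y m / cl)).
split.
- by rewrite ltr_wpDr // mulr_ge0 ?sqr_ge0 // mulr_ge0.
- have := @continuous_cvg _ _ _ _ _ (fun m => y m / cl) (@Num.sqrt R) 0.
  rewrite sqrtr0; apply; first exact: sqrt_continuous.
  by rewrite -[X in _ --> X](mul0r cl^-1); apply: cvgMl.
apply/cvgrPdist_le => e e0; near=> m.
have l1 : 1 <= logn m by near: m.
have l0 : 0 < logn m by apply: lt_le_trans l1.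
have sl0 : 0 < Num.sqrt (logn m) by rewrite sqrtr_gt0.
have D0m := D0 m.
have D1m u : D m ord0 <= D m u by exact: Dmono.
have Dbar0 : 0 < avg_weight (D m) by exact: avg_weight_gt0.
have SD : \sum_u D m u = (n m)%:R * avg_weight (D m).
  by rewrite mulrC divfK // pnatr_eq0.
pose mi i := Mvol B (sigma m) (D m) i / (\sum_l D m l).
have rate0 : 0 <= rate (n m) by apply: le_trans (normr_ge0 _) (Mrate m i0).
have rateM : rate (n m) <= M0.
  by apply: le_trans (ler_norm _) _; near: m; exact: near_rate.
have mM i : M0 <= mi i <= M i + M0.
  have /andP [h1 h2] : M i - rate (n m) <= mi i <= M i + rate (n m).
    by rewrite -ler_distl; exact: Mrate.
  by apply/andP; split; have := M2 i; lra.
have mi0 i : 0 < mi i by have /andP [/(lt_le_trans M00)] := mM i.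
have mib i : M0 <= mi i <= b.
  by have /andP [h1 h2] := mM i; rewrite h1 (le_trans h2).
have Bmb i j : B i j / (mi i * mi j) <= b.
  apply: le_trans (bB i j); rewrite ler_wpM2l // lef_pV2 ?posrE.
  - have /andP [mi1 _] := mM i; have /andP [mj1 _] := mM j.
    by rewrite expr2 ler_pM // ltW.
  - exact: mulr_gt0.
  - exact: exprn_gt0.
have rs u : \sum_v p m u v = D m u * mi (sigma m u).
  rewrite /mi SD /Mvol mulr_suml mulr_sumr; apply: eq_bigr => v _.
  by rewrite mxE; ring.
have p01 u v : 0 <= p m u v <= 1 by rewrite p1 edge_prob_ge0.
have cl1 : c1 * logn m * avg_weight (D m) <= D m ord0 ^+ 2.
  rewrite -ler_pdivlMr //; near: m; exact: hiv.
have l16 : 16 * logn m <= D m ord0 * M0 by near: m.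
pose eta := rate (n m) / M0.
have eta00 : 0 <= eta by rewrite divr_ge0 // ltW.
have rate2 : rate (n m) <= M0 / 2.
  by apply: le_trans (ler_norm _) _; near: m; apply: near_rate; rewrite divr_gt0.
have eta0 : 0 <= eta <= 2^-1 by rewrite eta00 ler_pdivrMr // mulrC.
have etaE i : `|M i / mi i - 1| <= eta.
  have /andP [m1 _] := mM i.
  rewrite (_ : _ - 1 = - ((mi i - M i) / mi i)); last by field; rewrite gt_eqF.
  rewrite normrN normrM normfV (gtr0_norm (mi0 i)) /eta.
  have iv : 0 <= (mi i)^-1 by rewrite invr_ge0 ltW.
  by apply: ler_pM => //; [exact: Mrate|rewrite lef_pV2 ?posrE].
have etag : 3 * eta * g <= ci / 2.
  have : rate (n m) <= ci * M0 / (6 * (g + 1)).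
    apply: le_trans (ler_norm _) _; near: m; apply: near_rate.
    by rewrite divr_gt0 // mulr_gt0.
  rewrite ler_pdivlMr ?mulr_gt0 // => hr.
  have : eta * (6 * (g + 1)) <= ci.
    by rewrite /eta mulrAC ler_pdivrMr.
  by move: eta00; move: (eta) => z z0 hz; lra.
have Kn : (K < n m)%N.
  apply: (@leq_trans m) (nm m); near: m; exact: nbhs_infty_ge.
have [gap Pnorm Prange] := hP _ (sigma m) (D m) Kn (blk m) Dbar0.
have f1 : `|f (n m)| <= 1 by near: m.
have hH : 1 + 2 * C2 * Gam <= h m by near: m; exact: near_h.
have CG0 : 0 <= 2 * C2 * Gam by rewrite !mulr_ge0 ?(ltW C20) // (le_trans ler01).
have h1 : 1 <= h m by apply: le_trans hH; rewrite lerDl.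
have h0 : 0 < h m by apply: lt_le_trans h1.
have s0 : 0 < s m by near: m; exact: near_s.
have h4 : h m ^+ 4 = f (n m) * Num.sqrt (logn m).
  rewrite -[4%N]/(2 * 2)%N exprM /h sqr_sqrtr ?sqrtr_ge0 // sqr_sqrtr //.
  exact: ltW.
have f0 : 0 < f (n m) by move: s0; rewrite /s pmulr_lgt0.
have f1' : f (n m) <= 1 by apply: le_trans (ler_norm _) f1.
pose w := C2 * (1 + h m) / Num.sqrt (logn m).
have w0 : 0 <= w by rewrite !mulr_ge0 ?invr_ge0 ?addr_ge0 ?(ltW C20) ?(ltW h0) ?(ltW sl0).
have h24 : h m ^+ 2 <= h m ^+ 4 by rewrite ler_weXn2l.
(* [1 + h <= 2 h ^ 4 = 2 f sqrt (log n)]. *)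
have hw : w <= 2 * C2 * f (n m).
  rewrite ler_pdivrMr // -[leRHS]mulrA -h4 [2 * C2]mulrC -[leRHS]mulrA.
  rewrite ler_wpM2l ?(ltW C20) //.
  have : h m <= h m ^+ 4 by rewrite ler_eXnr.
  by have : 1 <= h m ^+ 4 by [rewrite exprn_ege1|]; lra.
have wy : w + 3 * eta * g <= y m by rewrite /y lerD2r.
(* Two powers of [h] pay for [(1 + h) h <= 2 h ^ 2]; the other two absorb the constant
   [2 C2 Gam]. *)
have wf : w * (1 + 16 * b / ci) <= f (n m) / h m.
  rewrite -/Gam ler_pdivlMr // /w mulrAC -mulrA mulrAC.
  rewrite ler_pdivrMr // -h4.
  apply: le_trans (_ : (2 * C2 * Gam) * h m ^+ 2 <= _).
    rewrite [leLHS](_ : _ = C2 * Gam * ((1 + h m) * h m)); last by ring.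
    rewrite [leRHS](_ : _ = C2 * Gam * (2 * h m ^+ 2)); last by ring.
    rewrite ler_wpM2l ?mulr_ge0 ?(ltW C20) ?(le_trans ler01) //.
    by rewrite expr2; nra.
  rewrite (_ : h m ^+ 4 = h m ^+ 2 * h m ^+ 2); last by rewrite -exprD.
  rewrite ler_wpM2r ?sqr_ge0 //; apply: le_trans (_ : h m <= _).
    by apply: le_trans hH; rewrite lerDr.
  by rewrite ler_eXnr.
have wci : w + 3 * eta * g <= ci / 32.
  apply: le_trans wy _; apply: le_trans (ler_norm _) _; near: m.
  by apply: near_y; rewrite divr_gt0.
have wcl : (w + 3 * eta * g) / cl <= 1.
  rewrite ler_pdivrMr // mul1r.
  apply: le_trans wy _; apply: le_trans (ler_norm _) _; near: m; exact: near_y.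
have P'norm v : euclid_norm (v *m Pmx B mi (sigma m) (D m)) <=
    b / avg_weight (D m) * euclid_norm v.
  apply: Pmx_norm_le => //; first exact: ltW.
  move=> i j; rewrite mxE ger0_norm //.
  apply: divr_ge0 => //; apply: ltW; exact: mulr_gt0.
have := hC2 _ _ B (sigma m) (D m) mi (h m) B_sym B_ge0 D0m D1m (p1 m) mib Bmb rs
  cl1 l16 l1 h0.
set good := (X in graph_pr _ X) => hgood.
have {hgood} : 1 - (2 / (n m)%:R + h m ^- 2 + b / h m) <= graph_pr (p m) (fun A =>
    let err := embedding_error B M (sigma m) (D m) A in
    err <= Num.sqrt (y m / cl) /\
    forall (L : nat) (X : 'M[R]_(n m, L)),
      spectral_embedding A (f (n m)) X ->
      exists t : 'I_K -> 'rV[R]_L,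
        #|[pred u | ~~ (euclid_norm (Num.sqrt (n m)%:R *: row u X
                                     - t (sigma m u)) <=
                        (1 + 9 * K%:R * (16 * cu / ci) ^+ 2) * err)]|%:R
          <= (1 + 9 * K%:R * (16 * cu / ci) ^+ 2) * ((n m)%:R * err)).
  apply: le_trans hgood _; apply: graph_pr_le => // A sA [deg0 avgh W'].
  have W'norm v : euclid_norm (v *m Wmx B mi (sigma m) (D m) A) <=
      w / avg_weight (D m) * euclid_norm v.
    by apply: le_trans (W' v) _; rewrite /w invfM !mulrA.
  have [e1 e2] := embedding_conclusion B_sym M_gt0 mi0 Dbar0 sA cl0 ci0 g0 gap Pnorm
    Prange P'norm (ltW b0) w0 W'norm eta0 etaE etag h0 deg0 avgh wf wci wcl.
  split=> //; apply: le_trans e1 _; rewrite ler_wsqrtr // ler_wpM2r ?invr_ge0 //.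
  exact: ltW.
set pr := graph_pr _ _ => hpr.
have pr1 : pr <= 1 by exact: graph_pr_le1.
rewrite ger0_norm ?subr_ge0 // lerBlDr -lerBlDl.
apply: le_trans hpr; rewrite lerD2l lerN2.
(* By [f <= 1], [h <= h ^ 4 <= sqrt (log n) <= n]. The term [2 / n] is then at most [2 / h], and the
   total failure probability is at most [(3 + b) / h]. *)
have hN : h m <= (n m)%:R.
  apply: le_trans (_ : h m ^+ 4 <= _); first by rewrite ler_eXnr.
  rewrite h4; apply: le_trans (_ : 1 * Num.sqrt (logn m) <= _).
    by rewrite ler_wpM2r // ltW.
  rewrite mul1r; apply: le_trans (_ : logn m <= _).
    rewrite -[leRHS]sqr_sqrtr ?(ltW l0) // ler_eXnr //.
    by rewrite -[leLHS]sqrtr1 ler_wsqrtr.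
  rewrite -[leRHS]lnK ?posrE // -/(logn m).
  by apply: le_trans (expR_ge1Dx _); rewrite lerDr.
apply: le_trans (_ : (3 + b) / h m <= _).
  rewrite (_ : (3 + b) / h m = 2 / h m + (h m)^-1 + b / h m); last by ring.
  rewrite lerD2r; apply: lerD.
    by rewrite ler_wpM2l // lef_pV2 ?posrE.
  rewrite lef_pV2 ?posrE ?exprn_gt0 //; by rewrite ler_eXnr.
rewrite ler_pdivrMr // mulrC -ler_pdivrMr //; near: m; exact: near_h.
Unshelve. all: by end_near.
Qed.
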